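(* Let $m\geq2$, let $d_1\geq 2$ be an integer, and let $d_2,\ldots,d_m\in\mathbb{N}$ be such that $d_j\geq2$ for each $j=2,\ldots,m$. Let $h_1\in\mathcal{Y}_{d_1}$ with $\mathrm{int}(K(h_1))\neq\emptyset$ be such that $\langle h_1\rangle\in\mathcal{G}$. Let $b_2,b_3,\ldots,b_m\in\mathrm{int}(K(h_1))$. Then both of the following statements hold. 1. Suppose that $\langle h_1\rangle$ is semi-hyperbolic (resp. hyperbolic). Then there exists a number $c>0$ such that for each $(a_2,a_3,\ldots,a_m)\in\mathbb{C}^{m-1}$ with $0<|a_j|<c$ ($j=2,\ldots,m$), setting $h_j(z)=a_j(z-b_j)^{d_j}+b_j$ ($j=2,\ldots,m$), the polynomial semigroup $G=\langle h_1,\ldots,h_m\rangle$ satisfies that $G\in\mathcal{G}$, $\hat{K}(G)=K(h_1)$ and $G$ is semi-hyperbolic (resp. hyperbolic). 2. Suppose that $\langle h_1\rangle$ is semi-hyperbolic (resp. hyperbolic). Suppose also that either (i) there exists a $j\geq2$ with $d_j\geq3$, or (ii) $\deg(h_1)=3$, $b_2=\cdots=b_m$. Then there exist $a_2,a_3,\ldots,a_m>0$ such that setting $h_j(z)=a_j(z-b_j)^{d_j}+b_j$ ($j=2,\ldots,m$), the polynomial semigroup $G=\langle h_1,h_2,\ldots,h_m\rangle$ satisfies that $G\in\mathcal{G}_{dis}$, $\hat{K}(G)=K(h_1)$ and $G$ is semi-hyperbolic (resp. hyperbolic).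
   Context: $\hat{\mathbb{C}}$ is the Riemann sphere. For an integer $d\geq2$, $\mathcal{Y}_d$ is the set of polynomial maps of degree $d$. A polynomial semigroup is a semigroup, under composition, generated by a non-empty family of non-constant polynomial maps $\hat{\mathbb{C}}\to\hat{\mathbb{C}}$; $\langle h_1,\ldots,h_m\rangle$ is the semigroup generated by $h_1,\ldots,h_m$. The Fatou set $F(G)$ is the set of $z\in\hat{\mathbb{C}}$ having a neighborhood on which $G$ is a normal family; the Julia set is $J(G)=\hat{\mathbb{C}}\setminus F(G)$. $CV(g)$ is the set of critical values of $g:\hat{\mathbb{C}}\to\hat{\mathbb{C}}$, $P(G)=\overline{\bigcup_{g\in G}CV(g)}$ (closure in $\hat{\mathbb{C}}$), and $P^{\ast}(G)=P(G)\setminus\{\infty\}$. $\mathcal{G}$ is the set of all polynomial semigroups $G$ such that each element of $G$ has degree at least two and $P^{\ast}(G)$ is bounded in $\mathbb{C}$; $\mathcal{G}_{dis}$ is the set of $G\in\mathcal{G}$ with $J(G)$ disconnected. $\hat{K}(G)=\{z\in\mathbb{C}\mid\bigcup_{g\in G}\{g(z)\}\text{ is bounded in }\mathbb{C}\}$ and $K(g)=\hat{K}(\langle g\rangle)$. $\mathrm{int}$ denotes the set of interior points. $G$ is hyperbolic if $P(G)\subset F(G)$. $G$ is semi-hyperbolic if there exist $\delta>0$ and $N\in\mathbb{N}$ such that for each $y\in J(G)$ and each $g\in G$, $\deg(g:V\to B(y,\delta))\leq N$ for each connected component $V$ of $g^{-1}(B(y,\delta))$, where $B(y,\delta)$ is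 the ball of radius $\delta$ centered at $y$ in the spherical distance and $\deg$ is the degree of a finite branched covering. *)

(* Defs.v *)
From HB Require Import structures.
From mathcomp Require Export all_boot all_order all_algebra.
From mathcomp Require Export complex.
From mathcomp Require Export all_classical all_reals all_analysis.

Set Implicit Arguments.
Unset Strict Implicit.
Unset Printing Implicit Defensive.

Export Order.TTheory GRing.Theory Num.Theory.
Export numFieldNormedType.Exports.

Local Open Scope classical_set_scope.
Local Open Scope complex_scope.
Local Open Scope ring_scope.

(* The usual topology of the complex plane, given by the modulus; without this
   declaration [R[i]] carries no topology. *)
HB.instance Definition _ (R : realType) := NormedModule.copy R[i] (R[i]^o).

(* The Riemann sphere; [None] is the point at infinity. *)
Notation sphere R := (one_point_compactification R[i]).

Section SphericalDistance.
Variable R : realType.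
Implicit Types z w : sphere R.

(* Half of the Euclidean distance between the images of [z] and [w] under
   stereographic projection onto the unit sphere of R^3. *)
Definition half_chord z w : R :=
  match z, w with
  | Some x, Some y =>
      Normc.normc (x - y) /
      (Num.sqrt (1 + Normc.normc x ^+ 2) * Num.sqrt (1 + Normc.normc y ^+ 2))
  | Some x, None | None, Some x => (Num.sqrt (1 + Normc.normc x ^+ 2))^-1
  | None, None => 0
  end.

(* Geodesic distance of the spherical metric 2|dz|/(1+|z|^2); the diameter of
   the sphere is pi. *)
Definition sdist z w : R := 2 * asin (half_chord z w).

Definition sball z (r : R) : set (sphere R) := [set w | sdist z w < r].

End SphericalDistance.

(* Polynomial maps of the sphere are represented by polynomials: over the
   infinite field C the correspondence is bijective, and composition of maps is
   composition [\Po] of polynomials. *)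
Section PolynomialMaps.
Variable R : realType.
Implicit Types p g : {poly R[i]}.

Definition pdeg p : nat := (size p).-1.

Definition nonconstant p : Prop := (0 < pdeg p)%N.

Definition polyY (d : nat) : set {poly R[i]} := [set p | size p = d.+1].

Definition pmap p (z : sphere R) : sphere R :=
  match z with
  | Some x => Some p.[x]
  | None => if (0 < pdeg p)%N then None else Some p`_0
  end.

(* For nonconstant [p].  At infinity, in the coordinate 1/z, the map [p] has a
   zero of order [pdeg p]. *)
Definition local_degree p (z : sphere R) : nat :=
  match z with
  | Some x => mup x (p - p.[x]%:P)
  | None => pdeg p
  end.

(* Vanishing of the derivative, at infinity in the coordinate 1/z. *)
Definition critical_point p (z : sphere R) : Prop :=
  match z with
  | Some x => p^`().[x] = 0
  | None => (1 < pdeg p)%N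
  end.

Definition CV p : set (sphere R) := pmap p @` [set z | critical_point p z].

(* [n] is the degree of the branched covering [p : V -> B]: every point of [B]
   has [n] preimages in [V], counted with multiplicity. *)
Definition covering_degree p (V B : set (sphere R)) (n : nat) : Prop :=
  forall w, B w ->
    \big[addn/0%N]_(z \in V `&` pmap p @^-1` [set w]) local_degree p z = n.

End PolynomialMaps.

Section Semigroups.
Variable R : realType.
Implicit Types (H G : set {poly R[i]}) (g : {poly R[i]}).

Inductive generated H : set {poly R[i]} :=
| generated_gen g of H g : generated H g
| generated_comp f g of generated H f & generated H g : generated H (f \Po g).

Definition polynomial_semigroup G : Prop :=
  exists H, [/\ H !=set0, H `<=` @nonconstant R & G = generated H].

(* Every sequence in [F] has a subsequence converging uniformly on compact
   subsets of [U], for the spherical distance. *)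
Definition normal_family (U : set (sphere R))
    (F : set (sphere R -> sphere R)) : Prop :=
  forall f : nat -> sphere R -> sphere R, (forall n, F (f n)) ->
  exists phi : nat -> nat, {homo phi : k n / (k < n)%N} /\
  exists l : sphere R -> sphere R,
    forall K : set (sphere R), compact K -> K `<=` U ->
    forall e : R, 0 < e ->
      \forall n \near \oo, forall z, K z -> sdist (f (phi n) z) (l z) < e.

Definition Fatou G : set (sphere R) :=
  [set z | exists2 U, open_nbhs z U & normal_family U (@pmap R @` G)].

Definition Julia G : set (sphere R) := ~` Fatou G.

Definition postcritical G : set (sphere R) := closure (\bigcup_(g in G) CV g).

Definition planar_postcritical G : set R[i] := Some @^-1` postcritical G.

Definition classG : set (set {poly R[i]}) :=
  [set G | [/\ polynomial_semigroup G,
               forall g, G g -> (2 <= pdeg g)%N &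
               bounded_set (planar_postcritical G)]].

Definition classG_dis : set (set {poly R[i]}) :=
  [set G | classG G /\ ~ connected (Julia G)].

Definition Khat G : set R[i] :=
  [set z | bounded_set [set g.[z] | g in G]].

Definition filled_Julia g : set R[i] := Khat (generated [set g]).

Definition hyperbolic G : Prop := postcritical G `<=` Fatou G.

Definition semi_hyperbolic G : Prop :=
  exists (delta : R) (N : nat), 0 < delta /\
  forall y g, Julia G y -> G g ->
  forall z, (pmap g @^-1` sball y delta) z ->
  exists2 n, (n <= N)%N &
    covering_degree g (connected_component (pmap g @^-1` sball y delta) z)
      (sball y delta) n.

End Semigroups.

Arguments polyY {R} d.
Arguments classG {R}.
Arguments classG_dis {R}.

(* Main.v *)
Require Import Defs.
From mathcomp Require Import ring lra zify.

(* Let K be the filled Julia set of h_1.  For small a_j each h_j maps K into a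
   small disc about b_j inside int K.  Hence G preserves K, so that
   Khat(G) = K, and the finite critical values of the elements of G lie in K.

   (Semi-)hyperbolicity of h_1 bounds the number of zeros of A - y in the
   components V of A^-1(B(y, del)), for A an iterate of h_1 and y in the
   boundary of K.  Factoring A - y over its zeros in V and applying the minimum
   principle to the zero-free cofactor shows that pullbacks of small discs are
   uniformly small; in particular the orbit under h_1 of a compact part of
   int K stays away from the boundary of K.  An element of G is either an
   iterate of h_1 or of the form A o h_j o g'.  Pulling a small disc near the
   boundary of K back under A gives a small set away from h_j(K), over which
   h_j o g' is injective on components, since there it has no critical values.
   Discs far from K contain no critical values at all.

   For the disconnectedness the a_j of one group of maps tend to 0 while the
   others are fixed.  Then the points sent into K by the maps of the first
   group and the points sent to the basin of infinity by the other maps overlap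
   in an annulus, which lies in F(G) and separates the Julia set of h_1 from
   that of the maps of the first group. *)

Set Implicit Arguments.
Unset Strict Implicit.
Unset Printing Implicit Defensive.

Local Open Scope classical_set_scope.
Local Open Scope complex_scope.
Local Open Scope ring_scope.

(** All function theory is reduced to polynomials. The formula |p(x)| = |lc| prod |x - z| over the
    roots z of p gives an open mapping property uniform in x, hence the maximum and minimum
    principles and Montel's theorem. Degrees of coverings are counts of zeros in a component,
    constant over a connected base by continuity of roots. Monodromy over a disc without critical
    values comes from enlarging a radius of injectivity, not from lifting paths.

    The obstacle is that words of G contain arbitrarily many factors and degrees multiply. A bound
    independent of the word arises because only the iterate A applied after the last h_j
    contributes: zeros of A o q - w are grouped by the zeros u of A - w, and each u carries at most
    one zero of q - u in the component.

    For the second statement the a_j are also kept below the threshold of the first, so that only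
    disconnectedness remains to be shown. At scale rho, the maps outside the chosen group reach size
    rho from size rho^(1/e1), while those inside keep a disc of size rho^((e-1)/e) in K. The degree
    hypotheses yield 1/e1 < (e-1)/e. *)

Local Notation nm := Normc.normc.

(** * The modulus and the topology of the complex plane *)

Section Modulus.
Variable R : realType.
Local Notation C := R[i].
Implicit Types x y z : C.

Lemma normC_nm z : `|z| = (nm z)%:C.
Proof. by rewrite normc_def; case: z. Qed.

Lemma nm_ge0 z : 0 <= nm z.
Proof. by case: z => a b /=; rewrite sqrtr_ge0. Qed.

Lemma nm_eq0 z : (nm z == 0) = (z == 0).
Proof.
by apply/eqP/eqP => [/Normc.eq0_normc//|->]; rewrite Normc.normc0.
Qed.

Lemma nm_gt0 z : (0 < nm z) = (z != 0).
Proof. by rewrite lt_def nm_ge0 andbT nm_eq0. Qed.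

Lemma nmN z : nm (- z) = nm z.
Proof. by apply: complexI; rewrite -!normC_nm normrN. Qed.

Lemma nmB x y : nm (x - y) = nm (y - x).
Proof. by rewrite -nmN opprB. Qed.

Lemma nmD x y : nm (x + y) <= nm x + nm y.
Proof. by rewrite -lecR rmorphD/= -!normC_nm ler_normD. Qed.

Lemma nm_tri y x z : nm (x - z) <= nm (x - y) + nm (y - z).
Proof. by have := nmD (x - y) (y - z); rewrite addrA subrK. Qed.

Lemma nm_leD x y : nm x <= nm y + nm (x - y).
Proof. by have := nmD y (x - y); rewrite addrC subrK. Qed.

Lemma nmX z n : nm (z ^+ n) = nm z ^+ n.
Proof.
elim: n => [|n IH]; first by rewrite !expr0 Normc.normc1.
by rewrite !exprS Normc.normcM IH.
Qed.

Lemma nm_prod (I : Type) (s : seq I) (F : I -> C) :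
  nm (\prod_(i <- s) F i) = \prod_(i <- s) nm (F i).
Proof.
elim: s => [|i s IH]; first by rewrite !big_nil Normc.normc1.
by rewrite !big_cons Normc.normcM IH.
Qed.

Lemma nm_real (r : R) : nm r%:C = `|r|.
Proof. by rewrite /= expr0n addr0 sqrtr_sqr. Qed.

Lemma nm_Re z : `|complex.Re z| <= nm z.
Proof. by rewrite -lecR -normC_nm normc_ge_Re. Qed.

Lemma nm_Im z : `|complex.Im z| <= nm z.
Proof.
by case: z => a b /=; rewrite -sqrtr_sqr ler_wsqrtr// lerDr sqr_ge0.
Qed.

Lemma nm_le_ReIm z : nm z <= `|complex.Re z| + `|complex.Im z|.
Proof.
case: z => a b /=; rewrite -[leRHS]ger0_norm ?addr_ge0//.
rewrite -(sqrtr_sqr (`|a| + `|b|)) ler_wsqrtr//.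
rewrite sqrrD !real_normK ?num_real// lerD2r lerDl.
by rewrite mulrn_wge0// mulr_ge0.
Qed.

Definition disc x (r : R) : set C := [set z | nm (z - x) < r].

Lemma disc_center x r : 0 < r -> disc x r x.
Proof. by rewrite /disc /= subrr Normc.normc0. Qed.

Lemma nbhs_discP x (A : set C) :
  nbhs x A <-> exists2 r, 0 < r & disc x r `<=` A.
Proof.
split.
  move=> /nbhs_ballP[e /= e0 h].
  (* In the partial order of [C], [0 < e] forces the imaginary part of [e] to vanish. *)
  have [er Re0] : e = (complex.Re e)%:C /\ 0 < complex.Re e.
    by case: e e0 {h} => a b; rewrite ltcE /= => /andP[/eqP -> ?].
  exists (complex.Re e) => // z zx; apply: h.
  by rewrite -ball_normE /= er distrC normC_nm ltcR.
move=> [e e0 h]; apply/nbhs_ballP; exists (e%:C); first by rewrite /= ltcR.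
by move=> z; rewrite -ball_normE /= distrC normC_nm ltcR; exact: h.
Qed.

Lemma open_discP (A : set C) :
  open A <-> forall x, A x -> exists2 r, 0 < r & disc x r `<=` A.
Proof.
rewrite openE; split=> h x Ax.
  by have /nbhs_discP := h _ Ax.
by apply/nbhs_discP; exact: h.
Qed.

Lemma open_disc x r : open (disc x r).
Proof.
apply/open_discP => z zx; exists (r - nm (z - x)).
  by rewrite subr_gt0.
move=> w; rewrite /disc /= => h; rewrite (le_lt_trans (nm_tri z _ _))//.
by rewrite -ltrBrDr.
Qed.

Lemma interior_discP (A : set C) x :
  A° x <-> exists2 r, 0 < r & disc x r `<=` A.
Proof. exact: nbhs_discP. Qed.

Lemma closure_discP (A : set C) x :
  closure A x <-> forall r, 0 < r -> exists2 z, A z & nm (z - x) < r.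
Proof.
split=> [h r r0|h B /nbhs_discP[r r0 rB]].
  have /h [z [Az zr]] : nbhs x (disc x r) by apply/nbhs_discP; exists r.
  by exists z.
by have [z Az zx] := h _ r0; exists z; split=> //; exact: rB.
Qed.

Lemma closed_discP (A : set C) :
  closed A <-> forall x, (forall r, 0 < r -> exists2 z, A z & nm (z - x) < r) -> A x.
Proof.
by split=> h x; [move=> /closure_discP; exact: h|move=> /closure_discP; exact: h].
Qed.

Lemma continuous_complex (S : topologicalType) (f : S -> R) (g : S -> R) :
  continuous f -> continuous g -> continuous (fun s => (f s +i* g s)%C).
Proof.
move=> cf cg s; apply/cvgrPdist_lt => /= e.
case: e => e e'; rewrite ltcE /= => /andP[/eqP -> e0].
have e20 : 0 < e / 2 by rewrite divr_gt0.
have /cvgrPdist_lt /(_ _ e20) hf := cf s.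
have /cvgrPdist_lt /(_ _ e20) hg := cg s.
near=> t.
rewrite normC_nm ltcR (le_lt_trans (nm_le_ReIm _))//= [ltRHS]splitr ltrD//.
  by near: t.
by near: t.
Unshelve. all: by end_near. Qed.

(** Heine-Borel: [K] is closed in the image of the square [-M, M]^2 under (a, b) -> a + ib. *)
Lemma bounded_closed_compactC (K : set C) (M : R) :
  closed K -> (forall z, K z -> nm z <= M) -> compact K.
Proof.
move=> cK bK.
pose I : set R := `[- M, M]%classic.
have cI : compact (I `*` I) by apply: compact_setX; exact: segment_compact.
have cf : continuous (fun p : R * R => (p.1 +i* p.2)%C : C).
  by apply: continuous_complex => p; [exact: cvg_fst|exact: cvg_snd].
have cim := continuous_compact (continuous_subspaceT cf) cI.
apply: (subclosed_compact cK cim) => z Kz; exists (complex.Re z, complex.Im z) => //=.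
  split; rewrite /I /= in_itv /= -ler_norml.
    exact: le_trans (nm_Re _) (bK _ Kz).
  exact: le_trans (nm_Im _) (bK _ Kz).
by case: z {Kz}.
Qed.

Definition continuous_at_eps (f : C -> R) x :=
  forall e, 0 < e -> exists2 d, 0 < d & forall z, nm (z - x) < d -> `|f z - f x| < e.

Lemma continuous_epsP (f : C -> R) x : continuous_at_eps f x -> {for x, continuous f}.
Proof.
move=> h A /nbhs_ballP[e /= e0 eA]; have [d d0 hd] := h _ e0.
apply/nbhs_discP; exists d => // z zx; apply: eA.
by rewrite -ball_normE /= distrC; exact: hd.
Qed.

Lemma EVT_maxC (K : set C) (M : R) (f : C -> R) :
  closed K -> (forall z, K z -> nm z <= M) -> K !=set0 ->
  (forall x, continuous_at_eps f x) ->
  exists2 c, K c & forall z, K z -> f z <= f c.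
Proof.
move=> cK bK K0 cf.
have [|c /set_mem Kc h] := compact_EVT_max K0 (bounded_closed_compactC cK bK) (f:=f).
  by apply: continuous_subspaceT => x; exact: continuous_epsP.
by exists c => // z /mem_set; exact: h.
Qed.

Lemma EVT_minC (K : set C) (M : R) (f : C -> R) :
  closed K -> (forall z, K z -> nm z <= M) -> K !=set0 ->
  (forall x, continuous_at_eps f x) ->
  exists2 c, K c & forall z, K z -> f c <= f z.
Proof.
move=> cK bK K0 cf.
have [|c Kc h] := @EVT_maxC K M (fun z => - f z) cK bK K0.
  move=> x e e0; have [d d0 hd] := cf x _ e0; exists d => // z /hd.
  by rewrite -opprD normrN.
by exists c => // z /h; rewrite lerN2.
Qed.

Lemma closed_cball (x : C) (M : R) : closed [set z : C | nm (z - x) <= M].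
Proof.
apply/closed_discP => y h /=; rewrite leNgt; apply/negP => yM.
have [z /= zM zy] := h _ (eqbRL (subr_gt0 _ _) yM).
by have := nm_tri z y x; rewrite (nmB y z); lra.
Qed.

Lemma compact_cball (M : R) : compact [set z : C | nm z <= M].
Proof.
apply: (@bounded_closed_compactC _ M) => //.
have -> : [set z : C | nm z <= M] = [set z : C | nm (z - 0) <= M].
  by apply/seteqP; split=> z /=; rewrite subr0.
exact: closed_cball.
Qed.

(** Bolzano-Weierstrass in the form of a cluster point, which avoids extracting subsequences. *)
Lemma bounded_cluster (u : nat -> C) (M : R) : (forall n, nm (u n) <= M) ->
  exists p, forall e, 0 < e -> forall N, exists2 n, (N <= n)%N & nm (u n - p) < e.
Proof.
move=> bu.
have cK := @compact_cball M.
have [|p [_ hp]] := cK (u @ \oo) _.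
  by exists 0%N => // n _; exact: bu.
exists p => e e0 N.
have h1 : (u @ \oo) (u @` [set n | (N <= n)%N]) by exists N => // n /= Nn; exists n.
have h2 : nbhs p (disc p e) by apply/nbhs_discP; exists e.
by have [_ [[n /= Nn <-] un]] := hp _ _ h1 h2; exists n.
Qed.

End Modulus.

(** * Roots and the maximum principle *)

Section PolynomialRoots.
Variable R : realType.
Local Notation C := R[i].
Implicit Types (p q S : {poly C}) (x y z w : C).

Lemma poly_bound p (M : R) : exists2 B, 0 < B & forall z, nm z <= M -> nm p.[z] <= B.
Proof.
elim/poly_ind: p => [|p c [B B0 h]].
  by exists 1 => // z _; rewrite horner0 Normc.normc0.
exists (B * `|M| + nm c + 1) => [|z zM].
  by rewrite ltr_wpDl// addr_ge0 ?nm_ge0// mulr_ge0// ltW.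
rewrite !hornerE (le_trans (nmD _ _))// Normc.normcM -addrA lerD//; last by rewrite lerDl.
by rewrite ler_pM ?nm_ge0 ?h// (le_trans zM)// ler_norm.
Qed.

Lemma poly_lipschitz p (M : R) : exists2 L, 0 < L &
  forall z w, nm z <= M -> nm w <= M -> nm (p.[z] - p.[w]) <= L * nm (z - w).
Proof.
elim/poly_ind: p => [|p c [L L0 h]].
  by exists 1 => // z w _ _; rewrite !horner0 subr0 Normc.normc0 mul1r nm_ge0.
have [B B0 hB] := poly_bound p M.
exists (L * `|M| + B) => [|z w zM wM].
  by rewrite ltr_wpDl// mulr_ge0// ltW.
rewrite !hornerE.
have -> : p.[z] * z + c - (p.[w] * w + c) = (p.[z] - p.[w]) * z + p.[w] * (z - w) by ring.
rewrite (le_trans (nmD _ _))// !Normc.normcM mulrDl lerD//; last first.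
  by rewrite ler_wpM2r ?nm_ge0 ?hB.
rewrite mulrAC; apply: ler_pM; rewrite ?nm_ge0//; first exact: h.
by rewrite (le_trans zM)// ler_norm.
Qed.

Lemma poly_continuous p x e : 0 < e ->
  exists2 d, 0 < d & forall z, nm (z - x) < d -> nm (p.[z] - p.[x]) < e.
Proof.
move=> e0; have [L L0 h] := poly_lipschitz p (nm x + 1).
exists (Num.min 1 (e / L)) => [|z]; first by rewrite lt_min ltr01 divr_gt0.
rewrite lt_min => /andP[zx1]; rewrite ltr_pdivlMr// => zxe.
rewrite (le_lt_trans (h _ _ _ _))//; last by rewrite mulrC.
- by have := nm_leD z x; lra.
- by rewrite lerDl.
Qed.

Lemma continuous_nm_poly p x : continuous_at_eps (fun z => nm p.[z]) x.
Proof.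
move=> e e0; have [d d0 h] := poly_continuous p x e0; exists d => // z /h zx.
rewrite ltr_norml; have := nm_leD p.[z] p.[x]; have := nm_leD p.[x] p.[z].
by rewrite (nmB p.[x]); lra.
Qed.

Lemma open_poly_preimage p (A : set C) : open A -> open [set z | A p.[z]].
Proof.
move=> /open_discP oA; apply/open_discP => x /= /oA [r r0 rA].
have [d d0 h] := poly_continuous p x r0.
by exists d => // z zx; apply: rA; exact: h.
Qed.

Definition rootseq p : seq C := sval (closed_field_poly_normal p).

Lemma rootseqE p : p = lead_coef p *: \prod_(z <- rootseq p) ('X - z%:P).
Proof. exact: svalP (closed_field_poly_normal p). Qed.

Lemma mem_rootseq p z : p != 0 -> (z \in rootseq p) = root p z.
Proof.
move=> p0; rewrite [in RHS](rootseqE p) rootZ ?lead_coef_eq0//.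
by rewrite root_prod_XsubC.
Qed.

Lemma size_rootseq p : p != 0 -> size (rootseq p) = (size p).-1.
Proof.
move=> p0; rewrite [in RHS](rootseqE p) size_scale ?lead_coef_eq0//.
by rewrite size_prod_XsubC.
Qed.

Lemma nm_horner p x :
  nm p.[x] = nm (lead_coef p) * \prod_(z <- rootseq p) nm (x - z).
Proof.
rewrite {1}(rootseqE p) hornerZ Normc.normcM horner_prod nm_prod.
by congr (_ * _); apply: eq_bigr => z _; rewrite !hornerE.
Qed.

Lemma prod_ge_exp (s : seq C) (F : C -> R) (e : R) : 0 <= e ->
  (forall z, z \in s -> e <= F z) -> e ^+ size s <= \prod_(z <- s) F z.
Proof.
move=> e0; elim: s => [|a s IH] h; first by rewrite big_nil.
rewrite big_cons exprS ler_pM ?exprn_ge0 ?h ?mem_head//.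
by apply: IH => z zs; apply: h; rewrite inE zs orbT.
Qed.

Lemma prod_le_exp (s : seq C) (F : C -> R) (e : R) : (forall z, 0 <= F z) ->
  (forall z, z \in s -> F z <= e) -> \prod_(z <- s) F z <= e ^+ size s.
Proof.
move=> F0; elim: s => [|a s IH] h; first by rewrite big_nil.
rewrite big_cons exprS ler_pM ?prodr_ge0 ?h ?mem_head//.
by apply: IH => z zs; apply: h; rewrite inE zs orbT.
Qed.

(** If all roots were at distance at least [e] from [x], the product over the roots would give
    |p(x)| >= |lc| e^deg. *)
Lemma near_root p x e : (1 < size p)%N -> 0 < e ->
  nm p.[x] < nm (lead_coef p) * e ^+ (size p).-1 ->
  exists2 z, root p z & nm (z - x) < e.
Proof.
move=> sp e0; have p0 : p != 0 by rewrite -size_poly_gt0 (leq_trans _ sp).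
rewrite nm_horner -size_rootseq// ltr_pM2l ?nm_gt0 ?lead_coef_eq0// => h.
apply: contrapT => nh; move: h; apply/negP; rewrite -leNgt.
apply: prod_ge_exp; first exact: ltW.
move=> z zr; rewrite leNgt; apply/negP => zx; apply: nh; exists z.
  by rewrite -mem_rootseq.
by rewrite nmB.
Qed.

Lemma size_subC p w : (1 < size p)%N -> size (p - w%:P) = size p.
Proof.
move=> sp; rewrite size_polyDl// size_polyN (leq_ltn_trans _ sp)//.
exact: size_polyC_leq1.
Qed.

Lemma lead_coef_subC p w : (1 < size p)%N -> lead_coef (p - w%:P) = lead_coef p.
Proof.
move=> sp; rewrite lead_coefDl// size_polyN (leq_ltn_trans _ sp)//.
exact: size_polyC_leq1.
Qed.

Lemma root_subC p w z : root (p - w%:P) z = (p.[z] == w).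
Proof. by rewrite rootE !hornerE subr_eq0. Qed.

(** Here [d] does not depend on [x], because [near_root] involves only the leading coefficient and
    the degree, and these are the same for all [p - w%:P]. *)
Lemma poly_open_uniform p e : (1 < size p)%N -> 0 < e ->
  exists2 d, 0 < d &
    forall x w, nm (w - p.[x]) < d -> exists2 z, nm (z - x) < e & p.[z] = w.
Proof.
move=> sp e0; exists (nm (lead_coef p) * e ^+ (size p).-1).
  rewrite mulr_gt0 ?exprn_gt0// nm_gt0 lead_coef_eq0 -size_poly_gt0.
  by rewrite (leq_trans _ sp).
move=> x w wx.
have [|||z] := @near_root (p - w%:P) x e.
- by rewrite size_subC.
- by [].
- by rewrite !hornerE nmB lead_coef_subC// size_subC.
by rewrite root_subC => /eqP <- zx; exists z.
Qed.

Lemma poly_open_image p (A : set C) : (1 < size p)%N -> open A ->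
  open [set p.[z] | z in A].
Proof.
move=> sp /open_discP oA; apply/open_discP => _ [x /oA [r r0 rA] <-].
have [d d0 h] := poly_open_uniform sp r0.
by exists d => // w /h [z zx <-]; exists z => //; exact: rA.
Qed.

(** By openness, the image of [V] contains a point obtained from [p.[x]] by a radial move outwards
    of length [d / 2]. *)
Lemma no_interior_max p (V : set C) x : (1 < size p)%N -> open V -> V x ->
  exists2 z, V z & nm p.[x] < nm p.[z].
Proof.
move=> sp /open_discP oV /oV [r r0 rV].
have [d d0 h] := poly_open_uniform sp r0.
suff [w wx xw] : exists2 w, nm (w - p.[x]) < d & nm p.[x] < nm w.
  by have [z zx pz] := h _ _ wx; exists z; [exact: rV|rewrite pz].
have d20 : 0 < d / 2 by rewrite divr_gt0.
have [->|px0] := eqVneq p.[x] 0.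
  exists (d / 2)%:C; rewrite ?subr0 ?Normc.normc0 nm_real ger0_norm ?ltW//; lra.
move: px0; rewrite -nm_gt0 => px0.
exists (p.[x] * (1 + d / 2 / nm p.[x])%:C).
  rewrite rmorphD rmorph1 mulrDr mulr1 addrAC subrr add0r.
  rewrite Normc.normcM nm_real ger0_norm ?divr_ge0 ?ltW//.
  by rewrite mulrCA divff ?gt_eqF//; lra.
rewrite Normc.normcM nm_real ger0_norm ?addr_ge0 ?divr_ge0 ?ltW//.
by rewrite mulrDr mulr1 mulrCA divff ?gt_eqF// mulr1 ltrDl.
Qed.

Lemma no_interior_min p (V : set C) x : (1 < size p)%N -> open V -> V x ->
  p.[x] != 0 -> exists2 z, V z & nm p.[z] < nm p.[x].
Proof.
move=> sp /open_discP oV /oV [r r0 rV]; rewrite -nm_gt0 => px0.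
have [d d0 h] := poly_open_uniform sp r0.
suff [w wx xw] : exists2 w, nm (w - p.[x]) < d & nm w < nm p.[x].
  by have [z zx pz] := h _ _ wx; exists z; [exact: rV|rewrite pz].
pose t := Num.min 1 (d / 2 / nm p.[x]).
have t0 : 0 < t by rewrite lt_min ltr01 !divr_gt0.
have t1 : t <= 1 by rewrite ge_min lexx.
have td : t * nm p.[x] <= d / 2 by rewrite -ler_pdivlMr// ge_min lexx orbT.
exists (p.[x] * (1 - t)%:C).
  rewrite rmorphB rmorph1 mulrBr mulr1 addrAC subrr add0r.
  by rewrite nmN Normc.normcM nm_real ger0_norm ?ltW// mulrC; lra.
rewrite Normc.normcM nm_real ger0_norm ?subr_ge0//.
by rewrite mulrBr mulr1 gtrDl oppr_lt0 mulr_gt0.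
Qed.

Lemma closure_bounded (V : set C) (M : R) :
  (forall z, V z -> nm z <= M) -> forall z, closure V z -> nm z <= M.
Proof.
move=> bV z /closure_discP h; rewrite leNgt; apply/negP => Mz.
have [w /bV wM wz] := h _ (eqbRL (subr_gt0 _ _) Mz).
by have := nm_leD z w; rewrite nmB; lra.
Qed.

(* For constant p the boundary point is supplied by the polynomial 'X. *)
Lemma max_principle p (V : set C) (M : R) x : open V ->
  (forall z, V z -> nm z <= M) -> V x ->
  exists2 z, closure V z /\ ~ V z & nm p.[x] <= nm p.[z].
Proof.
move=> oV bV Vx.
have main q : (1 < size q)%N ->
    exists2 z, closure V z /\ ~ V z & nm q.[x] <= nm q.[z].
  move=> sq.
  have [||||c Vc h] := @EVT_maxC R (closure V) M (fun z => nm q.[z]).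
  - exact: closed_closure.
  - exact: closure_bounded.
  - by exists x; exact: subset_closure.
  - by move=> z; exact: continuous_nm_poly.
  exists c; last exact/h/subset_closure.
  split=> // /(no_interior_max sq oV)[z /subset_closure /h]; rewrite leNgt => /negP.
  by [].
have [/main//|/size1_polyC ->] := ltnP 1 (size p).
have [|z zV _] := main 'X; first by rewrite size_polyX.
by exists z => //; rewrite !hornerC.
Qed.

Lemma min_principle p (V : set C) (M : R) x : open V ->
  (forall z, V z -> nm z <= M) -> V x -> (forall z, V z -> p.[z] != 0) ->
  exists2 z, closure V z /\ ~ V z & nm p.[z] <= nm p.[x].
Proof.
move=> oV bV Vx pV.
have [sp|/size1_polyC ->] := ltnP 1 (size p); last first.
  have [z zV _] := max_principle 'X oV bV Vx.
  by exists z => //; rewrite !hornerC.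
have [||||c Vc h] := @EVT_minC R (closure V) M (fun z => nm p.[z]).
- exact: closed_closure.
- exact: closure_bounded.
- by exists x; exact: subset_closure.
- by move=> z; exact: continuous_nm_poly.
exists c; last exact/h/subset_closure.
split=> // cV; have [z /subset_closure /h] := no_interior_min sp oV cV (pV _ cV).
by rewrite leNgt => /negP.
Qed.

Lemma poly_divX p x : exists q, p - p.[x]%:P = q * ('X - x%:P).
Proof.
by have /factor_theorem[q ->] : root (p - p.[x]%:P) x; [rewrite root_subC|exists q].
Qed.

(* The maximum principle bounds the difference quotient by its values on the
   circle of radius r. *)
Lemma bounded_poly_lipschitz p a (r M : R) : 0 < r ->
  (forall z, disc a (2 * r) z -> nm p.[z] <= M) ->
  forall z w, disc a r z -> disc a r w -> nm (p.[z] - p.[w]) <= 2 * M / r * nm (z - w).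
Proof.
move=> r0 bp z w az aw.
have M0 : 0 <= M by apply: le_trans (nm_ge0 _) (bp a _); apply: disc_center; rewrite mulr_gt0.
have [q qE] := poly_divX p w.
have pE u : p.[u] - p.[w] = q.[u] * (u - w).
  by have /(congr1 (horner^~ u)) := qE; rewrite !hornerE.
rewrite pE Normc.normcM ler_wpM2r ?nm_ge0//.
(* For points at least [r] apart the trivial bound 2M suffices; otherwise the circle of radius [r]
   about [w] encloses [z] and stays in the disc of radius [2 * r] about [a]. *)
case: (leP r (nm (z - w))) => [rzw|rzw].
  rewrite ler_pdivlMr// (le_trans (ler_wpM2l (nm_ge0 _) rzw))//.
  rewrite -Normc.normcM -pE (le_trans (nmD _ _))// nmN mulrDl mul1r.
  have lt2 u : disc a r u -> disc a (2 * r) u by rewrite /disc /=; lra.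
  by rewrite lerD ?bp//; exact: lt2.
have [||u [/closure_discP cu ncu] h] := @max_principle q (disc w r) (nm w + r) z (@open_disc _ w r).
- by move=> v; rewrite /disc /= => vw; have := nm_leD v w; lra.
- exact: rzw.
apply: le_trans h _.
have uw : nm (u - w) = r.
  apply/eqP; rewrite eq_le; apply/andP; split; last by rewrite leNgt; apply/negP.
  rewrite leNgt; apply/negP => ruw.
  have [v vw vu] := cu _ (eqbRL (subr_gt0 _ _) ruw).
  by move: vw; rewrite /disc /= => vw; have := nm_tri v u w; rewrite (nmB u v); lra.
rewrite ler_pdivlMr// -{1}uw -Normc.normcM -pE (le_trans (nmD _ _))// nmN.
rewrite mulrDl mul1r lerD// bp// /disc/=; move: aw; rewrite /disc /=; last by lra.
by have := nm_tri w u a; rewrite uw; lra.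
Qed.

End PolynomialRoots.

(** * Components of preimages and root counts *)

Section Components.
Variable R : realType.
Local Notation C := R[i].
Implicit Types (A : set C) (x y z w : C).

Lemma segment_connectedC x y :
  connected [set x + t%:C * (y - x) | t in `[0 : R, 1]%classic].
Proof.
apply: connected_continuous_connected; first exact: segment_connected.
apply: continuous_subspaceT.
have -> : (fun t : R => x + t%:C * (y - x)) =
   (fun t : R => ((complex.Re x + t * complex.Re (y - x)) +i*
                  (complex.Im x + t * complex.Im (y - x)))%C).
  apply/funext => t; case: x => a b; case: y => c d.
  by apply/eqP; rewrite eq_complex /= !mul0r subr0 addr0 !eqxx.
by apply: continuous_complex => t; apply: cvgD; do 1?[exact: cvg_cst];
  apply: cvgM; do 1?[exact: cvg_cst]; exact: cvg_id.
Qed.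

(** The source of connectedness for discs, for intersections of two discs through a common point,
    and for spherical discs read in the plane. *)
Definition star_shaped A x :=
  forall y, A y -> forall t : R, 0 <= t <= 1 -> A (x + t%:C * (y - x)).

Lemma star_shaped_connected A x : star_shaped A x -> connected A.
Proof.
move=> sA; pose I (y : C) := [set x + t%:C * (y - x) | t in `[0 : R, 1]%classic].
have -> : A = \bigcup_(y in A) I y.
  apply/seteqP; split=> [y Ay|z [y Ay [t /=]]].
    exists y => //; exists 1; first by rewrite /= in_itv /= ler01 lexx.
    by rewrite mul1r addrC subrK.
  by rewrite in_itv /= => t01 <-; exact: sA.
apply: bigcup_connected => [|y _]; last exact: segment_connectedC.
exists x => y _; exists 0; first by rewrite /= in_itv /= ler01 lexx.
by rewrite mul0r addr0.
Qed.

Lemma disc_star_shaped x r : star_shaped (disc x r) x.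
Proof.
move=> y; rewrite /disc /= => yr t /andP[t0 t1].
rewrite addrC addKr Normc.normcM nm_real ger0_norm//.
by rewrite (le_lt_trans _ yr)// ler_piMl// nm_ge0.
Qed.

Lemma disc_connected x r : connected (disc x r).
Proof. exact: star_shaped_connected (@disc_star_shaped x r). Qed.

Lemma convexI_connected A B x : star_shaped A x -> star_shaped B x ->
  connected (A `&` B).
Proof.
move=> sA sB; apply: (@star_shaped_connected _ x) => y [Ay By] t t01.
by split; [exact: sA|exact: sB].
Qed.

Lemma component_disc A x z p r : connected_component A x z ->
  disc p r `<=` A -> disc p r z -> disc p r `<=` connected_component A x.
Proof.
move=> xz pA pz; rewrite (same_connected_component xz).
exact: connected_component_max pz pA (@disc_connected p r).
Qed.

Lemma component_open A x : open A -> open (connected_component A x).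
Proof.
move=> /open_discP oA; apply/open_discP => z xz.
have [r r0 rA] := oA z (@connected_component_sub _ _ _ _ xz).
by exists r => //; apply: component_disc xz rA _; exact: disc_center.
Qed.

(** Consequently a boundary point of a component of the preimage of a disc is mapped outside the
    disc. *)
Lemma component_closure A x p : open A -> A p ->
  closure (connected_component A x) p -> connected_component A x p.
Proof.
move=> /open_discP oA /oA [r r0 rA] /closure_discP /(_ r r0) [z xz zp].
by apply: (component_disc xz rA zp); exact: disc_center.
Qed.

Lemma component_mono A B x : A `<=` B ->
  connected_component A x `<=` connected_component B x.
Proof.
move=> AB y [D [Dx DA cD] Dy]; exists D => //; split=> //.
exact: subset_trans AB.
Qed.

End Components.

(** * Continuity of roots and the number of zeros in a component *)

Section RootCount.
Variable R : realType.
Local Notation C := R[i].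
Implicit Types (p q : {poly C}) (V : set C) (x y z w : C).

Lemma seq_min (T : eqType) (s : seq T) (P : T -> R -> Prop) :
  (forall a r r', P a r -> r' <= r -> P a r') ->
  (forall a, a \in s -> exists2 r, 0 < r & P a r) ->
  exists2 r, 0 < r & forall a, a \in s -> P a r.
Proof.
move=> Pm; elim: s => [|a s IH] h; first by exists 1.
have [|r r0 hr] := IH; first by move=> x xs; apply: h; rewrite inE xs orbT.
have [r' r'0 hr'] := h a (mem_head _ _).
exists (Num.min r r') => [|x]; first by rewrite lt_min r0.
rewrite inE => /predU1P[->|/hr Px].
  by apply: Pm hr' _; rewrite ge_min lexx orbT.
by apply: Pm Px _; rewrite ge_min lexx.
Qed.

Local Notation Pr s := (\prod_(z <- s) ('X - z%:P)).

Lemma nm_horner_prod (s : seq C) x : nm (Pr s).[x] = \prod_(z <- s) nm (x - z).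
Proof.
by rewrite horner_prod nm_prod; apply: eq_bigr => z _; rewrite !hornerE.
Qed.

(* Closeness of two monic polynomials is measured on a circle |x| = M enclosing
   the roots; it passes to the quotients by factors with close roots, which
   allows induction on the degree. *)
Lemma roots_continuous (s : seq C) (M : R) : (forall z, z \in s -> nm z + 1 <= M) ->
  forall e, 0 < e -> exists2 d, 0 < d & forall s', size s' = size s ->
    (forall x, nm x = M -> nm ((Pr s).[x] - (Pr s').[x]) < d) ->
    exists t, [/\ perm_eq s' t, size t = size s &
      forall i, (i < size s)%N -> nm (s`_i - t`_i) < e].
Proof.
elim: s => [|z s IH] sM e e0.
  by exists 1 => // -[|//] _ _; exists [::].
have zM : nm z + 1 <= M by apply: sM; rewrite mem_head.
have [|d1 d10 h1] := IH _ e e0; first by move=> y ys; apply: sM; rewrite inE ys orbT.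
have [B B0 hB] := poly_bound (Pr (z :: s)) M.
(* [e1 <= 1 / 2] keeps the root [z'] paired with [z] at distance at least 1/2 from the circle, so
   dividing by [x - z'] costs a factor 2; the last bound makes the error [(z - z') * b] at most
   [d1 / 2]. *)
pose e1 := Num.min e (Num.min (1 / 2) (d1 / (4 * (B + 1)))).
have e10 : 0 < e1.
  by rewrite !lt_min e0 !divr_gt0// mulr_gt0// ltr_wpDl// ltW.
have e1e : e1 <= e by rewrite /e1 ge_min lexx.
have e12 : e1 <= 1 / 2 by rewrite /e1 !ge_min lexx !orbT.
have e1d : e1 * (B + 1) * 4 <= d1.
  have B4 : 0 < 4 * (B + 1) by lra.
  rewrite -mulrA [(B + 1) * 4]mulrC -ler_pdivlMr//.
  by rewrite /e1 !ge_min lexx !orbT.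
pose d := Num.min 1 (Num.min (d1 / 2) (e1 ^+ (size s).+1)).
have d0 : 0 < d by rewrite !lt_min ltr01 divr_gt0// exprn_gt0.
have d1' : d <= 1 by rewrite /d ge_min lexx.
have dd1 : d <= d1 / 2 by rewrite /d !ge_min lexx !orbT.
have de : d <= e1 ^+ (size s).+1 by rewrite /d !ge_min lexx !orbT.
exists d => // s' ss' hs'.
have M0 : 0 < M by rewrite (lt_le_trans _ zM)// ltr_wpDl// nm_ge0.
have circle u : closure (disc (0 : C) M) u -> ~ disc (0 : C) M u -> nm u = M.
  move=> /closure_discP cu; rewrite /disc /= subr0 => /negP; rewrite -leNgt => Mu.
  apply/eqP; rewrite eq_le Mu andbT leNgt; apply/negP => ltMu.
  have [v] := cu _ (eqbRL (subr_gt0 _ _) ltMu); rewrite /disc /= subr0 => vM vu.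
  by have := nm_leD u v; rewrite nmB; lra.
have hz : nm ((Pr (z :: s)).[z] - (Pr s').[z]) < d.
  have [||u [cu nu]] := @max_principle _ (Pr (z :: s) - Pr s') _ M z (@open_disc _ (0 : C) M).
  - by move=> u; rewrite /disc /= subr0 => /ltW.
  - by rewrite /disc /= subr0 (lt_le_trans _ zM)// ltrDl.
  by rewrite !hornerD !hornerN => /le_lt_trans; apply; apply: hs'; exact: circle.
(* If all roots of [Pr s'] were at distance at least [e1] from [z], its modulus at [z] would be at
   least e1^(n+1) >= d, against [hz], as [z] is a root of the other product. *)
have [z' z's' zz'] : exists2 z', z' \in s' & nm (z - z') < e1.
  apply: contrapT => nh; move: hz; rewrite big_cons hornerM !hornerE subrr mul0r sub0r.
  rewrite nmN nm_horner_prod; apply/negP; rewrite -leNgt (le_trans de)//.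
  rewrite -[(size s).+1]/(size (z :: s)) -ss' prod_ge_exp ?ltW//.
  by move=> y ys'; rewrite leNgt; apply/negP => zy; apply: nh; exists y.
have ps' := perm_to_rem z's'.
have prod' x : (Pr s').[x] = (x - z') * (Pr (rem z' s')).[x].
  by rewrite (perm_big _ ps') /= big_cons hornerM !hornerE.
have [||t [pt st ht]] := h1 (rem z' s').
- by rewrite size_rem// ss'.
- move=> x xM; set a := (Pr s).[x]; set b := (Pr (rem z' s')).[x].
  have Pa : (Pr (z :: s)).[x] = (x - z) * a by rewrite big_cons hornerM !hornerE.
  have Pb : (Pr s').[x] = (x - z') * b by rewrite prod'.
  have xz : 1 <= nm (x - z) by have := nm_leD x z; lra.
  have xz' : 1 / 2 <= nm (x - z').
    by have := nm_tri z' x z; rewrite [nm (z' - z)]nmB; lra.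
  have hd := hs' _ xM.
  have b2 : nm b <= 2 * (B + 1).
    have : nm (Pr s').[x] <= B + 1.
      have := nm_leD (Pr s').[x] (Pr (z :: s)).[x]; rewrite [nm (_ - _)]nmB.
      by have := hB x; rewrite xM lexx => /(_ isT); lra.
    rewrite Pb Normc.normcM => hb.
    have : 1 / 2 * nm b <= nm (x - z') * nm b by rewrite ler_wpM2r// nm_ge0.
    by lra.
  have : nm (a - b) <= nm (x - z) * nm (a - b).
    by rewrite ler_peMl// nm_ge0.
  rewrite -Normc.normcM mulrBr -Pa.
  have -> : (Pr (z :: s)).[x] - (x - z) * b =
     ((Pr (z :: s)).[x] - (Pr s').[x]) + (z - z') * b by rewrite Pb; ring.
  move=> /le_lt_trans; apply; apply: (le_lt_trans (nmD _ _)).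
  rewrite (Normc.normcM (z - z')).
  have : nm (z - z') * nm b <= e1 * (2 * (B + 1)).
    by rewrite ler_pM ?nm_ge0// ltW.
  lra.
exists (z' :: t); split.
- by rewrite (perm_trans ps')// perm_cons.
- by rewrite /= st.
- by case=> [_|i] /=; [exact: lt_le_trans zz' e1e|rewrite ltnS; exact: ht].
Qed.

Lemma rootseqE_sub q w : (1 < size q)%N ->
  q - w%:P = lead_coef q *: Pr (rootseq (q - w%:P)).
Proof. by move=> sq; rewrite {1}(rootseqE (q - w%:P)) lead_coef_subC. Qed.

Lemma size_rootseq_sub q w : (1 < size q)%N ->
  size (rootseq (q - w%:P)) = (size q).-1.
Proof.
move=> sq; rewrite size_rootseq ?size_subC// -size_poly_gt0 size_subC//.
exact: leq_trans sq.
Qed.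

Lemma mem_rootseq_sub q w z : (1 < size q)%N ->
  (z \in rootseq (q - w%:P)) = (q.[z] == w).
Proof.
move=> sq; rewrite mem_rootseq ?root_subC// -size_poly_gt0 size_subC//.
exact: leq_trans sq.
Qed.

Lemma lead_coef_neq0 q : (1 < size q)%N -> lead_coef q != 0.
Proof. by move=> sq; rewrite lead_coef_eq0 -size_poly_gt0 (leq_trans _ sq). Qed.

Lemma rootseq_sub_perm q w s : (1 < size q)%N ->
  q - w%:P = lead_coef q *: Pr s -> perm_eq (rootseq (q - w%:P)) s.
Proof.
move=> sq h; apply: prod_XsubC_eq.
by apply: (scalerI (lead_coef_neq0 sq)); rewrite -h -rootseqE_sub.
Qed.

Lemma rootseq_sub_continuous q w0 e : (1 < size q)%N -> 0 < e ->
  exists2 d, 0 < d & forall w, nm (w - w0) < d ->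
  exists t, [/\ perm_eq (rootseq (q - w%:P)) t,
    size t = size (rootseq (q - w0%:P)) &
    forall i, (i < size t)%N -> nm ((rootseq (q - w0%:P))`_i - t`_i) < e].
Proof.
move=> sq e0; set s := rootseq _.
have [M hM] : exists M, forall z, z \in s -> nm z + 1 <= M.
  elim: s => [|a s [M IH]]; first by exists 0.
  exists (Num.max M (nm a + 1)) => z; rewrite inE => /predU1P[->|/IH zM].
    by rewrite le_max lexx orbT.
  by rewrite le_max zM.
have [d d0 h] := roots_continuous hM e0.
have l0 := lead_coef_neq0 sq.
exists (d * nm (lead_coef q)) => [|w ww0]; first by rewrite mulr_gt0// nm_gt0.
have [||t [pt st ht]] := h (rootseq (q - w%:P)).
- by rewrite !size_rootseq_sub.
- move=> x _.
  have hx : nm (lead_coef q) *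
      nm ((Pr (rootseq (q - w0%:P))).[x] - (Pr (rootseq (q - w%:P))).[x]) = nm (w - w0).
    rewrite -Normc.normcM mulrBr -!hornerZ -!rootseqE_sub// !hornerE.
    by congr nm; ring.
  have l1 : 0 < nm (lead_coef q) by rewrite nm_gt0.
  by have := ww0; rewrite -hx mulrC ltr_pM2r.
by exists t; split=> // i; rewrite st; exact: ht.
Qed.

(** Zeros of [q - w] in [V] with multiplicity: the degree of [q : V -> B] over [w] when [V] is a
    component of the preimage of [B]. *)
Definition cnt q V w : nat := count (fun z => z \in V) (rootseq (q - w%:P)).

Lemma cnt_mono q V V' w : V `<=` V' -> (cnt q V w <= cnt q V' w)%N.
Proof. by move=> VV'; apply: sub_count => z /set_mem /VV' /mem_set. Qed.

Lemma cnt_gt0 q V w : (1 < size q)%N ->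
  (0 < cnt q V w)%N <-> exists2 z, V z & q.[z] = w.
Proof.
move=> sq; rewrite /cnt -has_count; split.
  by move=> /hasP[z]; rewrite mem_rootseq_sub// => /eqP qz /set_mem Vz; exists z.
move=> [z Vz qz]; apply/hasP; exists z; last exact: mem_set.
by rewrite mem_rootseq_sub// qz.
Qed.

Lemma eq_count_nth (T : Type) (x0 : T) (a : pred T) s t : size s = size t ->
  (forall i, (i < size t)%N -> a (nth x0 s i) = a (nth x0 t i)) ->
  count a s = count a t.
Proof.
move=> st h; rewrite -![count a _](count_map a id).
congr count; apply: (@eq_from_nth _ false); rewrite !size_map// => i.
by rewrite st => it; rewrite !(nth_map x0) ?st// h.
Qed.

(** A small disc about a root of [q - w0] lies in the preimage of [B], so being connected it is
    contained in [V] or disjoint from it. For [w] near [w0] each root moves only inside its disc. *)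
Lemma cnt_locally_constant q (B : set C) x w0 : (1 < size q)%N -> open B -> B w0 ->
  let V := connected_component [set z | B q.[z]] x in
  exists2 d, 0 < d & forall w, nm (w - w0) < d -> cnt q V w = cnt q V w0.
Proof.
move=> sq oB Bw0 V; have oA := @open_poly_preimage _ q _ oB.
have [e e0 he] : exists2 e, 0 < e & forall z, z \in rootseq (q - w0%:P) ->
    disc z e `<=` [set z | B q.[z]].
  apply: seq_min => [z r r' rA r'r|z].
    by apply: subset_trans rA => u; rewrite /disc /= => /lt_le_trans; apply.
  rewrite mem_rootseq_sub// => /eqP qz; have /open_discP := oA; apply.
  by rewrite /= qz.
have [d d0 hd] := rootseq_sub_continuous w0 sq e0.
exists d => // w /hd [t [pt st ht]]; rewrite /cnt (permP pt).
apply: (@eq_count_nth _ 0) => // i is0.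
have it : (i < size t)%N by rewrite st.
have zi : (rootseq (q - w0%:P))`_i \in rootseq (q - w0%:P) by exact: mem_nth.
have := ht i it; set u := t`_i; set z := _`_i => zu; have := he _ zi; rewrite -/z => zA.
have uz : disc z e u by rewrite /disc /= nmB.
have zz : disc z e z by exact: disc_center.
apply/idP/idP => /set_mem h; apply/mem_set.
  exact: component_disc h zA uz _ zz.
exact: component_disc h zA zz _ uz.
Qed.

Lemma cnt_constant q (B : set C) x w w' : (1 < size q)%N -> open B -> connected B ->
  B w -> B w' ->
  cnt q (connected_component [set z | B q.[z]] x) w =
  cnt q (connected_component [set z | B q.[z]] x) w'.
Proof.
move=> sq oB cB Bw Bw'; set V := connected_component _ x.
pose D := [set u | B u /\ cnt q V u = cnt q V w'].
suff : D = B by move=> DB; have : D w by [rewrite DB]; case.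
have oD (P : nat -> Prop) : open [set u | B u /\ P (cnt q V u)].
  apply/open_discP => u [Bu Pu].
  have /open_discP /(_ u Bu) [r r0 rB] := oB.
  have [d d0 hd] := cnt_locally_constant x sq oB Bu.
  exists (Num.min r d) => [|v]; first by rewrite lt_min r0.
  by rewrite /disc /= lt_min => /andP[/rB Bv /hd ->].
apply: cB.
- by exists w'.
- exists D; first exact: (oD (fun n => n = _)).
  by rewrite setIidr// => u [].
- exists (~` [set u | B u /\ cnt q V u <> cnt q V w']).
    by apply: open_closedC; exact: (oD (fun n => n <> _)).
  apply/seteqP; split=> u [Bu Du]; split=> //; first by move=> [].
  by apply: contrapT => h; apply: Du.
Qed.

(** The count is positive over [q.[x]], hence over every point of [B]. *)
Lemma cnt_onto q (B : set C) x w : (1 < size q)%N -> open B -> connected B ->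
  B q.[x] -> B w -> exists2 z, connected_component [set z | B q.[z]] x z & q.[z] = w.
Proof.
move=> sq oB cB Bx Bw; apply/(cnt_gt0 _ _ sq).
rewrite (cnt_constant x sq oB cB Bw Bx); apply/(cnt_gt0 _ _ sq).
by exists x => //; exact: connected_component_refl.
Qed.

Lemma mup_rootseq p z : p != 0 -> mup z p = count_mem z (rootseq p).
Proof.
move=> p0; rewrite [in LHS](rootseqE p) -mul_polyC mupMr ?mu_prod_XsubC//.
by rewrite rootC lead_coef_eq0.
Qed.

Lemma cnt_le1 q V w : (1 < size q)%N ->
  (forall z z', V z -> V z' -> q.[z] = q.[z'] -> z = z') ->
  (forall z, V z -> q^`().[z] != 0) -> (cnt q V w <= 1)%N.
Proof.
move=> sq inj nc; rewrite /cnt leqNgt; apply/negP => h.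
have /hasP[z] : has (fun z => z \in V) (rootseq (q - w%:P)).
  by rewrite has_count ltnW.
rewrite mem_rootseq_sub// => /eqP qz /set_mem Vz.
have : (1 < count_mem z (rootseq (q - w%:P)))%N.
  apply: (leq_trans h); rewrite (@eq_in_count _ _ (pred1 z))// => u.
  rewrite mem_rootseq_sub// => /eqP qu /=.
  apply/idP/eqP => [/set_mem Vu|->]; last exact: mem_set.
  by apply: inj => //; rewrite qu.
have q0 : q - w%:P != 0 by rewrite -size_poly_gt0 size_subC// (leq_trans _ sq).
rewrite -mup_rootseq// mup_geq// => /dvdpP[k hk].
have := nc _ Vz; rewrite -[q](subrK w%:P) hk expr2 mulrA derivD derivC addr0 derivM.
by rewrite derivXsubC !hornerE subrr !mulr0 addr0 eqxx.
Qed.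

(** Substituting [q] into the factorisation of [p - w] shows that the roots of [p \Po q - w] are the
    roots of all [q - u], for [u] running through the roots of [p - w]. *)
Lemma cnt_comp p q V w : (1 < size p)%N -> (1 < size q)%N ->
  cnt (p \Po q) V w = \sum_(u <- rootseq (p - w%:P)) cnt q V u.
Proof.
move=> sp sq; set s := rootseq _.
have E : (p \Po q) - w%:P =
    lead_coef (p \Po q) *: Pr (flatten [seq rootseq (q - u%:P) | u <- s]).
  have -> : p \Po q - w%:P = (p - w%:P) \Po q by rewrite rmorphB /= comp_polyC.
  rewrite [in LHS](rootseqE_sub w sp) -/s comp_polyZ lead_coef_comp// -scalerA.
  congr (_ *: _).
  have -> : (size p).-1 = size s by rewrite size_rootseq_sub.
  elim: s => [|u s IH] /=; first by rewrite !big_nil expr0 scale1r rmorph1.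
  rewrite big_cons big_cat /= rmorphM /= IH rmorphB /= comp_polyX comp_polyC.
  by rewrite {1}(rootseqE_sub u sq) exprS -scalerA -scalerAl -scalerAr.
have spq : (1 < size (p \Po q))%N.
  have := size_comp_poly p q; case: (size p) sp (size q) sq => [|[|a]]// _ [|[|b]]// _ /=.
  by case: (size _) => [|[|c]].
rewrite /cnt (permP (rootseq_sub_perm spq E)).
elim: s {E} => [|u s IH] /=; first by rewrite big_nil.
by rewrite count_cat IH big_cons.
Qed.

End RootCount.

(** * Contraction of pullbacks; injectivity over discs without critical values *)

Section Contraction.
Variable R : realType.
Local Notation C := R[i].
Implicit Types (p q : {poly C}) (V : set C) (x y z w : C).

Lemma seq_argmin (T : eqType) (s : seq T) (F : T -> R) : s != [::] ->
  exists2 a, a \in s & forall b, b \in s -> F a <= F b.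
Proof.
elim: s => [//|a s IH _]; have [->|/IH [c cs hc]] := eqVneq s [::].
  by exists a; rewrite ?mem_head// => b; rewrite inE => /eqP ->.
have [ac|ca] := leP (F a) (F c).
  exists a; rewrite ?mem_head// => b; rewrite inE => /predU1P[->//|/hc].
  exact: le_trans.
exists c => [|b]; first by rewrite inE cs orbT.
by rewrite inE => /predU1P[->|/hc//]; exact: ltW.
Qed.

Lemma component_boundary q y (r : R) x z :
  let V := connected_component [set z | disc y r q.[z]] x in
  closure V z -> ~ V z -> r <= nm (q.[z] - y).
Proof.
move=> V cz nz; rewrite leNgt; apply/negP => qz; apply: nz.
by apply: component_closure => //; apply: open_poly_preimage; exact: open_disc.
Qed.

Lemma closure_diam V (D : R) : (forall z w, V z -> V w -> nm (z - w) <= D) ->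
  forall z w, closure V z -> V w -> nm (z - w) <= D.
Proof.
move=> h z w /closure_discP cz Vw; rewrite leNgt; apply/negP => Dzw.
have [u Vu uz] := cz _ (eqbRL (subr_gt0 _ _) Dzw).
by have := h _ _ Vu Vw; have := nm_tri u z w; rewrite (nmB z u); lra.
Qed.

(* Write q - y = S Q with Q the product of the factors whose roots lie in V.
   The minimum principle for S, which has no zero in V, bounds Q from above by
   the relative size of q - y. *)
Lemma contraction q y (del D : R) (N : nat) x z : (1 < size q)%N -> 0 < del -> 0 < D ->
  let V := connected_component [set z | disc y del q.[z]] x in
  (cnt q V y <= N)%N -> (forall z w, V z -> V w -> nm (z - w) <= D) -> V z ->
  exists2 u, V u /\ q.[u] = y & (nm (z - u) / D) ^+ N <= nm (q.[z] - y) / del.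
Proof.
move=> sq del0 D0 V cN bV Vz.
have oV : open V by apply: component_open; apply: open_poly_preimage; exact: open_disc.
pose rs := rootseq (q - y%:P).
pose s := [seq u <- rs | u \in V]; pose s' := [seq u <- rs | u \notin V].
pose S := lead_coef q *: \prod_(u <- s') ('X - u%:P).
pose Q := \prod_(u <- s) ('X - u%:P).
have SQ u : q.[u] - y = S.[u] * Q.[u].
  have -> : q.[u] - y = (q - y%:P).[u] by rewrite !hornerE.
  rewrite (rootseqE_sub y sq) -/rs -hornerM; congr (_.[u]).
  rewrite /S -scalerAl; congr (_ *: _); rewrite /Q /s /s' !big_filter mulrC.
  by rewrite (bigID (fun u => u \in V)).
have S0 u : V u -> S.[u] != 0.
  move=> Vu; rewrite /S hornerZ mulf_neq0 ?lead_coef_neq0// horner_prod.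
  rewrite prodf_seq_neq0; apply/allP => v; rewrite mem_filter => /andP[vV _] /=.
  rewrite !hornerE subr_eq0; apply: contraNneq vV => <-; exact: mem_set.
have [|p [cp np] Sp] := @min_principle _ S V (nm x + D) z oV _ Vz S0.
  move=> u Vu; have Vx : V x.
    apply: connected_component_refl.
    exact: (connected_component_sub (connected_component_sym Vu)).
  by have := nm_leD u x; have := bV _ _ Vu Vx; lra.
have qp := component_boundary cp np.
have sz : (size s <= N)%N by rewrite size_filter.
have Qp : nm Q.[p] <= D ^+ size s.
  rewrite nm_horner_prod prod_le_exp// => [u|u]; first exact: nm_ge0.
  by rewrite mem_filter => /andP[/set_mem Vu _]; exact: (closure_diam bV cp Vu).
have key : \prod_(u <- s) (nm (z - u) / D) <= nm (q.[z] - y) / del.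
  rewrite big_split /= big_const_seq count_predT iter_mulr mulr1 exprVn.
  rewrite -nm_horner_prod -/Q ler_pdivlMr// mulrAC ler_pdivrMr ?exprn_gt0//.
  rewrite SQ Normc.normcM [leLHS]mulrC [leRHS]mulrAC ler_wpM2r ?nm_ge0//.
  apply: (le_trans qp); rewrite SQ Normc.normcM.
  by rewrite ler_pM ?nm_ge0.
have lt1 : nm (q.[z] - y) / del < 1.
  by rewrite ltr_pdivrMr// mul1r; exact: (connected_component_sub Vz).
(* Without zeros in [V] the left side of [key] would be 1, while its right side is less than 1. *)
have [s0|/(seq_argmin (fun u => nm (z - u) / D)) [u us hu]] := eqVneq s [::].
  by move: key; rewrite s0 big_nil leNgt lt1.
have Vu : V u by move: us; rewrite mem_filter => /andP[/set_mem].
have qu : q.[u] = y.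
  by move: us; rewrite mem_filter => /andP[_]; rewrite mem_rootseq_sub// => /eqP.
exists u => //; apply: le_trans key.
have u0 : 0 <= nm (z - u) / D by rewrite divr_ge0 ?nm_ge0 ?ltW.
have u1 : nm (z - u) / D <= 1 by rewrite ler_pdivrMr// mul1r; exact: bV.
(* The ratio for the nearest zero [u] is at most 1, so its [N]-th power is at most its power of
   exponent [size s], which is at most the product in [key]. *)
apply: (le_trans (ler_wiXn2l u0 u1 sz)).
by apply: (@prod_ge_exp _ s (fun u => nm (z - u) / D)).
Qed.

End Contraction.

(** * Injectivity over discs without critical values *)

Section Monodromy.
Variable R : realType.
Local Notation C := R[i].
Implicit Types (q : {poly C}) (K V M : set C) (p x y z w : C).

Lemma connected_epsP K : connected K <->
  forall P : set C, K `&` P !=set0 ->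
  (forall w, K w -> P w -> exists2 d, 0 < d & forall v, K v -> nm (v - w) < d -> P v) ->
  (forall w, K w -> ~ P w -> exists2 d, 0 < d & forall v, K v -> nm (v - w) < d -> ~ P v) ->
  K `<=` P.
Proof.
split=> [cK P P0 oP cP|h B [b Bb] [U oU BU] [F cF BF]].
  have h (Q : set C) :
      (forall w, K w -> Q w -> exists2 d, 0 < d & forall v, K v -> nm (v - w) < d -> Q v) ->
      exists2 U, open U & K `&` Q = K `&` U.
    move=> hQ; exists [set v | exists w d, [/\ K w, Q w, nm (v - w) < d &
        forall u, K u -> nm (u - w) < d -> Q u]].
      apply/open_discP => v [w [d [Kw Qw vw hd]]].
      exists (d - nm (v - w)); first by rewrite subr_gt0.
      move=> u; rewrite /disc /= => uv; exists w, d; split=> //.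
      by have := nm_tri v u w; lra.
    apply/seteqP; split=> v [Kv]; last by move=> [w [d [_ _ vw hd]]]; split=> //; exact: hd.
    move=> Qv; split=> //; have [d d0 hd] := hQ v Kv Qv; exists v, d; split=> //.
    by rewrite subrr Normc.normc0.
  have [U oU KU] := h _ oP; have [W oW KW] := h (~` P) cP.
  suff -> : K = K `&` P by move=> v [].
  apply/esym/cK => //; first by exists U.
  exists (~` W); first exact: open_closedC.
  apply/seteqP; split=> v [Kv Pv]; split=> //.
    by move=> Wv; have [] : (K `&` ~` P) v by rewrite KW.
  apply: contrapT => nP; have [_] : (K `&` W) v by rewrite -KW.
  exact: Pv.
have BK : B `<=` K by rewrite BU => v [].
apply/seteqP; split=> //; apply: h; first by exists b; split=> //; exact: BK.
  move=> w Kw; rewrite BU => -[_ Uw]; have /open_discP /(_ _ Uw) [d d0 hd] := oU.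
  by exists d => // v Kv vw; split=> //; exact: hd.
move=> w Kw nB; have oF := closed_openC cF.
have Fw : (~` F) w by move=> Fw; apply: nB; rewrite BF.
have /open_discP /(_ _ Fw) [d d0 hd] := oF.
by exists d => // v Kv vw; rewrite BF => -[_]; exact: hd.
Qed.

(** Write q(z) - q(p) = k(z)(z - p), with k(p) = q'(p). If q(z) = q(w), then (z - w)k(z) = -(w -
    p)(k(z) - k(w)); the right side is at most rL|z - w| <= |z - w||k(p)|/4, whereas |k(z)| >
    |k(p)|/2. *)
Lemma local_injectivity q p : q^`().[p] != 0 -> exists2 r, 0 < r &
  forall z w, disc p r z -> disc p r w -> q.[z] = q.[w] -> z = w.
Proof.
move=> dq; have [k hk] := poly_divX q p.
have qE z : q.[z] - q.[p] = k.[z] * (z - p).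
  by have /(congr1 (horner^~ z)) := hk; rewrite !hornerE.
have kp : k.[p] = q^`().[p].
  have := congr1 deriv hk; rewrite derivB derivC subr0 derivM derivXsubC => ->.
  by rewrite !hornerE subrr mulr0 add0r.
have [L L0 hL] := poly_lipschitz k (nm p + 1).
have k0 : 0 < nm k.[p] by rewrite kp nm_gt0.
pose r := Num.min 1 (nm k.[p] / (4 * L)).
have r0 : 0 < r by rewrite lt_min ltr01 divr_gt0// mulr_gt0.
have r1 : r <= 1 by rewrite /r ge_min lexx.
have rL : r * L * 4 <= nm k.[p].
  by rewrite -mulrA [L * 4]mulrC -ler_pdivlMr ?mulr_gt0// /r ge_min lexx orbT.
exists r => // z w; rewrite /disc /= => zp wp qzw.
apply/eqP; rewrite -subr_eq0 -nm_eq0 eq_le nm_ge0 andbT leNgt; apply/negP => zw0.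
have E : (z - w) * k.[z] = - ((w - p) * (k.[z] - k.[w])).
  apply/eqP; rewrite -subr_eq0 opprK.
  have := qE w; rewrite -qzw qE => h.
  have -> : (z - w) * k.[z] + (w - p) * (k.[z] - k.[w]) =
    k.[z] * (z - p) - k.[w] * (w - p) by ring.
  by rewrite h subrr.
have bz u : nm (u - p) < r -> nm u <= nm p + 1 by have := nm_leD u p; lra.
have := congr1 (@nm R) E; rewrite nmN !Normc.normcM => E'.
have h1 := hL _ _ (bz _ zp) (bz _ wp).
have pp : nm p <= nm p + 1 by lra.
have h2 : nm (k.[z] - k.[p]) <= L * r.
  by apply: le_trans (hL _ _ (bz _ zp) pp) _; rewrite ler_wpM2l ?ltW.
have h3 := nm_leD k.[p] k.[z]; rewrite nmB in h2.
have kz : nm k.[p] / 2 < nm k.[z] by lra.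
have : nm (w - p) * nm (k.[z] - k.[w]) <= r * (L * nm (z - w)).
  by apply: ler_pM; rewrite ?nm_ge0//; exact: ltW.
rewrite -E' mulrA [r * L * _]mulrC ler_pM2l// => h4.
suff : (0 : R) < 0 by rewrite ltxx.
by lra.
Qed.

(** Openness of [q] makes the local inverse continuous, so connectedness of [K] passes to its lift
    in the disc. *)
Lemma local_lift q p (r : R) : (1 < size q)%N -> 0 < r ->
  (forall z w, disc p r z -> disc p r w -> q.[z] = q.[w] -> z = w) ->
  exists2 d, 0 < d & forall K, K `<=` disc q.[p] d -> connected K ->
    connected [set z | disc p r z /\ K q.[z]] /\
    forall w, K w -> exists2 z, disc p r z & q.[z] = w.
Proof.
move=> sq r0 inj; have [d d0 hd] := poly_open_uniform sq r0.
exists d => // K Kd cK.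
have lift w : K w -> exists2 z, disc p r z & q.[z] = w.
  by move=> /Kd wd; exact: hd.
split=> //; apply/connected_epsP => P [z0 [[z0p Kz0] Pz0]] oP cP z [zp Kz].
have op (Q : set C) :
    (forall w, disc p r w /\ K q.[w] -> Q w -> exists2 d, 0 < d &
      forall v, disc p r v /\ K q.[v] -> nm (v - w) < d -> Q v) ->
    forall w, K w -> (exists2 u, disc p r u & q.[u] = w /\ Q u) ->
    exists2 d, 0 < d & forall v, K v -> nm (v - w) < d ->
      exists2 u, disc p r u & q.[u] = v /\ Q u.
  move=> hQ w Kw [u up [qu Qu]]; subst w.
  have [//|e e0 he] := hQ u _ Qu.
  have /open_discP /(_ _ up) [s s0 hs] := @open_disc _ p r.
  have [|d1 d10 hd1] := poly_open_uniform sq (_ : 0 < Num.min e s).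
    by rewrite lt_min e0.
  exists d1 => // v Kv vu; have [u' + qu'] := hd1 _ _ vu.
  rewrite lt_min => /andP[ue us]; exists u'; first exact: hs.
  by split=> //; apply: he => //; rewrite qu'; split=> //; exact: hs.
have /connected_epsP hK := cK.
have [||||u up [qu Pu]] :=
  hK [set w | exists2 u, disc p r u & q.[u] = w /\ P u] _ _ _ q.[z].
- by exists q.[z0]; split=> //; exists z0.
- by move=> w Kw; exact: op.
- move=> w Kw nP; have [u up qu] := lift _ Kw.
  have nPu : ~ P u by move=> Pu; apply: nP; exists u.
  have [||d1 d10 hd1] := op (~` P) _ w Kw.
  + by move=> v [vp Kv] Pv; exact: cP.
  + by exists u.
  exists d1 => // v Kv vw [u1 u1p [qu1 Pu1]].
  have [u2 u2p [qu2 Pu2]] := hd1 _ Kv vw.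
  by apply: Pu2; rewrite -(inj u1 u2)// qu1.
- exact: Kz.
by rewrite (inj z u).
Qed.

Lemma bounded_cluster2 (u v : nat -> C) (M : R) :
  (forall n, nm (u n) <= M) -> (forall n, nm (v n) <= M) ->
  exists p p', forall e, 0 < e -> forall N,
    exists2 n, (N <= n)%N & nm (u n - p) < e /\ nm (v n - p') < e.
Proof.
move=> bu bv.
have cK := @compact_cball R M.
have cKK : compact ([set z : C | nm z <= M] `*` [set z : C | nm z <= M]).
  exact: compact_setX.
have [|[p p'] [_ hp]] := cKK ((fun n => (u n, v n)) @ \oo) _.
  by exists 0%N => // n _; split; [exact: bu|exact: bv].
exists p, p' => e e0 N.
have h1 : ((fun n => (u n, v n)) @ \oo) ((fun n => (u n, v n)) @` [set n | (N <= n)%N]).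
  by exists N => // n /= Nn; exists n.
have h2 : nbhs (p, p') (disc p e `*` disc p' e).
  by exists (disc p e, disc p' e) => //; split; apply/nbhs_discP; exists e.
by have [_ [[n /= Nn <-] [un vn]]] := hp _ _ h1 h2; exists n.
Qed.

Lemma poly_growth q : (1 < size q)%N -> exists c r : R, [/\ 0 < c, 0 < r &
  forall z, r <= nm z -> c * nm z ^+ (size q).-1 <= nm q.[z]].
Proof.
move=> sq; have [M M0 hM] : exists2 M, 0 < M & forall u, u \in rootseq q -> nm u <= M.
  elim: (rootseq q) => [|a s [M M0 IH]]; first by exists 1.
  exists (Num.max M (nm a)) => [|u]; first by rewrite lt_max M0.
  rewrite inE => /predU1P[->|/IH uM]; first by rewrite le_max lexx orbT.
  by rewrite le_max uM.
have q0 : q != 0 by rewrite -size_poly_gt0 (leq_trans _ sq).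
(* At |z| >= 2M, with [M] bounding the roots, every factor |z - u| is at least |z|/2. *)
exists (nm (lead_coef q) * 2^-1 ^+ (size q).-1), (2 * M); split.
- by rewrite mulr_gt0 ?exprn_gt0// nm_gt0 lead_coef_eq0.
- by rewrite mulr_gt0.
move=> z zM; rewrite nm_horner -mulrA ler_wpM2l ?nm_ge0// -exprMn -size_rootseq//.
apply: prod_ge_exp => [|u /hM uM]; first by rewrite mulr_ge0 ?nm_ge0.
by have := nm_leD z u; lra.
Qed.

Lemma poly_preimage_bounded q (M : R) : (1 < size q)%N ->
  exists B, forall z, nm q.[z] <= M -> nm z <= B.
Proof.
move=> sq; have [c [r [c0 r0 h]]] := poly_growth sq.
exists (Num.max (Num.max r 1) (M / c)) => z zM; rewrite leNgt; apply/negP.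
rewrite !gt_max => /andP[/andP[rz z1]]; rewrite ltr_pdivrMr//; apply/negP; rewrite -leNgt.
apply: (le_trans _ zM); apply: le_trans (h _ (ltW rz)); rewrite mulrC ler_pM2l//.
by rewrite -[leLHS]expr1 ler_eXn2l// -ltnS (ltn_predK sq).
Qed.

Lemma disc_convex x r a : disc x r a -> star_shaped (disc x r) a.
Proof.
rewrite /disc /= => ax y /= yx t /andP[t0 t1] /=.
have -> : a + t%:C * (y - a) - x = (1 - t)%:C * (a - x) + t%:C * (y - x).
  by rewrite rmorphB rmorph1; ring.
apply: (le_lt_trans (nmD _ _)); rewrite !Normc.normcM !nm_real !ger0_norm ?subr_ge0//.
have : (1 - t) * nm (a - x) <= (1 - t) * Num.max (nm (a - x)) (nm (y - x)).
  by rewrite ler_wpM2l ?subr_ge0// le_max lexx.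
have : t * nm (y - x) <= t * Num.max (nm (a - x)) (nm (y - x)).
  by rewrite ler_wpM2l// le_max lexx orbT.
have : Num.max (nm (a - x)) (nm (y - x)) < r by rewrite gt_max ax.
by set m := Num.max _ _; lra.
Qed.

Section SublevelComponents.
Variables (q : {poly C}) (y u0 : C).
Hypotheses (sq : (1 < size q)%N) (qu0 : q.[u0] = y).

Let V (r : R) := connected_component [set z | disc y r q.[z]] u0.
Let inj (r : R) := forall z w, V r z -> V r w -> q.[z] = q.[w] -> z = w.

Let Vmono r s : r <= s -> V r `<=` V s.
Proof. by move=> rs; apply: component_mono => z; rewrite /disc /= => /lt_le_trans; apply. Qed.

Let injmono r s : r <= s -> inj s -> inj r.
Proof. by move=> rs h z w /(Vmono rs) Vz /(Vmono rs); exact: h. Qed.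

Let Vu0 r : 0 < r -> V r u0.
Proof. by move=> r0; apply: connected_component_refl; rewrite /= qu0; exact: disc_center. Qed.

Let Vopen r : open (V r).
Proof. by apply: component_open; apply: open_poly_preimage; exact: open_disc. Qed.

(** By compactness: otherwise pairs of distinct points with equal values accumulate at p and p' in
    [M] with q(p) = q(p'). Then p = p', against local injectivity at p. *)
Let neighborhood_injective M (B : R) : closed M -> (forall z, M z -> nm z <= B) ->
  (forall z, M z -> q^`().[z] != 0) ->
  (forall z w, M z -> M w -> q.[z] = q.[w] -> z = w) ->
  exists2 s, 0 < s & forall z w m m', M m -> M m' -> nm (z - m) < s -> nm (w - m') < s ->
    q.[z] = q.[w] -> z = w.
Proof.
move=> cM bM dM iM; apply: contrapT => nh.
have /choice [f hf] : forall n : nat, exists t : (C * C) * (C * C),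
    [/\ M t.2.1, M t.2.2, nm (t.1.1 - t.2.1) < n.+1%:R^-1,
        nm (t.1.2 - t.2.2) < n.+1%:R^-1 & q.[t.1.1] = q.[t.1.2] /\ t.1.1 <> t.1.2].
  move=> n; apply: contrapT => nt; apply: nh; exists n.+1%:R^-1; first by rewrite invr_gt0.
  move=> z w m m' Mm Mm' zm wm' qzw; apply: contrapT => zw; apply: nt.
  by exists ((z, w), (m, m')).
have [p [p' hp]] := @bounded_cluster2 (fun n => (f n).2.1) (fun n => (f n).2.2) B
  (fun n => let: And5 h _ _ _ _ := hf n in bM _ h) (fun n => let: And5 _ h _ _ _ := hf n in bM _ h).
have near e : 0 < e -> exists n, [/\ nm ((f n).2.1 - p) < e, nm ((f n).2.2 - p') < e,
     nm ((f n).1.1 - p) < e & nm ((f n).1.2 - p') < e].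
  move=> e0; have e20 : 0 < e / 2 by rewrite divr_gt0.
  have [N Ne] : exists N : nat, N.+1%:R^-1 < e / 2.
    have [N _ hN] := near_infty_natSinv_lt (PosNum e20).
    by exists N; apply: hN => /=.
  have [n Nn [h1 h2]] := hp _ e20 N; exists n.
  have ne : n.+1%:R^-1 <= N.+1%:R^-1 :> R by rewrite lef_pV2 ?posrE// ler_nat ltnS.
  have [_ _ /lt_le_trans/(_ ne)/lt_trans/(_ Ne) h3 /lt_le_trans/(_ ne)/lt_trans/(_ Ne) h4 _] := hf n.
  have := nm_tri (f n).2.1 (f n).1.1 p; have := nm_tri (f n).2.2 (f n).1.2 p'.
  by split; lra.
have Mp : M p.
  move/closed_discP : cM; apply => r /near [n [h1 _ _ _]]; exists (f n).2.1 => //.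
  by have [] := hf n.
have Mp' : M p'.
  move/closed_discP : cM; apply => r /near [n [_ h1 _ _]]; exists (f n).2.2 => //.
  by have [] := hf n.
have qpp' : q.[p] = q.[p'].
  apply/eqP; rewrite -subr_eq0 -nm_eq0 eq_le nm_ge0 andbT leNgt; apply/negP => h.
  have h2 : 0 < nm (q.[p] - q.[p']) / 2 by rewrite divr_gt0.
  have [d d0 hd] := poly_continuous q p h2; have [d' d'0 hd'] := poly_continuous q p' h2.
  have [|n [_ _]] := near (Num.min d d'); first by rewrite lt_min d0.
  rewrite !lt_min => /andP[/hd h3 _] /andP[_ /hd' h4].
  have [_ _ _ _ [qq _]] := hf n; rewrite -qq in h4.
  have := nm_tri q.[(f n).1.1] q.[p] q.[p']; by rewrite (nmB q.[p] q.[(f n).1.1]); lra.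
have pp' := iM _ _ Mp Mp' qpp'; subst p'.
have [r r0 hr] := local_injectivity (dM _ Mp).
have [n [_ _ h1 h2]] := near _ r0; have [_ _ _ _ [qq nq]] := hf n.
by apply: nq; exact: hr.
Qed.

(* V r'' is kept inside a neighbourhood O of M on which q is injective, since
   |q - y| > r on the boundary of O. *)
Let extend M (B r : R) : closed M -> (forall z, M z -> nm z <= B) -> M u0 ->
  (forall z, M z -> q^`().[z] != 0) ->
  (forall z w, M z -> M w -> q.[z] = q.[w] -> z = w) ->
  (forall w, nm (w - y) <= r -> exists2 z, M z & q.[z] = w) ->
  exists2 r', r < r' & inj r'.
Proof.
move=> cM bM Mu0 dM iM sM.
have [s s0 hs] := neighborhood_injective cM bM dM iM.
have s20 : 0 < s / 2 by rewrite divr_gt0.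
pose O : set C := \bigcup_(m in M) disc m (s / 2).
have oO : open O by apply: bigcup_open => m _; exact: open_disc.
have MO : M `<=` O by move=> m Mm; exists m => //; exact: disc_center.
have cO z : closure O z -> exists2 m, M m & nm (z - m) < s.
  move=> /closure_discP /(_ _ s20) [v [m Mm]]; rewrite /disc /= => vm vz.
  by exists m => //; have := nm_tri v z m; rewrite (nmB z v); lra.
have [k rk hk] : exists2 k, r < k & forall z, closure O z -> ~ O z -> k <= nm (q.[z] - y).
  have gtr z : closure O z -> ~ O z -> r < nm (q.[z] - y).
    move=> /cO [m Mm zm] nO; rewrite ltNge; apply/negP => /sM [m' Mm' qm'].
    apply: nO; rewrite (hs z m' m m')//; first exact: MO.
    by rewrite subrr Normc.normc0.
  have [[a [aO na]]|none] := pselect (closure O `&` ~` O !=set0); last first.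
    exists (r + 1) => [|z cz nz]; first by rewrite ltrDl.
    by exfalso; apply: none; exists z.
  have [||||c [cc nc] hc] := @EVT_minC _ (closure O `&` ~` O) (B + s) (fun z => nm (q - y%:P).[z]).
  - by apply: closedI; [exact: closed_closure|exact: open_closedC].
  - by move=> z [/cO [m Mm zm] _]; have := nm_leD z m; have := bM _ Mm; lra.
  - by exists a.
  - by move=> z; exact: continuous_nm_poly.
  exists (nm (q.[c] - y)) => [|z cz nz]; first exact: gtr.
  by have := hc z (conj cz nz); rewrite !hornerE.
exists k => //.
have VO : V k `<=` O.
  have [k0|k0] := leP k 0.
    by move=> z /connected_component_sub; rewrite /= /disc /= => /lt_le_trans /(_ k0);
      rewrite ltNge nm_ge0.
  have /connected_epsP := @component_connected _ [set z | disc y k q.[z]] u0; apply.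
  - by exists u0; split; [exact: Vu0|exact: MO].
  - move=> w _ Ow; have /open_discP /(_ _ Ow) [d d0 hd] := oO.
    by exists d => // v _ vw; exact: hd.
  - move=> w Vw nO; have nc : ~ closure O w.
      move=> cw; have := hk _ cw nO; rewrite leNgt => /negP; apply.
      exact: (connected_component_sub Vw).
    have oc := closed_openC (@closed_closure _ O).
    have /open_discP /(_ _ nc) [d d0 hd] := oc.
    by exists d => // v _ vw Ov; apply: (hd v vw); exact: subset_closure.
move=> z w /VO /subset_closure /cO [m Mm zm] /VO /subset_closure /cO [m' Mm' wm'].
exact: hs zm wm'.
Qed.

(** Only boundary points matter. If p and p' were distinct, take disjoint discs about them and lift
    to both the connected set where a small disc about q(p) meets the disc about [y]. Each lift
    meets [V r], hence lies in it, so one value would be taken twice in [V r]. *)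
Let component_closure_injective r : 0 < r -> inj r ->
  (forall z, nm (q.[z] - y) <= r -> q^`().[z] != 0) ->
  forall p p', closure (V r) p -> closure (V r) p' -> q.[p] = q.[p'] -> p = p'.
Proof.
move=> r0 ir dr p p' cp cp' qpp'; apply: contrapT => npp'.
have le_r z : closure (V r) z -> nm (q.[z] - y) <= r.
  move=> /closure_discP cz; rewrite leNgt; apply/negP => rz.
  have [d d0 hd] := poly_continuous q z (eqbRL (subr_gt0 _ _) rz).
  have [v /connected_component_sub + /hd] := cz _ d0; rewrite /= /disc /= => h1 h2.
  by have := nm_tri q.[v] q.[z] y; rewrite (nmB q.[z] q.[v]); lra.
have [wr|rw] := ltP (nm (q.[p] - y)) r.
  have oA : open [set z | disc y r q.[z]].
    by apply: open_poly_preimage; exact: open_disc.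
  apply: npp'; apply: (ir p p' _ _ qpp'); first exact: (component_closure oA wr cp).
  by apply: (component_closure oA _ cp'); rewrite /= -qpp'.
have [r1 r10 h1] := local_injectivity (dr _ (le_r _ cp)).
have [r2 r20 h2] := local_injectivity (dr _ (le_r _ cp')).
have dpp' : 0 < nm (p - p') by rewrite nm_gt0 subr_eq0; apply/eqP.
pose r3 := Num.min (Num.min r1 r2) (nm (p - p') / 2).
have r30 : 0 < r3 by rewrite !lt_min r10 r20 divr_gt0.
have r31 : r3 <= r1 by rewrite /r3 !ge_min lexx.
have r32 : r3 <= r2 by rewrite /r3 !ge_min lexx !orbT.
have r33 : r3 <= nm (p - p') / 2 by rewrite /r3 !ge_min lexx !orbT.
have sub s s' a z : s <= s' -> disc a s z -> disc a s' z.
  by rewrite /disc /= => ss' /lt_le_trans; apply.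
have [z w zp wp|d1 d10 hd1] := @local_lift q p r3 sq r30.
  by apply: h1; exact: sub r31 _.
have [z w zp wp|d2 d20 hd2] := @local_lift q p' r3 sq r30.
  by apply: h2; exact: sub r32 _.
pose e := Num.min d1 d2.
have e0 : 0 < e by rewrite lt_min d10.
pose K := disc q.[p] e `&` disc y r.
have [k Kk] : exists k, K k.
  have [d d0 hd] := poly_continuous q p e0.
  have /closure_discP /(_ _ d0) [v /connected_component_sub /= vr /hd vp] := cp.
  by exists q.[v].
have cK : connected K.
  by case: (Kk) => k1 k2; apply: (@convexI_connected _ _ _ k); exact: disc_convex.
have inV a : closure (V r) a -> q.[a] = q.[p] ->
    connected [set z | disc a r3 z /\ K q.[z]] ->
    [set z | disc a r3 z /\ K q.[z]] `<=` V r.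
  move=> ca qa cE; have [d3 d30 hd3] := poly_continuous q a e0.
  have /closure_discP /(_ (Num.min r3 d3)) [|v Vv] := ca; first by rewrite lt_min r30.
  rewrite lt_min => /andP[va /hd3 qv].
  have Kv : K q.[v] by split; [rewrite -qa|exact: (connected_component_sub Vv)].
  rewrite /V (same_connected_component Vv).
  by apply: connected_component_max cE => //= z [_ []].
have [|E1 l1] := hd1 K _ cK.
  by move=> z [+ _]; apply: sub; rewrite /e ge_min lexx.
have [|E2 l2] := hd2 K _ cK.
  by move=> z [+ _]; rewrite qpp'; apply: sub; rewrite /e ge_min lexx orbT.
have [z zp qz] := l1 _ Kk; have [w wp' qw] := l2 _ Kk.
have Vz : V r z by apply: (inV p cp) => //=; rewrite qz.
have Vw : V r w by apply: (inV p' cp') => //=; rewrite qw.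
have zw : z = w by apply: ir => //; rewrite qz.
move: zp wp'; rewrite -zw /disc /= => zp zp'.
by have := nm_tri z p p'; rewrite (nmB p z); lra.
Qed.

Let inj_step r : 0 < r -> inj r ->
  (forall z, nm (q.[z] - y) <= r -> q^`().[z] != 0) -> exists2 r', r < r' & inj r'.
Proof.
move=> r0 ir dr.
have le_r z : closure (V r) z -> nm (q.[z] - y) <= r.
  move=> /closure_discP cz; rewrite leNgt; apply/negP => rz.
  have [d d0 hd] := poly_continuous q z (eqbRL (subr_gt0 _ _) rz).
  have [v /connected_component_sub + /hd] := cz _ d0; rewrite /= /disc /= => h1 h2.
  by have := nm_tri q.[v] q.[z] y; rewrite (nmB q.[z] q.[v]); lra.
have [B hB] := poly_preimage_bounded (nm y + r) sq.
have bV z : closure (V r) z -> nm z <= B.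
  by move=> /le_r zr; apply: hB; have := nm_leD q.[z] y; lra.
apply: (@extend (closure (V r)) B).
- exact: closed_closure.
- exact: bV.
- by apply: subset_closure; exact: Vu0.
- by move=> z /le_r; exact: dr.
- exact: component_closure_injective.
(* The closure of [V r] maps onto the closed disc: [w] is approached along the radius from [y] by
   points of the open disc, and a cluster point of preimages of these is sent to [w]. *)
move=> w wr.
have /choice [f hf] : forall n : nat, exists z, V r z /\
    nm (q.[z] - w) <= r * n.+1%:R^-1.
  move=> n; set t : R := n.+1%:R^-1.
  have t0 : 0 < t by rewrite invr_gt0.
  have t1 : t <= 1 by rewrite invf_le1// ler1n.
  have [||||z Vz qz] := @cnt_onto _ q (disc y r) u0 (y + (1 - t)%:C * (w - y)) sq.
  - exact: open_disc.
  - exact: disc_connected.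
  - by rewrite qu0; exact: disc_center.
  - rewrite /disc /= addrAC subrr add0r Normc.normcM nm_real ger0_norm ?subr_ge0//.
    have : (1 - t) * nm (w - y) <= (1 - t) * r by rewrite ler_wpM2l ?subr_ge0.
    have : 0 < t * r by rewrite mulr_gt0.
    by lra.
  exists z; split=> //; rewrite qz.
  have -> : y + (1 - t)%:C * (w - y) - w = - (t%:C * (w - y)).
    by rewrite rmorphB rmorph1; ring.
  by rewrite nmN Normc.normcM nm_real ger0_norm ?(ltW t0)// mulrC ler_wpM2r// ltW.
have [p hp] := bounded_cluster (fun n => bV _ (subset_closure (hf n).1)).
exists p.
  apply/closure_discP => e e0; have [n _ h] := hp _ e0 0%N.
  by exists (f n) => //; exact: (hf n).1.
apply/eqP; rewrite -subr_eq0 -nm_eq0 eq_le nm_ge0 andbT leNgt; apply/negP => h.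
have h2 : 0 < nm (q.[p] - w) / 2 by rewrite divr_gt0.
have [d d0 hd] := poly_continuous q p h2.
have h3 : 0 < nm (q.[p] - w) / 2 / r by rewrite divr_gt0.
have [N _ hN] := near_infty_natSinv_lt (PosNum h3).
have [n Nn /hd h4] := hp _ d0 N.
have := hN _ Nn; rewrite /= ltr_pdivlMr// => h5.
have h6 := (hf n).2; rewrite [r * _]mulrC in h6.
have {}h6 := le_lt_trans h6 h5.
by have := nm_tri q.[f n] q.[p] w; rewrite (nmB q.[p] q.[f n]); lra.
Qed.

(** Let T be the supremum of the radii up to [rho] for which injectivity holds. [V T] is the union
    of the smaller [V r], so injectivity holds at T, and if T < rho then [inj_step] would go beyond
    T. *)
Lemma sublevel_component_injective (rho : R) : 0 < rho ->
  (forall z, disc y rho q.[z] -> q^`().[z] != 0) -> inj rho.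
Proof.
move=> rho0 dq.
pose S := [set r : R | 0 < r <= rho /\ inj r].
have [r1 r10 ir1] : exists2 r, 0 < r & inj r.
  apply: (@extend [set u0] (nm u0)) => //.
  - apply/closed_discP => x h; apply: contrapT => /eqP nx.
    have [|z -> ] := h (nm (u0 - x)); last by rewrite ltxx.
    by rewrite nm_gt0 subr_eq0 eq_sym.
  - by move=> z ->.
  - by move=> z ->; apply: dq; rewrite qu0; exact: disc_center.
  - by move=> z w -> ->.
  move=> w wy; exists u0 => //; rewrite qu0; apply/esym/eqP.
  by rewrite -subr_eq0 -nm_eq0 eq_le nm_ge0 wy.
have Smin r : 0 < r -> inj r -> S (Num.min r rho).
  move=> r0 ir; split; last by apply: injmono ir; rewrite ge_min lexx.
  by rewrite lt_min r0 rho0 ge_min lexx orbT.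
have Sub : has_ubound S by exists rho => r [/andP[_]].
have hS : has_sup S by split => //; exists (Num.min r1 rho); exact: Smin.
pose T := sup S.
have T0 : 0 < T.
  apply: lt_le_trans (sup_upper_bound hS (Smin _ r10 ir1)).
  by rewrite lt_min r10.
have Trho : T <= rho by apply: sup_le_ub; [case: hS|move=> r [/andP[_]]].
have VT z : V T z -> exists2 r, 0 < r < T & V r z.
  have /connected_epsP h := @component_connected _ [set z | disc y T q.[z]] u0.
  apply: (h [set z | exists2 r, 0 < r < T & V r z]) => {z}.
  - exists u0; split; first exact: Vu0.
    by exists (T / 2); [lra|apply: Vu0; lra].
  - move=> w _ [r rT Vw]; have /open_discP /(_ _ Vw) [d d0 hd] := @Vopen r.
    by exists d => // v _ vw; exists r => //; exact: hd.
  - move=> w /connected_component_sub /= wT nP.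
    pose r := (nm (q.[w] - y) + T) / 2.
    have wr : nm (q.[w] - y) < r by move: wT; rewrite /r /disc /=; lra.
    have rT : r < T by move: wT; rewrite /r /disc /=; lra.
    have /open_discP /(_ w wr) [d d0 hd] :=
      @open_poly_preimage _ q _ (@open_disc _ y r).
    exists d => // v _ vw [r' /andP[r'0 r'T] Vv]; apply: nP.
    exists (Num.max r r'); first by rewrite gt_max rT r'T lt_max r'0 orbT.
    have Vv' : V (Num.max r r') v by apply: Vmono Vv; rewrite le_max lexx orbT.
    apply: (component_disc Vv' _ (_ : disc w d v)) => //; last exact: disc_center.
    move=> u /hd; rewrite /= /disc /= => /lt_le_trans; apply.
    by rewrite le_max lexx.
have iT : inj T.
  move=> z w /VT [r /andP[r0 rT] Vz] /VT [r' /andP[r'0 r'T] Vw].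
  have mT : Num.max r r' < T by rewrite gt_max rT.
  have [s [_ injs] ms] := sup_adherent (eqbRL (subr_gt0 _ _) mT) hS.
  have ms' : Num.max r r' < s by move: ms; rewrite /T; lra.
  move: ms'; rewrite gt_max => /andP[rs r's].
  by apply: injs; [exact: Vmono (ltW rs) _ Vz|exact: Vmono (ltW r's) _ Vw].
move: Trho; rewrite le_eqVlt => /predU1P[<-//|Trho].
have [|r' Tr' ir'] := inj_step T0 iT.
  by move=> z zT; apply: dq; exact: le_lt_trans zT Trho.
have := sup_upper_bound hS (Smin _ (lt_trans T0 Tr') ir').
by rewrite leNgt lt_min -/T Tr' Trho.
Qed.

End SublevelComponents.

(** The component containing [E] is mapped onto the disc, so it can be based at a point [u] over the
    centre [y], as the preceding lemma requires. *)
Lemma injective_without_critical_values q y (rho : R) E : (1 < size q)%N ->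
  (forall z, disc y rho q.[z] -> q^`().[z] != 0) ->
  connected E -> E `<=` [set z | disc y rho q.[z]] ->
  forall z w, E z -> E w -> q.[z] = q.[w] -> z = w.
Proof.
move=> sq dq cE EA z w Ez Ew.
have rho0 : 0 < rho by apply: le_lt_trans (nm_ge0 _) (EA _ Ez).
have [||||u Vu qu] := @cnt_onto _ q (disc y rho) z y sq.
- exact: open_disc.
- exact: disc_connected.
- exact: EA.
- exact: disc_center.
have EV : E `<=` connected_component [set z | disc y rho q.[z]] u.
  by rewrite -(same_connected_component Vu); exact: connected_component_max.
by apply: (sublevel_component_injective sq qu rho0 dq); exact: EV.
Qed.

End Monodromy.

(** * The Riemann sphere and the spherical distance *)

Section Sphere.
Variable R : realType.
Local Notation C := R[i].
Local Notation Sph := (sphere R).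
Implicit Types (A B : set C) (x y z w : C).

Lemma bounded_nmP A : bounded_set A <-> exists M : R, forall z, A z -> nm z <= M.
Proof.
split=> [[M [rM hM]]|[M hM]].
  have h : M < M + 1 by rewrite ltrDl.
  exists (complex.Re (M + 1)) => z Az; have := hM _ h z Az.
  by rewrite /= normC_nm lecE => /andP[].
exists M%:C; split; first by rewrite complex_real.
move=> e Me z Az /=; apply: le_trans (ltW Me).
by rewrite normC_nm lecR hM.
Qed.

Lemma open_Some A : open A -> open (Some @` A : set Sph).
Proof. exact: one_point_compactification_open_some. Qed.

Lemma open_preimage_Some (U : set Sph) : open U -> open (Some @^-1` U : set C).
Proof. by move=> oU; apply: open_comp oU => z _ A; exact. Qed.

Lemma nbhs_None (r : R) : nbhs (None : Sph) ([set None] `|` Some @` [set z : C | r < nm z]).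
Proof.
exists [set z : C | nm z <= r].
  split; first exact: compact_cball.
  have -> : [set z : C | nm z <= r] = [set z : C | nm (z - 0) <= r].
    by apply/seteqP; split=> z /=; rewrite subr0.
  exact: closed_cball.
move=> _ [[x /= xr <-]|->]; last by left.
by right; exists x => //=; rewrite ltNge; apply/negP.
Qed.

Lemma open_infinity (r : R) : open ([set None] `|` Some @` [set z : C | r < nm z] : set Sph).
Proof.
rewrite openE => -[x|_]; last exact: nbhs_None.
move=> [//|[x' /= xr [xx']]]; subst x'.
have : nbhs (Some x : Sph) (Some @` [set z : C | r < nm z]).
  apply: one_point_compactification_some_nbhs; apply/nbhs_discP.
  exists (nm x - r) => [|z]; first by rewrite subr_gt0.
  by rewrite /disc /= => zx; have := nm_leD x z; rewrite nmB; lra.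
by apply: filterS => z; right.
Qed.

Lemma compact_Some A : compact A -> compact (Some @` A : set Sph).
Proof.
move=> cA; apply: continuous_compact cA; apply: continuous_subspaceT.
exact: one_point_compactification_some_continuous.
Qed.

Lemma connected_Some A : connected A -> connected (Some @` A : set Sph).
Proof.
move=> cA; apply: connected_continuous_connected cA _; apply: continuous_subspaceT.
exact: one_point_compactification_some_continuous.
Qed.

Lemma connected_preimage_Some (D : set Sph) : D `<=` Some @` setT ->
  connected D -> connected (Some @^-1` D : set C).
Proof.
move=> DS cD E [e Ee] [U oU EU] [F cF EF].
suff : Some @` E = D.
  move=> <-; apply/seteqP; split=> [z Ez|z [u Eu [uz]]]; first by exists z.
  by subst u.
apply: cD.
- by exists (Some e); exists e.
- exists (Some @` U); first exact: open_Some.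
  apply/seteqP; split=> [_ [z + <-]|z [+ [u Uu uz]]].
    by rewrite EU => -[Dz Uz]; split=> //; exists z.
  by rewrite -uz => Du; exists u => //; rewrite EU.
- exists (~` (Some @` (~` F))); first by apply/open_closedC/open_Some/closed_openC.
  apply/seteqP; split=> [_ [z + <-]|z [Dz nF]].
    by rewrite EF => -[Dz Fz]; split=> // -[u + [uz]]; subst u.
  have [x _ xz] := DS _ Dz; exists x => //; rewrite EF; split; first by rewrite /= xz.
  by apply: contrapT => nFx; apply: nF; exists x.
Qed.

Lemma connected_component_Some A x : A x ->
  connected_component (Some @` A : set Sph) (Some x) = Some @` connected_component A x.
Proof.
move=> Ax; apply/seteqP; split; last first.
  apply: connected_component_max.
  - by exists x => //; exact: connected_component_refl.
  - by move=> _ [z /connected_component_sub Az <-]; exists z.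
  - by apply: connected_Some; exact: component_connected.
move=> z [D [Dx DA cD] Dz]; have [u _ uz] := DA _ Dz; subst z; exists u => //.
have DS : D `<=` Some @` setT by move=> _ /DA [v _ <-]; exists v.
exists (Some @^-1` D) => //; split=> //; last exact: connected_preimage_Some.
by move=> v /DA [w Aw [<-]].
Qed.

Implicit Types (p g : {poly C}).

Lemma size_pdeg p : (0 < pdeg p)%N = (1 < size p)%N.
Proof. by rewrite /pdeg; case: (size p) => [|[]]. Qed.

Lemma pmap_None p : (1 < size p)%N -> pmap p None = None.
Proof. by rewrite /pmap size_pdeg => ->. Qed.

Lemma local_degreeE p x v : p.[x] = v -> (1 < size p)%N ->
  local_degree p (Some x) = count_mem x (rootseq (p - v%:P)).
Proof.
move=> <- sp; rewrite /local_degree mup_rootseq// -size_poly_gt0 size_subC//.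
exact: leq_trans sp.
Qed.

(** The sum runs over distinct preimages weighted by multiplicity, while [rootseq] repeats each
    root; infinity is fixed by [p] and does not occur over a finite point. *)
Lemma covering_sum p (W : set Sph) v : (1 < size p)%N ->
  \big[addn/0%N]_(z \in W `&` pmap p @^-1` [set (Some v : Sph)]) local_degree p z =
  cnt p (Some @^-1` W) v.
Proof.
move=> sp; set rs := rootseq (p - v%:P).
pose s := [seq x <- undup rs | x \in (Some @^-1` W : set C)].
have us : uniq s by rewrite filter_uniq// undup_uniq.
have E : W `&` pmap p @^-1` [set (Some v : Sph)] = [set` [seq (Some x : Sph) | x <- s]].
  apply/seteqP; split=> z.
    case: z => [x [Wx [px]]|[_ h]]; last by have := pmap_None sp; rewrite h.
    apply/mapP; exists x => //; rewrite mem_filter mem_undup mem_rootseq_sub// px eqxx andbT.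
    exact: mem_set.
  move=> /mapP[x + ->]; rewrite mem_filter mem_undup mem_rootseq_sub//.
  by move=> /andP[/set_mem Wx /eqP <-].
rewrite E -fsbig_seq; last by rewrite map_inj_uniq// => a b [].
rewrite big_map /cnt -/rs.
transitivity (\sum_(x <- s) count_mem x rs)%N.
  apply: eq_big_seq => x; rewrite mem_filter mem_undup mem_rootseq_sub//.
  by move=> /andP[_ /eqP px]; rewrite (local_degreeE px).
rewrite /s big_filter -sum1_count -[RHS]big_undup_iterop_count.
apply: eq_bigr => x _; case: (count_mem x rs) => [//|n].
by elim: n => [//|n IH]; rewrite [RHS]iteropS iterS -(iteropS 0%N) -IH.
Qed.

End Sphere.

(** * Comparison of the spherical and the Euclidean distance *)

Section SphericalMetric.
Variable R : realType.
Local Notation C := R[i].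
Local Notation Sph := (sphere R).
Implicit Types (x y z w : C).

Local Notation rt x := (Num.sqrt (1 + nm x ^+ 2)).

Lemma rt_ge1 x : 1 <= rt x.
Proof. by rewrite -[leLHS](@sqrtr1 R) ler_wsqrtr// lerDl sqr_ge0. Qed.

Lemma rt_ge x : nm x <= rt x.
Proof.
by rewrite -[leLHS]ger0_norm ?nm_ge0// -sqrtr_sqr ler_wsqrtr// lerDr.
Qed.

Lemma rt_le x : rt x <= 1 + nm x.
Proof.
rewrite -[leRHS]ger0_norm ?addr_ge0 ?nm_ge0// -sqrtr_sqr ler_wsqrtr//.
by rewrite sqrrD expr1n mul1r -addrA lerD2l lerDr mulrn_wge0// nm_ge0.
Qed.

Lemma rt_gt0 x : 0 < rt x.
Proof. exact: lt_le_trans (rt_ge1 x). Qed.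

Lemma rt_sqr x : rt x ^+ 2 = 1 + nm x ^+ 2.
Proof. by rewrite sqr_sqrtr// addr_ge0// sqr_ge0. Qed.

Lemma half_chord_ge0 (z w : Sph) : 0 <= half_chord z w.
Proof.
case: z w => [x|] [y|] /=; rewrite ?invr_ge0 ?sqrtr_ge0//.
by rewrite divr_ge0 ?nm_ge0// mulr_ge0// sqrtr_ge0.
Qed.

(** For finite points this rests on (1 + a^2)(1 + b^2) - (a + b)^2 = (1 - ab)^2 with a, b the two
    moduli. *)
Lemma half_chord_le1 (z w : Sph) : half_chord z w <= 1.
Proof.
case: z w => [x|] [y|] //=; try by rewrite invf_le1 ?rt_gt0 ?rt_ge1.
rewrite ler_pdivrMr ?mulr_gt0 ?rt_gt0// mul1r.
rewrite -(@ler_sqr R) ?nnegrE ?nm_ge0 ?mulr_ge0 ?sqrtr_ge0//.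
rewrite exprMn !rt_sqr.
have : nm (x - y) ^+ 2 <= (nm x + nm y) ^+ 2.
  by rewrite ler_sqr ?nnegrE ?addr_ge0 ?nm_ge0//; have := nmD x (- y); rewrite nmN.
have : 0 <= (1 - nm x * nm y) ^+ 2 by exact: sqr_ge0.
by move=> h1 h2; apply: le_trans h2 _; move: h1; set a := nm x; set b := nm y; nra.
Qed.

(** The bound by pi keeps [e / 2] where the sine is increasing. *)
Lemma sdist_ltP (z w : Sph) (e : R) : 0 < e <= pi ->
  (sdist z w < e) = (half_chord z w < sin (e / 2)).
Proof.
move=> /andP[e0 epi].
have h01 : -1 <= half_chord z w <= 1.
  by rewrite half_chord_le1 (le_trans _ (half_chord_ge0 z w))// lerN10.
rewrite /sdist -ltr_pdivlMl// mulrC.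
rewrite -[in RHS](@asinK R (half_chord z w)) ?in_itv//= ltr_sin// in_itv/=.
  by rewrite asin_geNpi2// asin_lepi2.
have := @pi_gt0 R; lra.
Qed.

Lemma sin_half_gt0 (e : R) : 0 < e <= pi -> 0 < sin (e / 2).
Proof. by move=> /andP[e0 epi]; apply: sin_gt0_pi; have := @pi_gt0 R; lra. Qed.

Lemma sdist_lt_of_half_chord (e : R) : 0 < e -> exists2 s, 0 < s &
  forall z w : Sph, half_chord z w < s -> sdist z w < e.
Proof.
move=> e0; pose e' := Num.min e pi.
have he' : 0 < e' <= pi by rewrite lt_min e0 pi_gt0 /e' ge_min lexx orbT.
exists (sin (e' / 2)) => [|z w]; first exact: sin_half_gt0.
by rewrite -sdist_ltP// => /lt_le_trans; apply; rewrite /e' ge_min lexx.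
Qed.

Lemma half_chord_lt_of_sdist (s : R) : 0 < s -> exists2 e, 0 < e &
  forall z w : Sph, sdist z w < e -> half_chord z w < s.
Proof.
move=> s0; pose s' := Num.min s 1.
have s'0 : 0 < s' by rewrite lt_min s0 ltr01.
have s'1 : -1 <= s' <= 1.
  by rewrite /s' ge_min lexx orbT andbT (le_trans _ (ltW s'0))// lerN10.
have as0 : 0 < asin s'.
  rewrite ltNge; apply/negP => h; have := @asin_geNpi2 R s' s'1 => h'.
  have : s' <= 0.
    rewrite -(@asinK R s') ?in_itv//= -oppr_ge0 -sinN; apply: sin_ge0_pi.
    by have := @pi_gt0 R; lra.
  by rewrite leNgt s'0.
have he : 0 < 2 * asin s' <= pi.
  by have := @asin_lepi2 R s' s'1; lra.
exists (2 * asin s') => [|z w]; first by case/andP: he.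
rewrite sdist_ltP// [2 * _]mulrC mulfK ?pnatr_eq0// asinK ?in_itv// => /lt_le_trans; apply.
by rewrite /s' ge_min lexx.
Qed.

Lemma half_chord_Some_le x y : half_chord (Some x : Sph) (Some y) <= nm (x - y).
Proof.
rewrite /= ler_pdivrMr ?mulr_gt0 ?rt_gt0// ler_peMr ?nm_ge0//.
by rewrite mulr_ege1 ?rt_ge1.
Qed.

Lemma half_chord_None_lt x (s : R) : 0 < s -> s^-1 < nm x ->
  half_chord (Some x : Sph) None < s.
Proof.
move=> s0 xs; rewrite /= invf_plt ?posrE ?rt_gt0//.
exact: lt_le_trans xs (rt_ge x).
Qed.

Lemma half_chord_None_gt x (M : R) : nm x <= M ->
  (1 + M)^-1 <= half_chord (Some x : Sph) None.
Proof.
move=> xM; rewrite /= lef_pV2 ?posrE ?rt_gt0//.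
  by apply: le_trans (rt_le x) _; rewrite lerD2l.
by rewrite (lt_le_trans ltr01)// lerDl (le_trans (nm_ge0 x)).
Qed.

Lemma half_chord_far x y : 1 + 2 * nm y <= nm x ->
  (4 * (1 + nm y))^-1 <= half_chord (Some x : Sph) (Some y).
Proof.
move=> h; have hx := rt_le x; have hy := rt_le y; have := nm_leD x y => hxy.
have y0 := nm_ge0 y; have y4 : 0 < 4 * (1 + nm y) by lra.
rewrite /= ler_pdivlMr ?mulr_gt0 ?rt_gt0// mulrC ler_pdivrMr//.
have : rt x * rt y <= (1 + nm x) * (1 + nm y) by rewrite ler_pM ?sqrtr_ge0.
move=> /le_trans; apply; rewrite mulrA ler_pM2r; last by lra.
by lra.
Qed.

(* A small spherical disc about a point y of bounded modulus is the Euclidean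
   disc |w - y|^2 < s^2 (1 + |y|^2) (1 + |w|^2). *)
Lemma half_chord_ball y (M s : R) : nm y <= M -> 0 < s -> s * (1 + M) <= 1 / 2 ->
  let B := [set w : C | half_chord (Some y : Sph) (Some w) < s] in
  [/\ B `<=` disc y (4 * s * (1 + M) ^+ 2), star_shaped B y &
      ~ half_chord (Some y : Sph) None < s].
Proof.
move=> yM s0 sM B.
have M0 : 0 <= M := le_trans (nm_ge0 y) yM.
have E w : B w <-> nm (w - y) < s * (rt y * rt w).
  by rewrite /B /= ltr_pdivrMr ?mulr_gt0 ?rt_gt0// nmB.
split.
- move=> w /E; rewrite /disc /= => h.
  have h1 : rt y * rt w <= (1 + M) * (1 + M + nm (w - y)).
    apply: ler_pM; rewrite ?sqrtr_ge0//.
      by apply: le_trans (rt_le y) _; rewrite lerD2l.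
    by apply: le_trans (rt_le w) _; have := nm_leD w y; lra.
  have : s * (rt y * rt w) <= s * ((1 + M) * (1 + M + nm (w - y))) by rewrite ler_pM2l.
  rewrite mulrA mulrDr => h2.
  have h3 : s * (1 + M) * nm (w - y) <= 1 / 2 * nm (w - y) by rewrite ler_wpM2r ?nm_ge0.
  have : 0 < s * (1 + M) ^+ 2 by rewrite mulr_gt0// exprn_gt0//; lra.
  rewrite expr2 !mulrA in h2 *; lra.
- have sq w : B w <-> nm (w - y) ^+ 2 < s ^+ 2 * (1 + nm y ^+ 2) * (1 + nm w ^+ 2).
    apply: (iff_trans (E w)).
    rewrite -[nm (w - y) < _]ltr_sqr ?nnegrE ?nm_ge0 ?mulr_ge0 ?sqrtr_ge0 ?(ltW s0)//.
    by rewrite !exprMn !rt_sqr mulrA.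
  have nmsq w : nm w ^+ 2 = complex.Re w ^+ 2 + complex.Im w ^+ 2.
    by case: w => a b; rewrite /= sqr_sqrtr// addr_ge0// sqr_ge0.
  move=> w /sq h t /andP[t0 t1]; apply/sq; move: h.
  set k := s ^+ 2 * (1 + nm y ^+ 2).
  have k1 : 0 < k < 1.
    rewrite mulr_gt0 ?exprn_gt0 ?ltr_wpDr ?sqr_ge0//=.
    have : nm y ^+ 2 <= M ^+ 2 by rewrite ler_sqr ?nnegrE ?nm_ge0.
    have : (s * (1 + M)) ^+ 2 <= (1 / 2) ^+ 2.
      by rewrite ler_sqr ?nnegrE ?mulr_ge0 ?addr_ge0 ?(ltW s0)//; lra.
    move=> h1 h2; have : k <= s ^+ 2 * (1 + M ^+ 2).
      by rewrite /k ler_pM2l ?exprn_gt0// lerD2l.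
    have : s ^+ 2 * (1 + M ^+ 2) <= s ^+ 2 * (1 + M) ^+ 2.
      by rewrite ler_pM2l ?exprn_gt0//; nra.
    by move: h1; rewrite exprMn; lra.
  rewrite !nmsq; clearbody k.
  case: y {yM E B sq} => a b; case: w => c d /=.
  rewrite !(mul0r, subr0, addr0) => h.
  set u := c - a in h *; set v := d - b in h *.
  have -> : a + t * u - a = t * u by ring.
  have -> : b + t * v - b = t * v by ring.
  have {}h : u ^+ 2 + v ^+ 2 < k * (1 + ((a + u) ^+ 2 + (b + v) ^+ 2)).
    by move: h; rewrite /u /v ![_ + (_ - _)]addrC !subrK.
  have h0 : 0 < k * (1 + (a ^+ 2 + b ^+ 2)).
    by rewrite mulr_gt0 ?(andP k1).1// ltr_wpDr// addr_ge0// sqr_ge0.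
  clearbody u v.
  have tt : 0 <= t - t ^+ 2 by rewrite expr2 -{1}[t]mulr1 -mulrBr mulr_ge0// subr_ge0.
  have h5 : 0 <= (t - t ^+ 2) * ((1 - k) * (u ^+ 2 + v ^+ 2)).
    apply: mulr_ge0 => //; apply: mulr_ge0; last by rewrite addr_ge0 ?sqr_ge0.
    by case/andP: k1; lra.
  (* As [k < 1], the defect is concave in [t]: it is the convex combination of its values at the
     endpoints of the segment plus a nonnegative multiple of t - t^2. *)
  rewrite -subr_gt0.
  have -> : k * (1 + ((a + t * u) ^+ 2 + (b + t * v) ^+ 2)) - ((t * u) ^+ 2 + (t * v) ^+ 2) =
     (1 - t) * (k * (1 + (a ^+ 2 + b ^+ 2))) +
     t * (k * (1 + ((a + u) ^+ 2 + (b + v) ^+ 2)) - (u ^+ 2 + v ^+ 2)) +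
     (t - t ^+ 2) * ((1 - k) * (u ^+ 2 + v ^+ 2)) by ring.
  rewrite ltr_pwDl//.
  have [->|t'] := eqVneq t 0; first by rewrite subr0 mul1r mul0r addr0.
  have tp : 0 < t by rewrite lt_def t' t0.
  by rewrite ltr_wpDl ?mulr_gt0 ?subr_gt0// mulr_ge0 ?subr_ge0 ?(ltW h0).
- apply/negP; rewrite -leNgt; apply: le_trans (half_chord_None_gt yM).
  by rewrite -[s]invrK lef_pV2 ?posrE ?invr_gt0// ?lerNgt; [|lra];
    rewrite -[leRHS]mul1r ler_pdivlMr// mulrC; lra.
Qed.

End SphericalMetric.

(** * Normal families of polynomials *)

Section Words.
Variable R : realType.
Local Notation C := R[i].
Variables (T : finType) (gen : T -> {poly C}).

(** The head letter is applied last; [rcons] appends the letter applied first. *)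
Fixpoint word (s : seq T) : {poly C} :=
  if s is t :: s' then gen t \Po word s' else 'X.

Lemma word_cat s s' : word (s ++ s') = word s \Po word s'.
Proof. by elim: s => [|t s IH] /=; rewrite ?comp_polyX ?comp_Xpoly// IH comp_polyA. Qed.

Lemma word_rcons s t : word (rcons s t) = word s \Po gen t.
Proof. by rewrite -cats1 word_cat /= comp_polyXr. Qed.

Lemma generated_word g :
  generated (range gen) g <-> exists t s, g = word (t :: s).
Proof.
split.
  elim=> {g} [_ [t _ <-]|f g _ [t [s ->]] _ [t' [s' ->]]].
    by exists t, [::]; rewrite /= comp_polyXr.
  by exists t, (s ++ t' :: s'); rewrite -word_cat.
move=> [t [s ->]]; elim: s t => [|t' s IH] t /=.
  by rewrite comp_polyXr; apply: generated_gen; exists t.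
by apply: generated_comp; [apply: generated_gen; exists t|exact: IH].
Qed.

Hypothesis gen_size : forall t, (1 < size (gen t))%N.

Lemma size_word s : (1 < size (word s))%N.
Proof.
elim: s => [|t s IH] /=; first by rewrite size_polyX.
have := size_comp_poly (gen t) (word s); move: (gen_size t) IH.
case: (size (gen t)) => [|[|a]]// _; case: (size (word s)) => [|[|b]]// _ /=.
by case: (size _) => [|[|c]].
Qed.

Variable rho : R.
Hypothesis gen_escape : forall t z, rho <= nm z -> 2 * nm z <= nm (gen t).[z].

Lemma word_escape s z : rho <= nm z -> 2 ^+ size s * nm z <= nm (word s).[z].
Proof.
move=> zr; elim: s => [|t s IH] /=; first by rewrite hornerX mul1r.
rewrite horner_comp exprS -mulrA.
apply: le_trans (gen_escape _ _); first by rewrite ler_pM2l.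
apply: le_trans zr (le_trans _ IH).
by rewrite ler_peMl ?nm_ge0// exprn_ege1// ler1n.
Qed.

End Words.

Section Normality.
Variable R : realType.
Local Notation C := R[i].
Local Notation Sph := (sphere R).
Implicit Types (G : set {poly C}) (U : set Sph) (f : nat -> {poly C}).

(* Uniform approximation of l along infinitely many n only; successive choices
   then give a subsequence. *)
Definition clusters f U (l : Sph -> Sph) := forall e : R, 0 < e -> forall N,
  exists2 n, (N <= n)%N & forall z, U z -> sdist (pmap (f n) z) (l z) < e.

Lemma normal_of_clusters G U :
  (forall f, (forall n, G (f n)) -> exists l, clusters f U l) ->
  normal_family U (@pmap R @` G).
Proof.
move=> h F hF; have /choice [f hf] : forall n, exists g, G g /\ pmap g = F n.
  by move=> n; have [g Gg <-] := hF n; exists g.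
have [l hl] := h f (fun n => (hf n).1).
have /choice [nx hnx] : forall k : nat * nat, exists n, (k.2 <= n)%N /\
    forall z, U z -> sdist (pmap (f n) z) (l z) < k.1.+1%:R^-1.
  move=> [k N]; have [|n Nn hn] := hl k.+1%:R^-1 _ N; first by rewrite invr_gt0.
  by exists n.
pose phi := fix phi k := nx (k, if k is k'.+1 then (phi k').+1 else 0)%N.
have phiE k : phi k = nx (k, if k is k'.+1 then (phi k').+1 else 0%N) by case: k.
exists phi; split.
  apply: homo_ltn => [y x z|k]; first exact: ltn_trans.
  by rewrite (phiE k.+1); exact: (hnx (_, _)).1.
exists l => K _ KU e e0; have := near_infty_natSinv_lt (PosNum e0).
apply: filterS => n /= ne z /KU Uz; apply: lt_trans ne.
by rewrite -(hf (phi n)).2 {1}phiE; exact: (hnx (n, _)).2.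
Qed.

Lemma clusters_subsequence f (phi : nat -> nat) U l : (forall n, (n <= phi n)%N) ->
  clusters (f \o phi) U l -> clusters f U l.
Proof.
move=> hphi h e e0 N; have [n Nn hn] := h e e0 N.
by exists (phi n) => //; exact: leq_trans (hphi n).
Qed.

(** Limits along one ultrafilter exist at all points simultaneously, which replaces a diagonal
    extraction. *)
Lemma ultralimit (F : set_system nat) (u : nat -> C) (M : R) : UltraFilter F ->
  (forall n, nm (u n) <= M) ->
  exists L, forall e : R, 0 < e -> F [set n | nm (u n - L) < e].
Proof.
move=> FU bu; have [|L [_ hL]] := @compact_cball R M (u @ F) _.
  by apply: (@filterE _ F) => n; exact: bu.
exists L => e e0; have [//|h] := in_ultra_setVsetC [set n | nm (u n - L) < e] FU.
have h2 : nbhs L (disc L e) by apply/nbhs_discP; exists e.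
have h1 : (u @ F) (~` disc L e) by [].
by have [z []] := hL _ _ h1 h2.
Qed.

(** The bound makes the family uniformly Lipschitz, so the pointwise limit [l] along a free
    ultrafilter is Lipschitz too. If uniform approximation failed for almost all [n], points of
    failure would converge along the ultrafilter to some [a], where closeness of [f n] and [l]
    extends to all nearby points. *)
Lemma montel f (p : C) (r M : R) : 0 < r ->
  (forall n z, disc p (2 * (2 * r)) z -> nm (f n).[z] <= M) ->
  exists l, clusters f (Some @` disc p r) l.
Proof.
move=> r0 bf; have r20 : 0 < 2 * r by rewrite mulr_gt0.
have [F [FU FN]] := @ultraFilterLemma nat \oo _.
have sub z : disc p (2 * r) z -> disc p (2 * (2 * r)) z by rewrite /disc /=; lra.
have sub1 z : nm (z - p) <= r -> disc p (2 * r) z by rewrite /disc /=; lra.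
have M0 : 0 <= M by apply: le_trans (nm_ge0 _) (bf 0%N p _); apply/sub/disc_center.
pose L := 2 * M / (2 * r).
have L0 : 0 <= L by rewrite divr_ge0 ?mulr_ge0// ltW.
have lip n z w : disc p (2 * r) z -> disc p (2 * r) w ->
    nm ((f n).[z] - (f n).[w]) <= L * nm (z - w).
  by apply: bounded_poly_lipschitz => //; exact: bf.
have /choice [l hl] : forall z, exists v, disc p (2 * r) z ->
    forall e : R, 0 < e -> F [set n | nm ((f n).[z] - v) < e].
  move=> z; have [zp|nz] := pselect (disc p (2 * r) z); last by exists 0.
  by have [v hv] := ultralimit FU (fun n => bf n z (sub z zp)); exists v.
have lipl z w : disc p (2 * r) z -> disc p (2 * r) w -> nm (l z - l w) <= L * nm (z - w).
  move=> zp wp; apply/ler_addgt0Pr => e e0.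
  have e20 : 0 < e / 2 by rewrite divr_gt0.
  have [n /= [h1 h2]] := filter_ex (filterI (hl z zp _ e20) (hl w wp _ e20)).
  have := nm_tri (f n).[z] (l z) (l w); have := nm_tri (f n).[w] (f n).[z] (l w).
  by rewrite (nmB (l z) (f n).[z]); have := lip n z w zp wp; move: h1 h2 => /=; lra.
exists (fun z => if z is Some x then Some (l x) else None) => e e0 N.
have [s s0 hs] := @sdist_lt_of_half_chord R e e0.
pose A := [set n | forall z, disc p r z -> nm ((f n).[z] - l z) < s].
suff FA : F A.
  have [|n [/= An Nn]] := filter_ex (filterI FA (FN [set n | (N <= n)%N] _)).
    by exists N.
  exists n => // _ [x xp <-]; apply/hs/(le_lt_trans (half_chord_Some_le _ _)).
  exact: An.
have [//|FnA] := in_ultra_setVsetC A FU.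
have /choice [z hz] : forall n, exists z, nm (z - p) <= r /\
    (~ A n -> disc p r z /\ s <= nm ((f n).[z] - l z)).
  move=> n; have [An|nA] := pselect (A n).
    by exists p; split=> //; rewrite subrr Normc.normc0 ltW.
  apply: contrapT => nz; apply: nA => z zp; rewrite ltNge; apply/negP => h; apply: nz.
  by exists z; split=> //; exact: ltW.
have bz n : nm (z n) <= nm p + r by have := (hz n).1; have := nm_leD (z n) p; lra.
have [a ha] := ultralimit FU bz.
have ap : nm (a - p) <= r.
  apply/ler_addgt0Pr => e1 e10; have [n /= h] := filter_ex (ha _ e10).
  by have := nm_tri (z n) a p; rewrite (nmB a (z n)); have := (hz n).1; lra.
pose d := s / (4 * (L + 1)).
have d0 : 0 < d by rewrite divr_gt0 ?mulr_gt0//; lra.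
have s20 : 0 < s / 2 by rewrite divr_gt0.
have [n /= [nA [h1 h2]]] := filter_ex (filterI FnA (filterI (ha _ d0) (hl a (sub1 _ ap) _ s20))).
have [_ /(_ nA) [_ h3]] := hz n.
have h4 := lip n (z n) a (sub1 _ (hz n).1) (sub1 _ ap).
have h5 := lipl a (z n) (sub1 _ ap) (sub1 _ (hz n).1).
have h6 : L * nm (z n - a) <= s / 4.
  have : L * nm (z n - a) <= (L + 1) * d.
    by apply: ler_pM; rewrite ?nm_ge0//; [lra|exact: ltW].
  have -> : (L + 1) * d = s / 4.
    rewrite /d; have : L + 1 != 0 by rewrite gt_eqF//; lra.
    by move=> ?; field.
  by [].
rewrite (nmB a) in h5.
have := nm_tri (f n).[a] (f n).[z n] (l (z n)); have := nm_tri (l a) (f n).[a] (l (z n)).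
suff : (0 : R) < 0 -> F A by move=> h ? ?; apply: h; lra.
by rewrite ltxx.
Qed.

Lemma infinite_pigeonhole (T : finType) (P : nat -> T) :
  exists t, forall N, exists2 n, (N <= n)%N & P n = t.
Proof.
apply: contrapT => h.
have /choice [N hN] : forall t, exists N, forall n, (N <= n)%N -> P n <> t.
  move=> t; apply: contrapT => ht; apply: h; exists t => N.
  apply: contrapT => hn; apply: ht; exists N => n Nn Pn; apply: hn.
  by exists n.
pose M := (\max_t N t)%N.
exact: (hN (P M) M (leq_bigmax _)).
Qed.

Lemma seq_dichotomy (T : finType) (s : nat -> seq T) :
  (forall L N, exists2 n, (N <= n)%N & (L <= size (s n))%N) \/
  exists w, forall N, exists2 n, (N <= n)%N & s n = w.
Proof.
have [h|] := pselect (forall L N, exists2 n, (N <= n)%N & (L <= size (s n))%N).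
  by left.
move=> /existsNP[L /existsNP[N0 hL]]; right.
have sL n : (size (s (N0 + n)) <= L)%N.
  rewrite leqNgt; apply/negP => Ls; apply: hL.
  by exists (N0 + n)%N; [exact: leq_addr|exact: ltnW].
have [t ht] := infinite_pigeonhole (fun n => Bseq (sL n)).
exists (t : seq T) => N; have [n Nn <-] := ht N.
by exists (N0 + n)%N => //; rewrite (leq_trans Nn)// leq_addl.
Qed.

Section Escape.
Variables (T : finType) (gen : T -> {poly C}).
Hypothesis gen_size : forall t, (1 < size (gen t))%N.

(** If the words get arbitrarily long, some of them send [U] uniformly close to infinity. Otherwise
    one word recurs infinitely often and is itself the limit. *)
Lemma escape_clusters (s : nat -> seq T) U (rho : R) : 0 < rho ->
  (forall n x, U (Some x) -> 2 ^+ size (s n) * rho <= nm (word gen (s n)).[x]) ->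
  exists l, clusters (word gen \o s) U l.
Proof.
move=> rho0 h; have [hL|[w hw]] := seq_dichotomy s; last first.
  exists (pmap (word gen w)) => e e0 N; have [n Nn sn] := hw N.
  exists n => // z _; rewrite /= sn /sdist.
  have -> : half_chord (pmap (word gen w) z) (pmap (word gen w) z) = 0.
    by case: (pmap _ z) => [x|] //=; rewrite subrr Normc.normc0 mul0r.
  have -> : asin 0 = 0 :> R.
    by rewrite -[X in asin X](@sin0 R) sinK// in_itv/= oppr_le0 andbb divr_ge0// pi_ge0.
  by rewrite mulr0.
exists (fun=> None) => e e0 N; have [d d0 hd] := @sdist_lt_of_half_chord R e e0.
have [k hk] : exists k : nat, d^-1 < 2 ^+ k * rho.
  exists (Num.truncn (d^-1 / rho)).+1.
  rewrite -ltr_pdivrMr//; apply: lt_le_trans (truncnS_gt _) _.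
  by rewrite -natrX ler_nat ltnW// ltn_expl.
have [n Nn sn] := hL k N; exists n => // -[x|] Ux; apply: hd; last by rewrite pmap_None ?size_word.
apply: half_chord_None_lt => //; apply: lt_le_trans hk (le_trans _ (h n x Ux)).
by rewrite ler_pM2r// ler_weXn2l// ler1n.
Qed.

Variable rho : R.
Hypotheses (rho0 : 0 < rho)
  (gen_escape : forall t z, rho <= nm z -> 2 * nm z <= nm (gen t).[z]).

Lemma generated_words f : (forall n, generated (range gen) (f n)) ->
  exists s : nat -> seq T, f = word gen \o s.
Proof.
move=> hf; have /choice [s hs] : forall n, exists s, f n = word gen s.
  by move=> n; have /generated_word [t [s ->]] := hf n; exists (t :: s).
by exists s; apply/funext.
Qed.

Lemma Fatou_infinity (z : Sph) : (forall x, z = Some x -> rho < nm x) ->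
  Fatou (generated (range gen)) z.
Proof.
move=> hz; exists ([set None] `|` Some @` [set x : C | rho < nm x]).
  split; first exact: open_infinity.
  by case: z hz => [x|] hz; [right; exists x => //; exact: hz|left].
apply: normal_of_clusters => f /generated_words [s ->].
apply: (@escape_clusters _ _ rho) => // n x [//|[y /= yr [yx]]]; subst y.
apply: le_trans (word_escape gen_escape (s n) (ltW yr)).
by rewrite ler_pM2l ?exprn_gt0// ltW.
Qed.

End Escape.

Lemma Fatou_bounded G (A : set C) (M : R) x :
  (forall g z, G g -> A z -> nm g.[z] <= M) -> A° x -> Fatou G (Some x).
Proof.
(* [montel] asks for the bound on a disc of four times the radius. *)
move=> bG /interior_discP[r r0 rA]; pose r4 := r / 4.
have r40 : 0 < r4 by rewrite divr_gt0.
exists (Some @` disc x r4).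
  by split; [apply/open_Some/open_disc|exists x => //; exact: disc_center].
apply: normal_of_clusters => f Gf; apply: (@montel _ _ _ M) => // n z zx.
by apply: bG => //; apply: rA; move: zx; rewrite /disc /= /r4; lra.
Qed.

Lemma Fatou_mono G G' : G `<=` G' -> Fatou G' `<=` Fatou G.
Proof.
move=> GG' z [U oU nU]; exists U => // f hf; apply: nU => n.
by have [g Gg <-] := hf n; exists g => //; exact: GG'.
Qed.

End Normality.

(** * The semigroup generated by h1 *)

Section Semigroup.
Variable R : realType.
Local Notation C := R[i].
Implicit Types (H G : set {poly C}) (p q g : {poly C}).

Lemma escape_radius p : (2 < size p)%N -> exists2 rho : R, 0 < rho &
  forall z, rho <= nm z -> 2 * nm z <= nm p.[z].
Proof.
move=> sp; have [|c [r [c0 r0 h]]] := @poly_growth R p; first exact: ltnW.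
exists (Num.max (Num.max r 1) (2 / c)) => [|z]; first by rewrite !lt_max r0.
rewrite !ge_max => /andP[/andP[rz z1]]; rewrite ler_pdivrMr// => z2.
apply: le_trans (h z rz); rewrite mulrC.
have : nm z * 2 <= nm z * (nm z * c) by rewrite ler_pM2l//; exact: lt_le_trans z1.
move=> /le_trans; apply; rewrite mulrA -expr2 mulrC ler_pM2l//.
by rewrite ler_weXn2l// -ltnS (ltn_predK sp).
Qed.

Lemma common_escape_radius (T : finType) (gen : T -> {poly C}) :
  (forall t, (2 < size (gen t))%N) -> exists2 rho : R, 0 < rho &
  forall t z, rho <= nm z -> 2 * nm z <= nm (gen t).[z].
Proof.
move=> sg; have /choice [r hr] : forall t, exists r : R, 0 < r /\
    forall z, r <= nm z -> 2 * nm z <= nm (gen t).[z].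
  by move=> t; have [r r0 h] := escape_radius (sg t); exists r.
exists (1 + \sum_t r t) => [|t z].
  by rewrite ltr_pwDl// sumr_ge0// => t _; exact/ltW/(hr t).1.
move=> h; apply: (hr t).2; apply: le_trans h.
rewrite (bigD1 t)//= addrCA lerDl addr_ge0// sumr_ge0// => t' _.
exact/ltW/(hr t').1.
Qed.

(** The semigroup with the identity adjoined, so that either outer factor in [A \Po (hh j \Po g')]
    may be trivial. *)
Definition generated1 H p := p = 'X \/ generated H p.

Lemma generated1_comp H p q : generated1 H p -> generated1 H q -> generated1 H (p \Po q).
Proof.
move=> [->|hp] [->|hq]; rewrite ?comp_polyX ?comp_polyXr ?comp_Xpoly.
- by left.
- by right.
- by right.
- by right; exact: generated_comp.
Qed.

Lemma size_generated H g : (forall p, H p -> (2 < size p)%N) ->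
  generated H g -> (2 < size g)%N.
Proof.
move=> sH; elim=> {g} [g /sH//|f g _ + _].
have := size_comp_poly f g.
case: (size f) => [|[|[|a]]]// + _; case: (size g) => [|[|[|b]]]//= + _.
by case: (size _) => [|[|[|c]]].
Qed.

Lemma size_generated1 H g : (forall p, H p -> (2 < size p)%N) ->
  generated1 H g -> (1 < size g)%N.
Proof. by move=> sH [->|/(size_generated sH)/ltnW//]; rewrite size_polyX. Qed.

Lemma generated_mono H H' : H `<=` H' -> generated H `<=` generated H'.
Proof.
move=> HH' g; elim=> {g} [g /HH'|f g _ + _]; first exact: generated_gen.
exact: generated_comp.
Qed.

Lemma KhatP G z : Khat G z <-> exists M : R, forall g, G g -> nm g.[z] <= M.
Proof.
rewrite /Khat /=; split=> [/bounded_nmP [M h]|[M h]].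
  by exists M => g Gg; apply: h; exists g.
by apply/bounded_nmP; exists M => _ [g Gg <-]; exact: h.
Qed.

Lemma Khat_forward H g z : generated H g ->
  Khat (generated H) z -> Khat (generated H) g.[z].
Proof.
move=> Gg /KhatP[M h]; apply/KhatP; exists M => f Gf.
by rewrite -horner_comp; apply: h; exact: generated_comp.
Qed.

Lemma connected_poly_image q (V : set C) : connected V -> connected [set q.[z] | z in V].
Proof.
move=> cV; apply: connected_continuous_connected cV _.
apply: continuous_subspaceT => x A /nbhs_discP[e e0 eA].
have [d d0 hd] := poly_continuous q x e0.
by apply/nbhs_discP; exists d => // z zx; apply: eA; exact: hd.
Qed.

Lemma critical_comp p q z : (p \Po q)^`().[z] = 0 ->
  q^`().[z] = 0 \/ p^`().[q.[z]] = 0.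
Proof.
rewrite deriv_comp hornerM horner_comp => /eqP; rewrite mulf_eq0.
by move=> /orP[/eqP ->|/eqP ->]; [right|left].
Qed.

Section Escape.
Variables (T : finType) (gen : T -> {poly C}) (rho : R).
Hypotheses (rho0 : 0 < rho)
  (gen_escape : forall t z, rho <= nm z -> 2 * nm z <= nm (gen t).[z]).

Lemma generated_escape g z : generated (range gen) g -> rho <= nm z ->
  2 * nm z <= nm g.[z].
Proof.
move=> /generated_word [t [s ->]] zr; apply: le_trans (word_escape gen_escape _ zr).
by rewrite ler_wpM2r ?nm_ge0//= exprS ler_peMr// exprn_ege1// ler1n.
Qed.

Lemma generated1_escape g z : generated1 (range gen) g -> rho <= nm z ->
  nm z <= nm g.[z].
Proof.
move=> [->|Gg zr]; first by rewrite hornerX.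
by have := generated_escape Gg zr; have := nm_ge0 z; lra.
Qed.

Lemma unbounded_orbit x (M : R) (t : T) : rho <= nm x ->
  exists k, M < nm (word gen (nseq k t)).[x].
Proof.
move=> xr; exists (Num.truncn (M / nm x)).+1.
have x0 : 0 < nm x := lt_le_trans rho0 xr.
apply: lt_le_trans (word_escape gen_escape _ xr).
rewrite size_nseq -ltr_pdivrMr//; apply: lt_le_trans (truncnS_gt _) _.
by rewrite -natrX ler_nat ltnW// ltn_expl.
Qed.

Lemma Khat_bounded (t : T) z : Khat (generated (range gen)) z -> nm z < rho.
Proof.
move=> /KhatP[M h]; rewrite ltNge; apply/negP => zr.
have [k] := unbounded_orbit (Num.max M (nm z)) t zr.
rewrite gt_max => /andP[hM hz]; move: hM; rewrite ltNge => /negP; apply.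
apply: h; apply/generated_word; case: k hz => [|k _].
  by rewrite /= hornerX ltxx.
by exists t, (nseq k t).
Qed.

(** Orbits starting in [Khat] satisfy the common bound [rho], which passes to limits of starting
    points. *)
Lemma Khat_closed (t : T) : closed (Khat (generated (range gen))).
Proof.
apply/closed_discP => x hx; apply/KhatP; exists rho => g Gg.
apply/ler_addgt0Pr => e e0; have [d d0 hd] := poly_continuous g x e0.
have [z Kz /hd zx] := hx d d0.
have := Khat_bounded t (Khat_forward Gg Kz).
by have := nm_leD g.[x] g.[z]; rewrite nmB; lra.
Qed.

End Escape.

End Semigroup.

(** * The filled Julia set of one polynomial and the degrees of its pullbacks *)

Section Single.
Variable R : realType.
Local Notation C := R[i].
Variable h : {poly C}.
Hypothesis size_h : (2 < size h)%N.
Implicit Types (A g : {poly C}) (x y z w : C).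

Local Notation K := (filled_Julia h).
Local Notation gen := (fun _ : unit => h).
Local Notation G1 := (generated [set h]).

Lemma range_unit : range gen = [set h].
Proof. by apply/seteqP; split=> [_ [_ _ <-]//|_ ->]; exists tt. Qed.

Lemma single_escape_radius : exists2 rho : R, 0 < rho &
  forall (t : unit) z, rho <= nm z -> 2 * nm z <= nm h.[z].
Proof. by have [rho rho0 hr] := escape_radius size_h; exists rho. Qed.

Lemma filled_Julia_closed : closed K.
Proof.
have [rho rho0 hr] := single_escape_radius.
have := @Khat_closed R _ gen rho rho0 hr tt.
by rewrite range_unit.
Qed.

Lemma size_G1 A : generated1 [set h] A -> (1 < size A)%N.
Proof. by apply: size_generated1 => _ ->. Qed.

Lemma filled_Julia_forward A z : generated1 [set h] A -> K z -> K A.[z].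
Proof. by move=> [->|GA Kz]; [rewrite hornerX|exact: Khat_forward]. Qed.

Lemma interior_forward A x : generated1 [set h] A -> K° x -> K° A.[x].
Proof.
move=> GA Kx; have oA := @poly_open_image R A (K°) (size_G1 GA) (@open_interior _ K).
have : [set A.[z] | z in K°] `<=` K.
  move=> _ [z /interior_subset Kz <-]; exact: filled_Julia_forward.
by rewrite (open_subsetE _ oA); apply; exists x.
Qed.

Definition boundary_point y := K y /\ ~ K° y.

(** A disc without boundary points of [K] lies in [K] or misses it, by connectedness; as [x] is not
    interior, the former is impossible. *)
Lemma near_boundary x (kap : R) : ~ K° x ->
  (exists2 y, boundary_point y & disc y kap x) \/ (forall z, disc x kap z -> ~ K z).
Proof.
move=> nKx; have [hby|none] := pselect (exists2 y, boundary_point y & disc y kap x).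
  by left.
right=> z zx Kz; have kap0 : 0 < kap by exact: le_lt_trans (nm_ge0 _) zx.
apply: nKx; apply/interior_discP; exists kap => //.
have /connected_epsP := @disc_connected R x kap; apply.
- by exists z.
- move=> w wx Kw; apply: contrapT => hw; apply: none; exists w; last first.
    by rewrite /disc /= nmB.
  split=> // /interior_discP[d d0 hd]; apply: hw.
  by exists d => // v _ vw; exact: hd.
- move=> w _ nKw; have oK := closed_openC filled_Julia_closed.
  have /open_discP /(_ w nKw) [d d0 hd] := oK.
  by exists d => // v _ vw; exact: hd.
Qed.

(** A limit of iterates near [x] must be infinity at escaping points. By uniformity a single iterate
    is then large at all escaping points near [x], but it is bounded by [rho] at [x] and continuous.
    So no points near [x] escape, and [x] is interior. *)
Lemma boundary_Julia x : boundary_point x -> Julia G1 (Some x).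
Proof.
move=> [Kx nKx] [U [oU Ux] nU].
have [rho rho0 hr] := single_escape_radius.
pose f n := word gen (nseq n.+1 tt).
have Gf n : G1 (f n) by rewrite -range_unit; apply/generated_word; exists tt, (nseq n tt).
have [phi [phi_homo [l hl]]] :=
  nU (fun n => pmap (f n)) (fun n => ex_intro2 _ _ (f n) (Gf n) erefl).
have phin n : (n <= phi n)%N.
  elim: n => // n IH; apply: leq_ltn_trans IH _; exact: phi_homo.
have /open_discP /(_ x Ux) [r r0 rU] := open_preimage_Some oU.
pose D : set C := [set z | nm (z - x) <= r / 2].
have r20 : 0 < r / 2 by rewrite divr_gt0.
have cD : compact (Some @` D : set (sphere R)).
  apply: compact_Some; apply: (@bounded_closed_compactC _ _ (nm x + r / 2)).
    exact: closed_cball.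
  by move=> z; rewrite /D /= => zx; have := nm_leD z x; lra.
have DU : Some @` D `<=` U.
  by move=> _ [z zx <-]; apply: rU; move: zx; rewrite /D /disc /=; lra.
have escaping z : ~ K z -> forall M : R, exists N, forall n, (N <= n)%N -> M < nm (f n).[z].
  move=> nK M; have [k kr] : exists k, rho <= nm (f k).[z].
    apply: contrapT => hk; apply: nK; apply/KhatP; exists rho => g.
    rewrite -range_unit => /generated_word [t [s ->]].
    have -> : t :: s = nseq (size s).+1 tt.
      by case: t; congr (_ :: _); elim: s => [|[] s] //= <-.
    by rewrite leNgt; apply/negP => hg; apply: hk; exists (size s); exact: ltW.
  have [m hm] := @unbounded_orbit R _ gen rho rho0 hr _ M tt kr.
  have fr : 0 < nm (f k).[z] := lt_le_trans rho0 kr.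
  exists (m + k)%N => n mn.
  have -> : f n = word gen (nseq (n - k - m) tt) \Po (word gen (nseq m tt) \Po f k).
    rewrite /f -!word_cat -!nseqD; congr (word _ (nseq _ _)); lia.
  rewrite horner_comp (horner_comp _ (f k)); apply: lt_le_trans hm _.
  set v := (word gen (nseq m tt)).[(f k).[z]].
  have [vr|vr] := leP rho (nm v).
    apply: le_trans (@word_escape R _ gen rho hr _ _ vr).
    by rewrite ler_peMl ?nm_ge0// exprn_ege1// ler1n.
  move: vr; rewrite ltNge => /negP; case; apply: (le_trans kr).
  apply: le_trans (@word_escape R _ gen rho hr _ _ kr).
  by rewrite ler_peMl ?nm_ge0// exprn_ege1// ler1n.
have limit_infinity z : D z -> ~ K z -> l (Some z) = None.
  move=> Dz nK; case E : (l (Some z)) => [y|//]; exfalso.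
  have y4 : 0 < (4 * (1 + nm y))^-1.
    by rewrite invr_gt0 mulr_gt0// ltr_wpDr ?nm_ge0.
  have [e e0 he] := half_chord_lt_of_sdist y4.
  have [N _ hN] := hl _ cD DU e e0.
  have [N' hN'] := escaping z nK (1 + 2 * nm y).
  pose n := maxn N N'.
  have := hN n (leq_maxl _ _) (Some z) (ex_intro2 _ _ z Dz erefl).
  rewrite E => /he /=; apply/negP; rewrite -leNgt; apply: half_chord_far.
  by apply/ltW/hN'; apply: leq_trans (phin n); exact: leq_maxr.
have s0 : 0 < (1 + (rho + 1))^-1 by rewrite invr_gt0; lra.
have [e e0 he] := half_chord_lt_of_sdist s0.
have [N _ /(_ N (leqnn N)) hN] := hl _ cD DU e e0.
have [d d0 hd] := poly_continuous (f (phi N)) x ltr01.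
apply: nKx; apply/interior_discP; exists (Num.min d (r / 2)); first by rewrite lt_min d0.
move=> z; rewrite /disc /= lt_min => /andP[/hd zd zr]; apply: contrapT => nK.
have Dz : D z by exact: ltW.
have := hN (Some z) (ex_intro2 _ _ z Dz erefl).
rewrite (limit_infinity z Dz nK) => /he; apply/negP; rewrite -leNgt.
apply: half_chord_None_gt.
have : nm (f (phi N)).[x] < rho.
  have Kf : K (f (phi N)).[x] by apply: filled_Julia_forward => //; right; exact: Gf.
  by apply: (@Khat_bounded R _ gen rho rho0 hr tt); rewrite range_unit.
by have := nm_leD (f (phi N)).[z] (f (phi N)).[x]; lra.
Qed.

(* Bounded degree of the pullbacks of discs centred on the boundary of the
   filled Julia set, the common consequence of (semi-)hyperbolicity. *)
Definition uniform_degree (del : R) (N : nat) := forall y A x, boundary_point y ->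
  generated1 [set h] A -> disc y del A.[x] ->
  forall w, disc y del w ->
  (cnt A (connected_component [set z | disc y del A.[z]] x) w <= N)%N.

(** The added unit covers the identity, whose count is at most 1 even when [N] is 0. *)
Lemma uniform_degreeW (del : R) (N : nat) :
  (forall y A x, boundary_point y -> G1 A -> disc y del A.[x] ->
    forall w, disc y del w ->
    (cnt A (connected_component [set z | disc y del A.[z]] x) w <= N)%N) ->
  uniform_degree del N.+1.
Proof.
move=> hN y A x by_ [->|GA] Ax w yw; last exact/leqW/hN.
rewrite (leq_trans (count_size _ _))// size_rootseq_sub ?size_polyX//.
Qed.

Lemma semi_hyperbolic_uniform_degree : semi_hyperbolic G1 ->
  exists (del : R) N, 0 < del /\ uniform_degree del N.
Proof.
move=> [d [N [d0 hN]]]; have [s s0 hs] := sdist_lt_of_half_chord d0.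
exists s, N.+1; split=> //; apply: uniform_degreeW => y A x by_ GA Ax w yw.
have sub : Some @` disc y s `<=` sball (Some y : sphere R) d.
  move=> _ [v vy <-]; apply: hs; apply: le_lt_trans (half_chord_Some_le _ _) _.
  by rewrite nmB.
have sA : (1 < size A)%N by apply: size_G1; right.
have [|n nN hn] := hN (Some y) A (boundary_Julia by_) GA (Some x).
  by apply: sub; exists A.[x].
have := hn (Some w) (sub _ (ex_intro2 _ _ w yw erefl)).
rewrite covering_sum// => cn; apply: leq_trans nN; rewrite -cn.
apply: cnt_mono => z Vz /=.
pose W : set (sphere R) := Some @` connected_component [set z | disc y s A.[z]] x.
suff : W `<=` connected_component (pmap A @^-1` sball (Some y : sphere R) d) (Some x).
  by apply; exists z.
apply: connected_component_max.
- by exists x => //; exact: connected_component_refl.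
- move=> _ [v /connected_component_sub vA <-]; apply: sub.
  by exists A.[v].
- by apply: connected_Some; exact: component_connected.
Qed.

Lemma postcritical_Some A z : G1 A -> A^`().[z] = 0 ->
  (\bigcup_(g in G1) CV g) (Some A.[z]).
Proof. by move=> GA Az; exists A => //; exists (Some z). Qed.

(** The boundary of [K] is compact and lies in the Julia set, so it has positive distance [d] from
    the critical values of all iterates. Over discs of radius [d] about boundary points all counts
    are then at most 1. *)
Lemma hyperbolic_uniform_degree : hyperbolic G1 ->
  exists (del : R) N, 0 < del /\ uniform_degree del N.
Proof.
move=> hyp; have [rho rho0 hr] := single_escape_radius.
suff [d d0 hd] : exists2 d : R, 0 < d & forall y A z, boundary_point y -> G1 A ->
    A^`().[z] = 0 -> ~ disc y d A.[z].
  exists d, 2%N; split=> //; apply: uniform_degreeW => y A x by_ GA Ax w yw.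
  have sA : (1 < size A)%N by apply: size_G1; right.
  have nc z : disc y d A.[z] -> A^`().[z] != 0.
    by move=> zd; apply/eqP => /(hd y A z by_ GA).
  apply: cnt_le1 => //; last by move=> z /connected_component_sub; exact: nc.
  apply: (@injective_without_critical_values _ A y d) => //.
    exact: component_connected.
  exact: connected_component_sub.
apply: contrapT => nh.
have /choice [f hf] : forall n : nat, exists t : C * ({poly C} * C),
    [/\ boundary_point t.1, G1 t.2.1, t.2.1^`().[t.2.2] = 0 &
        nm (t.2.1.[t.2.2] - t.1) < n.+1%:R^-1].
  move=> n; apply: contrapT => nt; apply: nh; exists n.+1%:R^-1.
    by rewrite invr_gt0.
  by move=> y A z by_ GA Az yz; apply: nt; exists (y, (A, z)).
have bK z : K z -> nm z <= rho.
  by move=> Kz; apply/ltW/(@Khat_bounded R _ gen rho rho0 hr tt); rewrite range_unit.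
have [y hy] := bounded_cluster (fun n => bK _ (let: And4 h _ _ _ := hf n in h.1)).
have by_ : boundary_point y.
  split.
    have /closed_discP := filled_Julia_closed; apply => r r0.
    have [n _ yn] := hy r r0 0%N; exists (f n).1 => //.
    by have [[]] := hf n.
  move=> /interior_discP[r r0 rK]; have [n _ yn] := hy r r0 0%N.
  have [[_ nK] _ _ _] := hf n; apply: nK.
  have /open_discP /(_ _ yn) [s s0 hs] := @open_disc _ y r.
  by apply/interior_discP; exists s => //; exact: subset_trans rK.
apply: (boundary_Julia by_); apply: hyp => U /=.
rewrite nbhsE => -[V [oV Vy] VU].
have /open_discP /(_ y Vy) [r r0 rV] := open_preimage_Some oV.
have r20 : 0 < r / 2 by rewrite divr_gt0.
have [N _ hN] := near_infty_natSinv_lt (PosNum r20).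
have [n Nn yn] := hy _ r20 N; have [_ GA Az h1] := hf n.
exists (Some (f n).2.1.[(f n).2.2]); split; first exact: postcritical_Some.
apply: VU; apply: rV; rewrite /disc /=.
have := hN n Nn => /= h2; have h3 := lt_trans h1 h2.
by have := nm_tri (f n).1 (f n).2.1.[(f n).2.2] y; lra.
Qed.

Section UniformDegree.
Variables (del : R) (N : nat).
Hypotheses (del0 : 0 < del) (hdel : uniform_degree del N).

(** A point of modulus above [rho + del] is never moved inwards, so it cannot reach a disc of radius
    [del] about a point of [K]. This bounds the diameter of [V] independently of [A]. *)
Lemma pullback_contraction : exists2 D : R, 0 < D & forall y A x z, boundary_point y ->
  generated1 [set h] A -> disc y del A.[x] ->
  let V := connected_component [set z | disc y del A.[z]] x in
  V z -> exists2 u, V u /\ A.[u] = y & (nm (z - u) / D) ^+ N <= nm (A.[z] - y) / del.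
Proof.
have [rho rho0 hr] := single_escape_radius.
exists (2 * (rho + del)); first by rewrite mulr_gt0// addr_gt0.
move=> y A x z by_ GA Ax V Vz.
have Ky : nm y < rho.
  by apply: (@Khat_bounded R _ gen rho rho0 hr tt); rewrite range_unit; exact: by_.1.
have bV v : V v -> nm v <= rho + del.
  move=> /connected_component_sub /= vA; rewrite leNgt; apply/negP => hv.
  have := @generated1_escape R _ gen rho hr A v.
  rewrite range_unit => /(_ GA) h1; have := h1 (ltW (lt_trans (_ : rho < rho + del) hv)).
  rewrite ltrDl => /(_ del0); move: vA; rewrite /disc /= => vA.
  have := nm_leD A.[v] y => h2 h3.
  suff : (0 : R) < 0 by rewrite ltxx.
  lra.
apply: contraction => //; first exact: size_G1.
- by rewrite mulr_gt0// addr_gt0.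
- by apply: hdel => //; exact: disc_center.
- move=> v w /bV hv /bV hw; have := nmD v (- w); rewrite nmN; lra.
Qed.

(** If [A.[x]] came too close to [y], contraction would give a preimage of [y] within [eta] of [x],
    hence interior to [K]; but interior points are mapped to interior points. *)
Lemma interior_orbit (eta : R) : 0 < eta -> exists2 eta', 0 < eta' &
  forall x A y, disc x eta `<=` K -> generated1 [set h] A -> boundary_point y ->
  eta' <= nm (A.[x] - y).
Proof.
move=> eta0; have [D D0 hD] := pullback_contraction.
pose t := (eta / D) ^+ N; have t0 : 0 < t by rewrite exprn_gt0 ?divr_gt0.
exists (Num.min del (del * t)); first by rewrite lt_min del0 mulr_gt0.
move=> x A y xK GA by_; rewrite leNgt; apply/negP; rewrite lt_min => /andP[xd xt].
have [|u [Vu uy]] := hD y A x x by_ GA xd; first exact: connected_component_refl.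
move=> hu; have {}hu : (nm (x - u) / D) ^+ N < t.
  by apply: le_lt_trans hu _; rewrite ltr_pdivrMr// mulrC.
have xu : nm (x - u) < eta.
  rewrite ltNge; apply/negP => h1; move: hu; rewrite ltNge => /negP; apply.
  by rewrite lerXn2r ?nnegrE ?divr_ge0 ?nm_ge0 ?(ltW D0) ?(ltW eta0)// ler_pM2r ?invr_gt0.
have Ku : K° u.
  have xu' : disc x eta u by rewrite /disc /= nmB.
  have /open_discP /(_ _ xu') [s s0 hs] := @open_disc _ x eta.
  by apply/interior_discP; exists s => //; exact: subset_trans xK.
by apply: by_.2; rewrite -uy; exact: interior_forward.
Qed.

(* W is covered by at most N small discs; being connected it is small. *)
Lemma pullback_small (tau : R) : 0 < tau -> exists2 d, 0 < d <= del &
  forall y A x, boundary_point y -> generated1 [set h] A -> disc y d A.[x] ->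
  forall z, connected_component [set z | disc y d A.[z]] x z -> nm (z - x) < tau.
Proof.
move=> tau0; have [D D0 hD] := pullback_contraction.
pose r := tau / (2 * N.+1%:R).
have r0 : 0 < r by rewrite divr_gt0// mulr_gt0.
pose t := (r / D) ^+ N; have t0 : 0 < t by rewrite exprn_gt0 ?divr_gt0.
exists (Num.min del (del * t)).
  by rewrite lt_min del0 mulr_gt0//= ge_min lexx.
set d := Num.min _ _; move=> y A x by_ GA Ax z0 Wz0.
have dd : d <= del by rewrite /d ge_min lexx.
have dt : d <= del * t by rewrite /d ge_min lexx orbT.
set W := connected_component _ x in Wz0.
have WV : W `<=` connected_component [set z | disc y del A.[z]] x.
  by apply: component_mono => z; rewrite /disc /= => /lt_le_trans; apply.
have Ax' : disc y del A.[x] by exact: lt_le_trans Ax dd.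
have sA := size_G1 GA.
pose V := connected_component [set z | disc y del A.[z]] x.
pose s := undup [seq u <- rootseq (A - y%:P) | u \in V].
have ss : (size s <= N)%N.
  by rewrite (leq_trans (size_undup _))// size_filter; apply: hdel => //; exact: disc_center.
have near_s z : W z -> exists u : seq_sub s, nm (z - val u) < r.
  move=> Wz; have [u [Vu uy] hu] := hD y A x z by_ GA Ax' (WV _ Wz).
  have us : u \in s by rewrite mem_undup mem_filter mem_rootseq_sub// uy eqxx andbT; exact: mem_set.
  exists (SeqSub us) => /=; rewrite ltNge; apply/negP => h1.
  have : nm (A.[z] - y) / del < t.
    rewrite ltr_pdivrMr// mulrC; apply: lt_le_trans dt.
    exact: (connected_component_sub Wz).
  move=> /(le_lt_trans hu); rewrite ltNge => /negP; apply.
  clearbody r; rewrite lerXn2r ?nnegrE ?divr_ge0 ?nm_ge0 ?(ltW D0) ?(ltW r0)//.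
  by rewrite ler_pM2r ?invr_gt0.
rewrite ltNge; apply/negP => h1.
have cI : is_interval [set nm (z - x) | z in W].
  apply/connected_intervalP; apply: connected_continuous_connected.
    exact: component_connected.
  apply: continuous_subspaceT => v; apply: continuous_epsP => e e0.
  exists e => // w wv; rewrite ltr_norml.
  have := nm_tri v w x; have := nm_tri w v x; rewrite (nmB v w); lra.
(* On the connected set [W] the distance to [x] takes every value [k * c] with k <= N. Of these N +
   1 points two are within [r] of the same root, hence less than [2 * r = c] apart, though their
   distances to [x] differ by at least [c]. *)
pose c := tau / N.+1%:R; have c0 : 0 < c by rewrite divr_gt0.
have /choice [p hp] : forall k : 'I_N.+1, exists p, W p /\ nm (p - x) = k%:R * c.
  move=> k; have [|||p Wp pE] := cI 0 (nm (z0 - x)) _ _ (k%:R * c).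
  - by exists x; [exact: connected_component_refl|rewrite subrr Normc.normc0].
  - by exists z0.
  - apply/andP; split; first by rewrite mulr_ge0// ltW.
    apply: le_trans h1; rewrite /c mulrA ler_pdivrMr// mulrC ler_pM2l// ler_nat.
    exact: ltnW (ltn_ord k).
  - by exists p.
have /choice [u hu] : forall k : 'I_N.+1, exists u : seq_sub s, nm (p k - val u) < r.
  by move=> k; apply: near_s; exact: (hp k).1.
have /injectivePn [k [l kl ul]] : ~~ injectiveb u.
  apply/negP => /injectiveP /leq_card; rewrite card_ord => hc.
  by move: hc; rewrite card_seq_sub ?undup_uniq// ltnNge ss.
have hk := hu k; have hl := hu l; rewrite -ul in hl.
have pkl : nm (p k - p l) < 2 * r.
  by have := nm_tri (val (u k)) (p k) (p l); rewrite (nmB (val (u k)) (p l)); lra.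
have : c <= nm (p k - p l).
  clearbody c.
  have := nm_tri (p l) (p k) x; have := nm_tri (p k) (p l) x.
  rewrite (hp k).2 (hp l).2 (nmB (p l) (p k)).
  have [lt_kl|lt_lk|e] := ltngtP k l; last by move: kl; rewrite (val_inj e) eqxx.
  - have : k%:R + 1 <= l%:R :> R by rewrite natr1 ler_nat.
    by move=> /(ler_wpM2r (ltW c0)); rewrite mulrDl mul1r; lra.
  - have : l%:R + 1 <= k%:R :> R by rewrite natr1 ler_nat.
    by move=> /(ler_wpM2r (ltW c0)); rewrite mulrDl mul1r; lra.
rewrite leNgt => /negP; apply; apply: lt_le_trans pkl _.
by rewrite /r /c invfM mulrCA mulVKf ?pnatr_eq0.
Qed.

End UniformDegree.
End Single.

(** * Perturbations of the semigroup generated by h1 *)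

Section Family.
Variable R : realType.
Local Notation C := R[i].
Variables (h1 : {poly C}) (I : finType) (hh : I -> {poly C}) (b : I -> C) (eps : R).
Implicit Types (A g q : {poly C}) (x y z w : C).

Local Notation K := (filled_Julia h1).
Local Notation H := ([set h1] `|` range hh).
Local Notation G := (generated H).
Local Notation G1 := (generated [set h1]).

Definition family_gen (t : option I) : {poly C} := if t is Some j then hh j else h1.
Local Notation gen := family_gen.

Lemma range_family_gen : range gen = H.
Proof.
apply/seteqP; split=> [_ [[j|] _ <-]|_ [->|[j _ <-]]].
- by right; exists j.
- by left.
- by exists None.
- by exists (Some j).
Qed.

Hypotheses (size_h1 : (2 < size h1)%N) (size_hh : forall j, (2 < size (hh j))%N).

Lemma size_family_gen t : (2 < size (gen t))%N.
Proof. by case: t. Qed.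

Lemma size_H p : H p -> (2 < size p)%N.
Proof. by move=> [->|[j _ <-]]. Qed.

Lemma G1_sub_G : G1 `<=` G.
Proof. by apply: generated_mono => p; left. Qed.

(** [A] collects the factors [h1] applied after the last [hh j]. *)
Lemma family_decomposition g : G g -> G1 g \/
  exists A j g', [/\ generated1 [set h1] A, generated1 H g' & g = A \Po (hh j \Po g')].
Proof.
elim=> {g} [g [->|[j _ <-]]|f g Gf IHf Gg IHg].
- by left; exact: generated_gen.
- right; exists 'X, j, 'X; split; [by left|by left|].
  by rewrite comp_polyXr comp_polyX.
- case: IHf => [G1f|[A [j [g' [GA Gg' ->]]]]].
    case: IHg => [G1g|[A [j [g' [GA Gg' ->]]]]].
      by left; exact: generated_comp.
    right; exists (f \Po A), j, g'; split=> //; last by rewrite comp_polyA.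
    by apply: generated1_comp => //; right.
  right; exists A, j, (g' \Po g); split=> //; last by rewrite -!comp_polyA.
  by apply: generated1_comp => //; right.
Qed.

Hypotheses (eps0 : 0 < eps) (disc_K : forall j, disc (b j) eps `<=` K)
  (hh_K : forall j z, K z -> disc (b j) (eps / 4) (hh j).[z])
  (hh_crit : forall j z, (hh j)^`().[z] = 0 -> (hh j).[z] = b j)
  (h1_crit : forall z, h1^`().[z] = 0 -> K z).

Lemma family_forward g z : generated1 H g -> K z -> K g.[z].
Proof.
move=> [->|Gg]; first by rewrite hornerX.
elim: Gg z => {g} [g [->|[j _ <-]]|f g _ IHf _ IHg] z Kz.
- by apply: filled_Julia_forward => //; right; exact: generated_gen.
- apply: (@disc_K j); have := @hh_K j _ Kz; have e0 := eps0; rewrite /disc /=; lra.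
- by rewrite horner_comp; exact/IHf/IHg.
Qed.

Lemma family_Khat : Khat G = K.
Proof.
apply/seteqP; split=> z.
  by move=> /KhatP[M hM]; apply/KhatP; exists M => g /G1_sub_G; exact: hM.
move=> Kz; have [rho rho0 hr] := single_escape_radius size_h1.
apply/KhatP; exists rho => g Gg; apply: ltW.
apply: (@Khat_bounded R _ (fun _ : unit => h1) rho rho0 hr tt); rewrite range_unit.
by apply: family_forward => //; right.
Qed.

Lemma family_critical_value g z : generated1 H g -> g^`().[z] = 0 -> K g.[z].
Proof.
move=> [->|Gg]; first by rewrite derivX hornerC => /eqP; rewrite oner_eq0.
elim: Gg z => {g} [g [->|[j _ <-]]|f g Gf IHf Gg IHg] z.
- move=> /h1_crit; apply: filled_Julia_forward; right; exact: generated_gen.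
- by move=> /hh_crit ->; apply: (@disc_K j); exact: disc_center.
- move=> /critical_comp [/IHg|/IHf]; rewrite horner_comp//.
  by apply: family_forward; right.
Qed.

(** A critical value coming from [g'] lies in [K] and is then sent near [b j]; the one coming from
    [hh j] is [b j] itself. *)
Lemma family_critical_value_disc j g z : generated1 H g -> (hh j \Po g)^`().[z] = 0 ->
  disc (b j) (eps / 4) (hh j \Po g).[z].
Proof.
move=> Gg /critical_comp [/(family_critical_value Gg) Kg|/hh_crit E]; rewrite horner_comp.
  exact: hh_K.
by rewrite E; apply: disc_center; rewrite divr_gt0.
Qed.

Lemma CV_SomeP g u : (1 < size g)%N -> CV g (Some u) -> exists2 z, g^`().[z] = 0 & g.[z] = u.
Proof.
move=> sg [[z|] /= hz]; first by move=> [<-]; exists z.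
by have := pmap_None sg; rewrite /pmap => -> .
Qed.

Lemma postcritical_approx (G' : set {poly C}) x (r : R) :
  (forall g, G' g -> (1 < size g)%N) -> postcritical G' (Some x) -> 0 < r ->
  exists g z, [/\ G' g, g^`().[z] = 0 & nm (g.[z] - x) < r].
Proof.
move=> sG' cx r0.
have nx : nbhs (Some x : sphere R) (Some @` disc x r).
  by apply: one_point_compactification_some_nbhs; apply/nbhs_discP; exists r.
have [v [[g G'g gu] [u ux uE]]] := cx _ nx; rewrite -uE in gu.
have [z gz uz] := CV_SomeP (sG' _ G'g) gu.
by exists g, z; split=> //; rewrite uz.
Qed.

Lemma family_postcritical x : postcritical G (Some x) -> K x.
Proof.
move=> Px; have /closed_discP := filled_Julia_closed size_h1; apply => r r0.
have [|g [z [Gg gz gx]]] := postcritical_approx _ Px r0.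
  by move=> g Gg; apply/ltnW/(size_generated _ Gg)/size_H.
by exists g.[z] => //; apply: family_critical_value => //; right.
Qed.

Lemma family_classG : classG G.
Proof.
split.
- exists H; split=> //; first by exists h1; left.
  by move=> p /size_H; rewrite /nonconstant size_pdeg => /ltnW.
- move=> g Gg; have := size_generated size_H Gg.
  by rewrite /pdeg; case: (size g) => [|[|]].
have [rho rho0 hr] := single_escape_radius size_h1.
apply/bounded_nmP; exists rho => z /family_postcritical Kz; apply: ltW.
by apply: (@Khat_bounded R _ (fun _ : unit => h1) rho rho0 hr tt); rewrite range_unit.
Qed.

Lemma family_escape_radius : exists2 rho : R, 0 < rho &
  forall t z, rho <= nm z -> 2 * nm z <= nm (gen t).[z].
Proof. exact: common_escape_radius size_family_gen. Qed.

Lemma Fatou_interior x : K° x -> Fatou G (Some x).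
Proof.
have [rho rho0 hr] := single_escape_radius size_h1.
apply: (@Fatou_bounded _ _ _ rho) => g z Gg Kz; apply: ltW.
apply: (@Khat_bounded R _ (fun _ : unit => h1) rho rho0 hr tt); rewrite range_unit.
by apply: family_forward => //; right.
Qed.

Lemma Julia_bounded : exists2 rho : R, 0 < rho &
  forall p, Julia G p -> exists2 x, p = Some x & nm x <= rho /\ ~ K° x.
Proof.
have [rho rho0 hr] := family_escape_radius.
exists rho => // y Jy.
have sg t : (1 < size (gen t))%N by exact/ltnW/size_family_gen.
have FI := Fatou_infinity sg rho0 hr; rewrite range_family_gen in FI.
case: y Jy => [x|] Jx; last by case: Jx; apply: FI.
exists x => //; split.
  by rewrite leNgt; apply/negP => xr; apply: Jx; apply: FI => _ [<-].
by move=> Kx; apply: Jx; exact: Fatou_interior.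
Qed.

Section UniformDegree.
Variables (del : R) (N : nat).
Hypotheses (del0 : 0 < del) (hdel : uniform_degree h1 del N).

(** Radius [eps / 2] has room for the critical values, within [eps / 4] of [b j], and for pullbacks
    of size [eps / 4]; each of its points still has a disc of radius [eps / 2] in [K], as
    [interior_orbit] requires. *)
Lemma family_orbit : exists2 eta : R, 0 < eta & forall j x A y,
  disc (b j) (eps / 2) x -> generated1 [set h1] A -> boundary_point h1 y ->
  eta <= nm (A.[x] - y).
Proof.
have e20 : 0 < eps / 2 by rewrite divr_gt0.
have [eta eta0 h] := interior_orbit size_h1 del0 hdel e20.
exists eta => // j x A y xb GA by_; apply: h => // z; rewrite /disc /= => zx.
apply: (@disc_K j); move: xb; rewrite /disc /= => xb.
by have := nm_tri x z (b j); lra.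
Qed.

(** Near a boundary point of [K], critical values of [G] are critical values of iterates of [h1],
    since those passing through some [hh j] stay [eta] away. A postcritical point of [G] on the
    boundary would thus be postcritical for [h1], although it lies in the Julia set of [h1]. *)
Lemma family_hyperbolic : hyperbolic G1 -> hyperbolic G.
Proof.
move=> hyp; have [eta eta0 heta] := family_orbit.
have [rho rho0 hr] := family_escape_radius.
move=> [x|] Px; last first.
  have sg t : (1 < size (gen t))%N by exact/ltnW/size_family_gen.
  by have := Fatou_infinity sg rho0 hr (z := None); rewrite range_family_gen; apply.
apply: Fatou_interior; apply: contrapT => nKx.
have by_ : boundary_point h1 x by split=> //; exact: family_postcritical.
apply: (boundary_Julia size_h1 by_); apply: hyp => U nU.
have [r r0 rU] : exists2 r, 0 < r & Some @` disc x r `<=` U.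
  move: nU => /= /nbhs_discP[r r0 rU]; exists r => // _ [u ux <-].
  exact: rU.
have [||g [z [Gg gz]]] := postcritical_approx (r := Num.min r eta) _ Px.
- by move=> g Gg; apply/ltnW/(size_generated _ Gg)/size_H.
- by rewrite lt_min r0.
rewrite lt_min => /andP[gr geta].
suff [A [w [GA Aw Ag]]] : exists A w, [/\ G1 A, A^`().[w] = 0 & A.[w] = g.[z]].
  exists (Some g.[z]); split; last by apply: rU; exists g.[z].
  by rewrite -Ag; exact: postcritical_Some.
have [G1g|[A [j [g' [GA Gg' E]]]]] := family_decomposition Gg.
  by exists g, z.
move: gz geta; rewrite E => /critical_comp[/(family_critical_value_disc Gg') vb|Av] geta.
  exfalso; move: geta; rewrite ltNge => /negP; apply; rewrite horner_comp.
  by apply: (heta j) => //; move: vb; have e0 := eps0; rewrite /disc /=; lra.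
case: GA => [AX|GA].
  by move: Av; rewrite AX derivX hornerC => /eqP; rewrite oner_eq0.
by exists A, (hh j \Po g').[z]; rewrite (horner_comp A).
Qed.

(* Either g has no critical value near x, or g = A o hh j o g' with the
   pullbacks under A small, hence avoiding the critical values of hh j o g'. *)
Lemma family_local_degree : exists2 kap : R, 0 < kap & forall x g (V : set C),
  ~ K° x -> G g -> connected V -> V `<=` [set z | disc x kap g.[z]] ->
  forall w, disc x kap w -> (cnt g V w <= N.+1)%N.
Proof.
have [eta eta0 heta] := family_orbit.
have e0 := eps0; have tau0 : 0 < eps / 4 by rewrite divr_gt0.
have [d /andP[d0 ddel] hd] := pullback_small size_h1 del0 hdel tau0.
pose d1 := Num.min d eta; have d10 : 0 < d1 by rewrite lt_min d0.
have d1d : d1 <= d by rewrite /d1 ge_min lexx.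
have d1eta : d1 <= eta by rewrite /d1 ge_min lexx orbT.
exists (d1 / 2) => [|x g V nKx Gg cV Vg w wx]; first by rewrite divr_gt0.
have [[z0 Vz0]|V0] := pselect (V !=set0); last first.
  rewrite leqNgt; apply/negP => /ltnW/(leq_trans (ltn0Sn N)).
  have sg : (1 < size g)%N by apply/ltnW/(size_generated _ Gg)/size_H.
  by move=> /(cnt_gt0 _ _ sg)[z Vz _]; apply: V0; exists z.
have sg : (1 < size g)%N by apply/ltnW/(size_generated _ Gg)/size_H.
have inj_case q u (r : R) : (1 < size q)%N ->
    (forall z, disc u r q.[z] -> q^`().[z] != 0) ->
    V `<=` [set z | disc u r q.[z]] -> forall w, (cnt q V w <= 1)%N.
  move=> sq nc Vq w'; apply: cnt_le1 => //; last by move=> z /Vq; exact: nc.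
  exact: injective_without_critical_values nc cV Vq.
(* When the disc misses [K] it contains no critical value of [g] and the count is at most 1, which
   is below [N.+1] for every [N]. *)
have [[y by_ xy]|far] := near_boundary size_h1 (d1 / 2) nKx; last first.
  apply: leq_trans (ltn0Sn N).
  apply: (inj_case g x (d1 / 2)) => // z zx; apply/eqP => gz; apply: (far _ zx).
  by apply: family_critical_value => //; right.
have discxy u : disc x (d1 / 2) u -> disc y d u.
  move: xy; rewrite /disc /= => xy ux; have := nm_tri x u y; lra.
have discxy1 u : disc x (d1 / 2) u -> nm (u - y) < eta.
  move: xy; rewrite /disc /= => xy ux; have := nm_tri x u y; lra.
have disc_del u : disc y d u -> disc y del u.
  by rewrite /disc /= => /lt_le_trans; apply.
have [G1g|[A [j [g' [GA Gg' E]]]]] := family_decomposition Gg.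
  apply: leqW; apply: leq_trans (hdel by_ (or_intror G1g) (disc_del _ (discxy _ (Vg _ Vz0)))
    (disc_del _ (discxy _ wx))).
  apply: cnt_mono; apply: connected_component_max => // z /Vg.
  by move=> /discxy; exact: disc_del.
pose q := hh j \Po g'.
have sA : (1 < size A)%N by apply: size_generated1 GA => _ ->.
have sq : (1 < size q)%N.
  apply: (size_generated1 size_H); apply: generated1_comp => //.
  by right; apply: generated_gen; right; exists j.
have gE z : g.[z] = A.[q.[z]] by rewrite E horner_comp.
have Aq : disc y d A.[q.[z0]] by rewrite -gE; exact/discxy/Vg.
pose W := connected_component [set z | disc y d A.[z]] q.[z0].
have VW z : V z -> W q.[z].
  move=> Vz; have : [set q.[z] | z in V] `<=` W.
    apply: connected_component_max; [by exists z0| |exact: connected_poly_image].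
    by move=> _ [v Vv <-] /=; rewrite -gE; exact/discxy/Vg.
  by apply; exists z.
(* [q] maps [V] into [W], which lies within [eps / 4] of [q.[z0]]. A critical value of [q] there
   would put [q.[z0]] within [eps / 2] of [b j], so [A] would send it at least [eta] away from [y].
   Hence each [u] in [W] has at most one preimage in [V], and the count for [g] is bounded by that
   of [A] on [W]. *)
have cnt1 u : (cnt q V u <= (u \in W))%N.
  have [Wu|nWu] := boolP (u \in W); last first.
    rewrite leqNgt; apply/negP => /(cnt_gt0 _ _ sq)[z Vz qz].
    by move: nWu => /negP; apply; rewrite -qz; exact/mem_set/VW.
  apply: (inj_case q q.[z0] (eps / 4)) => // [z zq|z /VW Wz]; last exact: hd by_ GA Aq _ Wz.
  apply/eqP => /(family_critical_value_disc Gg') zb.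
  have : disc (b j) (eps / 2) q.[z0].
    move: zb zq; rewrite /disc /= -/q => zb zq.
    have := nm_tri q.[z] q.[z0] (b j); rewrite (nmB q.[z0] q.[z]); lra.
  move=> /(heta j _ _ _)/(_ GA by_); rewrite leNgt => /negP; apply.
  by rewrite -gE; exact/discxy1/Vg.
rewrite E cnt_comp//.
have : (cnt A W w <= N)%N.
  apply: leq_trans (hdel by_ GA (disc_del _ Aq) (disc_del _ (discxy _ wx))).
  by apply/cnt_mono/component_mono => z; exact: disc_del.
move=> /leqW; apply: leq_trans.
rewrite /cnt -sum1_count [leqRHS]big_mkcond /=; apply: leq_sum => u _.
by apply: leq_trans (cnt1 u) _; case: (u \in W).
Qed.

Lemma open_half_chord_ball y (s : R) : 0 < s ->
  open [set w : C | half_chord (Some y : sphere R) (Some w) < s].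
Proof.
move=> s0; pose rt (x : C) := Num.sqrt (1 + nm x ^+ 2).
have E w : half_chord (Some y : sphere R) (Some w) < s <-> nm (w - y) < s * rt y * rt w.
  by rewrite /= ltr_pdivrMr ?mulr_gt0 ?rt_gt0// nmB mulrA.
have rt_lip u v : rt u <= rt v + nm (u - v).
  rewrite -[leRHS]ger0_norm ?addr_ge0 ?sqrtr_ge0 ?nm_ge0// -sqrtr_sqr.
  rewrite ler_wsqrtr// sqrrD rt_sqr -!addrA lerD2l.
  have h2 : nm v * nm (u - v) <= rt v * nm (u - v) by rewrite ler_wpM2r ?nm_ge0 ?rt_ge.
  have : nm u ^+ 2 <= (nm v + nm (u - v)) ^+ 2.
    by rewrite ler_sqr ?nnegrE ?addr_ge0 ?nm_ge0 ?nm_leD.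
  by rewrite sqrrD !mulr2n; lra.
apply/open_discP => w /E hw; set k := s * rt y in hw.
have k0 : 0 < k by rewrite mulr_gt0 ?rt_gt0.
exists ((k * rt w - nm (w - y)) / (1 + k)); first by rewrite divr_gt0 ?subr_gt0//; lra.
move=> v; rewrite /disc /= ltr_pdivlMr; last by lra.
move=> vw; apply/E; rewrite -/k.
have := nm_tri w v y; have := rt_lip w v; rewrite (nmB w v) => h2 h3.
have : k * rt w <= k * (rt v + nm (v - w)) by rewrite ler_pM2l.
lra.
Qed.

Lemma family_semi_hyperbolic : semi_hyperbolic G.
Proof.
have [kap kap0 hk] := family_local_degree.
have [rho rho0 hJ] := Julia_bounded.
(* The first bound excludes infinity and makes the spherical disc star-shaped; the second places it
   in the Euclidean disc of radius [kap]. *)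
pose s := Num.min (1 / (2 * (1 + rho))) (kap / (4 * (1 + rho) ^+ 2)).
have r1 : 0 < 1 + rho by rewrite addr_gt0.
have s0 : 0 < s by rewrite lt_min !divr_gt0 ?mulr_gt0 ?exprn_gt0.
have s1 : s * (1 + rho) <= 1 / 2.
  rewrite -ler_pdivlMr//; apply: (@le_trans _ _ (1 / (2 * (1 + rho)))).
    by rewrite /s ge_min lexx.
  by rewrite !mul1r invfM.
have s2 : 4 * s * (1 + rho) ^+ 2 <= kap.
  have : s * (4 * (1 + rho) ^+ 2) <= kap.
    by rewrite -ler_pdivlMr ?mulr_gt0 ?exprn_gt0// /s ge_min lexx orbT.
  by rewrite mulrA [s * 4]mulrC.
have [e e0 he] := half_chord_lt_of_sdist s0.
pose e' := Num.min e pi.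
have e'p : 0 < e' <= pi by rewrite lt_min e0 pi_gt0 /e' ge_min lexx orbT.
pose s' := sin (e' / 2); have s'0 : 0 < s' by exact: sin_half_gt0.
exists e', N.+1; split; first by case/andP: e'p.
move=> y0 g Jy Gg z hz.
have [y E [yr nKy]] := hJ _ Jy; subst y0.
pose B := [set w : C | half_chord (Some y : sphere R) (Some w) < s'].
have [subs' _ nN] := half_chord_ball yr s0 s1.
have ballE (p : sphere R) :
    sball (Some y : sphere R) e' p <-> half_chord (Some y : sphere R) p < s'.
  by rewrite /sball /= sdist_ltP.
have ls (p : sphere R) :
    half_chord (Some y : sphere R) p < s' -> half_chord (Some y : sphere R) p < s.
  move=> /ballE h; apply: he; apply: lt_le_trans h _.
  by rewrite /e' ge_min lexx.
have sB : star_shaped B y.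
  case: (leP s' s) => [ss|ss].
    have [] // := @half_chord_ball R y rho s' yr s'0.
    by apply: le_trans s1; rewrite ler_pM2r.
  move=> w Bw t t01; have [_ h _] := half_chord_ball yr s0 s1.
  by apply: lt_trans ss; apply: h => //; exact: ls.
have cB : connected B by exact: star_shaped_connected sB.
have oB : open B by exact: open_half_chord_ball.
have Bk w : B w -> disc y kap w.
  by move=> /ls /subs'; rewrite /disc /= => /lt_le_trans; apply.
have sg : (1 < size g)%N by apply/ltnW/(size_generated _ Gg)/size_H.
have preE : pmap g @^-1` sball (Some y : sphere R) e' = Some @` [set v | B g.[v]].
  apply/seteqP; split=> [[v|] /ballE|_ [v /= Bv <-]]; last exact/ballE.
    by move=> Bv; exists v.
  by move=> /ls hN; case: nN; move: hN; have := pmap_None sg; rewrite /pmap => ->.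
rewrite preE in hz *; case: hz => x Bx xz; subst z.
rewrite connected_component_Some//.
set V := connected_component _ x.
have SV : Some @^-1` (Some @` V : set (sphere R)) = V :> set C.
  by apply/seteqP; split=> [v [u Vu [<-]]//|v Vv]; exists v.
have cntN w : B w -> (cnt g V w <= N.+1)%N.
  move=> Bw; apply: (hk y) => //; [exact: component_connected| |exact: Bk].
  by move=> v /connected_component_sub /= /Bk.
exists (cnt g V g.[x]); first exact: cntN.
move=> [w|] /ballE; last by move=> /ls.
move=> Bw; rewrite covering_sum// SV; exact: cnt_constant.
Qed.

End UniformDegree.
End Family.

Section Unicritical.
Variable R : realType.
Local Notation C := R[i].
Implicit Types (a b z : C) (d : nat).

Definition unicritical a b d : {poly C} := a *: ('X - b%:P) ^+ d + b%:P.

Lemma size_unicritical a b d : a != 0 -> (0 < d)%N -> size (unicritical a b d) = d.+1.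
Proof.
move=> a0 d0; rewrite /unicritical size_polyDl size_scale// size_exp_XsubC//.
by rewrite ltnS (leq_trans (size_polyC_leq1 _)).
Qed.

Lemma nm_unicritical a b d z :
  nm ((unicritical a b d).[z] - b) = nm a * nm (z - b) ^+ d.
Proof. by rewrite /unicritical !hornerE addrK Normc.normcM nmX. Qed.

Lemma unicritical_critical a b d z : a != 0 -> (1 < d)%N ->
  (unicritical a b d)^`().[z] = 0 -> (unicritical a b d).[z] = b.
Proof.
move=> a0 d1; rewrite /unicritical derivD derivC addr0 derivZ deriv_exp derivXsubC mul1r.
rewrite hornerZ hornerMn horner_exp !hornerE => /eqP.
rewrite mulf_eq0 (negPf a0) /= mulrn_eq0 expf_eq0 => /orP[/eqP d0|/andP[_ /eqP zb]].
  by move: d1; rewrite d0.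
by rewrite zb expr0n eqn0Ngt ltnW// mulr0 add0r.
Qed.

End Unicritical.

(** * Small coefficients: the threshold of the first statement *)

Section PartOne.
Variable R : realType.
Local Notation C := R[i].
Variables (h1 : {poly C}) (I : finType) (d : I -> nat) (b : I -> C).
Hypotheses (size_h1 : (2 < size h1)%N) (hd : forall j, (2 <= d j)%N)
  (hG1 : classG (generated [set h1])) (hb : forall j, (filled_Julia h1)° (b j)).

Local Notation K := (filled_Julia h1).
Local Notation G1 := (generated [set h1]).
Local Notation hh a := (fun j => unicritical (a j) (b j) (d j)).
Local Notation G a := (generated ([set h1] `|` range (hh a))).

(** Every element of the semigroup has [h1] as innermost factor, so a critical point of [h1] is
    critical for all of them and its orbit lies in the bounded postcritical set. *)
Lemma critical_point_filled_Julia z : h1^`().[z] = 0 -> K z.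
Proof.
move=> hz; case: hG1 => _ _ /bounded_nmP [M hM].
apply/KhatP; exists M => g Gg; apply: hM; apply: subset_closure.
apply: postcritical_Some => //.
have [f ->] : exists f, g = f \Po h1.
  elim: Gg => {g} [_ ->|f g _ _ _ [g' ->]]; first by exists 'X; rewrite comp_polyX.
  by exists (f \Po g'); rewrite comp_polyA.
by rewrite deriv_comp hornerM hz mulr0.
Qed.

Lemma interior_radius : exists2 eps : R, 0 < eps & forall j, disc (b j) eps `<=` K.
Proof.
have [|j _|eps eps0 h] := @seq_min R _ (enum I) (fun j r => disc (b j) r `<=` K).
- move=> j r r' h r'r z zb; apply: h; exact: lt_le_trans zb r'r.
- by have /interior_discP := hb j.
- by exists eps => // j; apply: h; rewrite mem_enum.
Qed.

Lemma filled_Julia_bound : exists2 rho : R, 0 < rho & forall z, K z -> nm z < rho.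
Proof.
have [rho rho0 hr] := single_escape_radius size_h1; exists rho => // z Kz.
by apply: (@Khat_bounded R _ (fun _ : unit => h1) rho rho0 hr tt); rewrite range_unit.
Qed.

Lemma perturbation (del : R) (N : nat) : 0 < del -> uniform_degree h1 del N ->
  exists2 c : R, 0 < c & forall a : I -> C, (forall j, 0 < nm (a j) < c) ->
  [/\ classG (G a), Khat (G a) = K, semi_hyperbolic (G a) &
      hyperbolic G1 -> hyperbolic (G a)].
Proof.
move=> del0 hdel; have [eps eps0 heps] := interior_radius.
have [rho rho0 hrho] := filled_Julia_bound.
(* [M] bounds |z - b j| for [z] in [K]; the summand 1 makes its powers increasing, so that M^D
   serves all exponents [d j]. *)
pose M := 1 + 2 * rho; have M1 : 1 <= M by rewrite /M lerDl mulr_ge0// ltW.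
pose D := (\max_j d j)%N.
have MD : 0 < M ^+ D by rewrite exprn_gt0// (lt_le_trans ltr01).
exists (eps / 4 / M ^+ D); first by rewrite !divr_gt0.
move=> a ha.
have a0 j : a j != 0 by rewrite -nm_gt0; case/andP: (ha j).
have size_hh j : (2 < size (hh a j))%N.
  by rewrite size_unicritical ?a0 ?(ltnW (hd j))// ltnS hd.
have hh_K j z : K z -> disc (b j) (eps / 4) (hh a j).[z].
  move=> Kz; rewrite /disc /= nm_unicritical.
  have zb : nm (z - b j) <= M.
    have := nmD z (- b j); rewrite nmN; have := hrho _ Kz.
    have := hrho _ (interior_subset (hb j)); rewrite /M; lra.
  have hz : nm (z - b j) ^+ d j <= M ^+ D.
    apply: (@le_trans _ _ (M ^+ d j)).
      by rewrite lerXn2r ?nnegrE ?nm_ge0// (le_trans ler01).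
    by rewrite ler_weXn2l//; exact: leq_bigmax.
  have /andP[aj0] := ha j; rewrite ltr_pdivlMr// => /(le_lt_trans _); apply.
  by rewrite ler_pM2l.
have hh_crit j z : (hh a j)^`().[z] = 0 -> (hh a j).[z] = b j.
  exact: unicritical_critical.
have crit := critical_point_filled_Julia.
split.
- exact: (family_classG size_h1 size_hh eps0 heps hh_K hh_crit crit).
- exact: (family_Khat size_h1 eps0 heps hh_K).
- exact: (family_semi_hyperbolic size_h1 size_hh eps0 heps hh_K hh_crit crit del0 hdel).
- exact: (family_hyperbolic size_h1 size_hh eps0 heps hh_K hh_crit crit del0 hdel).
Qed.

End PartOne.

(** * Disconnected Julia sets *)

Section Disconnectedness.
Variable R : realType.
Local Notation C := R[i].
Local Notation Sph := (sphere R).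

Lemma disconnected_across_annulus (J : set Sph) (r1 r2 : R) (p1 p2 : C) : r1 < r2 ->
  (forall x, J (Some x) -> nm x <= r1 \/ r2 <= nm x) ->
  J (Some p1) -> nm p1 <= r1 -> J (Some p2) -> r2 <= nm p2 -> ~ connected J.
Proof.
move=> r12 hJ J1 n1 J2 n2 cJ; pose B := J `&` Some @` [set x : C | nm x < r2].
have BJ : B = J.
  apply: cJ.
  - by exists (Some p1); split=> //; exists p1 => //=; exact: le_lt_trans r12.
  - exists (Some @` [set x : C | nm x < r2]) => //; apply: open_Some.
    have -> : [set x : C | nm x < r2] = disc 0 r2.
      by apply/seteqP; split=> x; rewrite /disc /= subr0.
    exact: open_disc.
  - exists (~` ([set None] `|` Some @` [set x : C | r1 < nm x])).
      by apply: open_closedC; exact: open_infinity.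
    apply/seteqP; split=> [z [Jz [x /= xr xz]]|[x|] [Jx nx]].
    + subst z; split=> // -[//|[y /= yr [yx]]]; subst y.
      have [xr1|rx] := hJ x Jz; first by move: yr; rewrite ltNge xr1.
      by move: xr; rewrite ltNge rx.
    + split=> //; exists x => //=; have [xr1|rx] := hJ x Jx; first exact: le_lt_trans r12.
      by exfalso; apply: nx; right; exists x => //=; exact: lt_le_trans r12 rx.
    + by exfalso; apply: nx; left.
have : B (Some p2) by rewrite BJ.
by move=> [_ [x /= xr [xp]]]; move: xr; rewrite xp ltNge n2.
Qed.

(* On the annulus a word whose first applied letter is in P takes values in K,
   and any other word escapes at a rate depending only on its length. *)
Lemma Fatou_annulus (T : finType) (gen : T -> {poly C}) (P : pred T) (K : set C)
    (rho L r1 r2 : R) x : (forall t, (1 < size (gen t))%N) -> 0 < L ->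
  (forall t z, L <= nm z -> 2 * nm z <= nm (gen t).[z]) ->
  (forall t z, ~~ P t -> r1 < nm z -> L <= nm (gen t).[z]) ->
  (forall t z, P t -> nm z < r2 -> K (gen t).[z]) ->
  (forall s z, K z -> K (word gen s).[z]) -> (forall z, K z -> nm z <= rho) ->
  r1 < nm x < r2 -> Fatou (generated (range gen)) (Some x).
Proof.
move=> sg L0 escape out into Kword Kb /andP[x1 x2].
pose r := Num.min (nm x - r1) (r2 - nm x) / 4.
have r0 : 0 < r by rewrite divr_gt0// lt_min !subr_gt0 x1.
have rx1 : 4 * r <= nm x - r1 by rewrite /r mulrC divfK ?pnatr_eq0// ge_min lexx.
have rx2 : 4 * r <= r2 - nm x by rewrite /r mulrC divfK ?pnatr_eq0// ge_min lexx orbT.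
have in_annulus z : disc x (4 * r) z -> r1 < nm z /\ nm z < r2.
  rewrite /disc /= => zx; have := nm_leD x z; have := nm_leD z x.
  by rewrite (nmB x z); split; lra.
exists (Some @` disc x r).
  by split; [apply/open_Some/open_disc|exists x => //; exact: disc_center].
apply: normal_of_clusters => f Gf.
have /choice [w hw] : forall n, exists w : seq T * T, f n = word gen (rcons w.1 w.2).
  move=> n; have /generated_word [t [s ->]] := Gf n.
  by exists (belast t s, last t s); rewrite -lastI.
have [often|] := pselect (forall N, exists2 n, (N <= n)%N & P (w n).2).
  have /choice [phi hphi] : forall N, exists n, (N <= n)%N /\ P (w n).2.
    by move=> N; have [n Nn Pn] := often N; exists n.
  have [n z zx|l hl] := @montel R (f \o phi) x r rho r0; last first.
    by exists l; apply: clusters_subsequence hl => n; exact: (hphi n).1.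
  rewrite /= hw word_rcons horner_comp; apply/Kb/Kword/into; first exact: (hphi n).2.
  by have [] := in_annulus z; move: zx; rewrite /disc /=; lra.
move=> /existsNP[N0 hN0].
have nP n : ~~ P (w (n + N0)%N).2.
  apply/negP => Pn; apply: hN0; exists (n + N0)%N => //; exact: leq_addl.
(* The first letter reaches modulus [L] without a guaranteed doubling; halving [L] restores the rate
   2^size for the whole word. *)
have L20 : 0 < L / 2 by rewrite divr_gt0.
have [|l hl] := @escape_clusters R T gen sg (fun n => rcons (w (n + N0)%N).1 (w (n + N0)%N).2)
    (Some @` disc x r) (L / 2) L20.
  move=> n _ [z zx [<-]]; rewrite word_rcons horner_comp size_rcons.
  have [zr1 _] : r1 < nm z /\ nm z < r2.
    by apply: in_annulus; move: zx; rewrite /disc /=; lra.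
  have hL := out _ _ (nP n) zr1.
  apply: le_trans (word_escape escape (w (n + N0)%N).1 hL).
  by rewrite exprSr -mulrA [2 * _]mulrC divfK ?pnatr_eq0// ler_pM2l ?exprn_gt0.
exists l; apply: (@clusters_subsequence _ f (fun n => n + N0)%N) => [n|].
  exact: leq_addr.
by have <- : word gen \o (fun n => rcons (w (n + N0)%N).1 (w (n + N0)%N).2) =
  f \o (fun n => n + N0)%N by apply/funext => n; rewrite /= hw.
Qed.

(** One exponent [e], possibly below the degrees, serves all maps of the group; lowering the
    exponent is allowed for |z| >= 1, hence [1 <= r]. *)
Lemma common_growth (T : finType) (gen : T -> {poly C}) (P : pred T) (e : nat) : (0 < e)%N ->
  (forall t, P t -> (e < size (gen t))%N) -> exists c r : R, [/\ 0 < c, 1 <= r &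
    forall t z, P t -> r <= nm z -> c * nm z ^+ e <= nm (gen t).[z]].
Proof.
move=> e0 sg.
have /choice [cr hcr] : forall t, exists cr : R * R, 0 < cr.1 /\ (P t ->
    forall z, cr.2 <= nm z -> 1 <= nm z -> cr.1 * nm z ^+ e <= nm (gen t).[z]).
  move=> t; have [Pt|nPt] := boolP (P t); last by exists (1, 0); split.
  have [|c [r [c0 r0 h]]] := @poly_growth R (gen t).
    by apply: leq_ltn_trans (sg t Pt).
  exists (c, r); split=> //= _ z rz z1; apply: le_trans (h z rz).
  rewrite ler_pM2l// ler_weXn2l// -ltnS (ltn_predK (sg t Pt)).
  exact: sg.
have [|t _|c c0 hc] := @seq_min R _ (enum T) (fun t c => c <= (cr t).1).
- by move=> t u v ut vu; exact: le_trans vu ut.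
- by exists (cr t).1 => //; exact: (hcr t).1.
exists c, (1 + \sum_t `|(cr t).2|); split=> // [|t z Pt].
  by rewrite lerDl sumr_ge0.
rewrite (bigD1 t)//= => rz.
have s0 : 0 <= \sum_(i | i != t) `|(cr i).2| by rewrite sumr_ge0.
have := ler_norm (cr t).2; have := normr_ge0 (cr t).2 => h1 h2.
apply: le_trans ((hcr t).2 Pt z _ _); [|lra|lra].
rewrite ler_wpM2r ?exprn_ge0 ?nm_ge0//; apply: hc; exact: mem_enum.
Qed.

Lemma exists_boundary_point (h : {poly C}) x : (2 < size h)%N -> filled_Julia h x ->
  exists y, boundary_point h y.
Proof.
move=> sh Kx; have [rho rho0 hr] := single_escape_radius sh.
have Kb z : filled_Julia h z -> nm z < rho.
  move=> Kz; apply: (@Khat_bounded R _ (fun _ : unit => h) rho rho0 hr tt).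
  by rewrite range_unit.
have nK : ~ (filled_Julia h)° rho%:C.
  by move=> /interior_subset /Kb; rewrite nm_real ger0_norm ?ltxx// ltW.
have [[y by_ _]|none] := near_boundary sh (2 * rho) nK; first by exists y.
exfalso; apply: (none x) => //; rewrite /disc /=.
have := nmD x (- rho%:C); rewrite nmN nm_real (ger0_norm (ltW rho0)).
by have := Kb _ Kx; lra.
Qed.

End Disconnectedness.

(** * Separation of scales and the choice of coefficients *)

Section PartTwo.
Variable R : realType.
Local Notation C := R[i].
Variables (h1 : {poly C}) (I : finType) (d : I -> nat) (b : I -> C).
Hypotheses (size_h1 : (2 < size h1)%N) (hd : forall j, (2 <= d j)%N)
  (hb : forall j, (filled_Julia h1)° (b j)).

Local Notation K := (filled_Julia h1).
Local Notation hh a := (fun j => unicritical (a j) (b j) (d j)).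
Local Notation G a := (generated ([set h1] `|` range (hh a))).

(* Scales: with rho = sigma^(e e1), the disc |z| <= 4 rho contains J(G); its
   preimages under the maps outside S lie in |z| <= k' sigma^e, and the
   preimages of the complement of K under the maps in S lie in
   |z| >= k sigma^(e1 (e - 1)).  Since e < e1 (e - 1) an annulus separates them. *)
Lemma scales (e e1 : nat) (c R0 C0 eps : R) : (2 <= e)%N -> (2 <= e1)%N ->
  (e < e1 * e.-1)%N -> 0 < c -> 1 <= R0 -> 0 < C0 -> 0 < eps ->
  exists rho r1 r2 : R, [/\ 1 <= rho, rho ^- e.-1 < c & r1 < r2] /\
    [/\ R0 <= r1, 4 * rho <= C0 * r1 ^+ e1, rho ^- e.-1 * (r2 + R0) ^+ e < eps,
        r2 <= rho - R0 & 2 <= C0 * rho].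
Proof.
move=> e2 e12 ee1 c0 R01 C00 eps0.
(* [k'] is chosen for C0 k'^e1 >= 4, and [k] for (2k)^e < eps together with r2 <= rho / 4. *)
pose k' := 1 + 4 / C0; pose k := Num.min (1 / 4) (eps / 4).
have k'1 : 1 <= k' by rewrite lerDl divr_ge0// ltW.
have k0 : 0 < k by rewrite lt_min !divr_gt0.
have k4 : k <= 1 / 4 by rewrite /k ge_min lexx.
have keps : k <= eps / 4 by rewrite /k ge_min lexx orbT.
(* [s] is the sigma of the scales. Exceeding k'/k gives k' s^e < k s^(e+1) <= k s^(e1 (e-1)), that
   is r1 < r2; exceeding 1/c makes rho^-(e-1) smaller than [c]. *)
pose s := 1 + R0 + k' / k + 1 / c.
have q0 : 0 <= k' / k by rewrite divr_ge0 ?(ltW k0)// (le_trans ler01).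
have q1 : 0 < 1 / c by rewrite divr_gt0.
have s1 : 1 <= s by rewrite /s; lra.
have sR : R0 <= s by rewrite /s; lra.
have sk : k' / k < s by rewrite /s; lra.
have sc : 1 / c < s by rewrite /s; lra.
clearbody s.
have s0 : 0 < s by rewrite (lt_le_trans ltr01).
have kk' : k' < k * s by move: sk; rewrite ltr_pdivrMr// mulrC.
have e0 : (0 < e)%N by apply: leq_trans e2.
have e10 : (0 < e1)%N by apply: leq_trans e12.
pose rho := s ^+ (e * e1); pose r1 := k' * s ^+ e; pose r2 := k * s ^+ (e1 * e.-1).
have se1 n : 1 <= s ^+ n by rewrite exprn_ege1.
have sle m n : (m <= n)%N -> s ^+ m <= s ^+ n by move=> mn; rewrite ler_weXn2l.
have s_rho : s <= rho by rewrite -[leLHS]expr1; apply: sle; rewrite muln_gt0 e0.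
have R0r1 : R0 <= r1.
  apply: le_trans sR _; rewrite -[leLHS]mul1r ler_pM//; first exact: ltW.
  by rewrite -[leLHS]expr1; exact: sle.
have r12 : r1 < r2.
  rewrite /r2; apply: (@lt_le_trans _ _ (k * s ^+ e.+1)); last by rewrite ler_pM2l// sle.
  by rewrite exprS mulrA /r1 ltr_pM2r// exprn_gt0.
have r2rho : r2 <= rho / 4.
  have : s ^+ (e1 * e.-1) <= rho by apply: sle; rewrite mulnC leq_mul2r leq_pred orbT.
  move=> h; apply: (@le_trans _ _ (1 / 4 * rho)); last by lra.
  by apply: ler_pM => //; [exact: ltW|rewrite exprn_ge0// ltW].
have rho1 : 1 <= rho by exact: se1.
have rho0 : 0 < rho by rewrite (lt_le_trans ltr01).
have e1' : (0 < e.-1)%N by rewrite -ltnS (ltn_predK e2).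
have rhoe0 : 0 < rho ^+ e.-1 by rewrite exprn_gt0.
exists rho, r1, r2; split; split=> //.
- rewrite -[c]invrK ltf_pV2 ?posrE ?invr_gt0// -div1r.
  apply: (lt_le_trans sc); apply: (le_trans s_rho).
  by rewrite -[leLHS]expr1 ler_weXn2l.
- rewrite /r1 exprMn -exprM -/rho mulrA ler_pM2r//.
  have : k' <= k' ^+ e1 by rewrite -[leLHS]expr1 ler_weXn2l.
  move=> h; have : C0 * k' <= C0 * k' ^+ e1 by rewrite ler_pM2l.
  by rewrite /k' mulrDr mulrCA divff ?gt_eqF// !mulr1; lra.
- rewrite mulrC ltr_pdivrMr//.
  apply: (@le_lt_trans _ _ ((2 * k) ^+ e * rho ^+ e.-1)).
    have -> : (2 * k) ^+ e * rho ^+ e.-1 = (2 * r2) ^+ e.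
      rewrite /r2 /rho mulrA [in RHS]exprMn -!exprM; congr (_ * s ^+ _).
      by rewrite -mulnA mulnC.
    by rewrite lerXn2r ?nnegrE//; lra.
  rewrite ltr_pM2r//; apply: (@le_lt_trans _ _ (2 * k)); last by lra.
  by rewrite -[leRHS]expr1 ler_wiXn2l//; lra.
- by lra.
- have : 4 / C0 <= rho.
    apply: (@le_trans _ _ k'); first by rewrite /k' lerDr.
    apply: le_trans s_rho; apply/ltW/(lt_le_trans kk').
    by rewrite ler_piMl ?ltW//; lra.
  by rewrite ler_pdivrMr// mulrC; lra.
Qed.

Lemma disconnected_parameters (S : pred I) (j0 : I) (e e1 : nat) (c : R) : 0 < c -> S j0 ->
  (forall j, S j -> d j = e) -> (2 <= e)%N -> (2 <= e1)%N -> (e < e1 * e.-1)%N ->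
  (e1 < size h1)%N -> (forall j, ~~ S j -> (e1 <= d j)%N) ->
  exists2 a : I -> R, (forall j, 0 < a j < c) &
    Khat (G (fun j => (a j)%:C)) = K -> ~ connected (Julia (G (fun j => (a j)%:C))).
Proof.
move=> c0 Sj0 dS e2 e12 ee1 e1h1 e1d.
have c20 : 0 < c / 2 by rewrite divr_gt0.
have c2c : c / 2 < c by lra.
have c2n : (c / 2)%:C != 0 :> C by rewrite -nm_gt0 nm_real ger0_norm// ltW.
have [eps eps0 heps] := interior_radius hb.
have [rK rK0 hrK] := filled_Julia_bound size_h1.
(* The maps outside [S] get the coefficient [c / 2] before [rho] is chosen, so that the growth
   constants do not depend on [rho]; inside [S] these maps are placeholders. *)
pose gen0 (t : option I) := if t is Some j then unicritical (c / 2)%:C (b j) (d j) else h1.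
pose P (t : option I) := if t is Some j then S j else false.
have [|t|C0 [r0 [C00 r01 growth]]] := @common_growth R _ gen0 (predC P) e1.
- exact: leq_trans e12.
- case: t => [j|] //= nS; rewrite size_unicritical// ?ltnS ?e1d//.
  by apply: leq_trans (hd j).
pose R0 := r0 + rK.
have R01 : 1 <= R0 by rewrite /R0; lra.
have r0R0 : r0 <= R0 by rewrite /R0; lra.
have rKR0 : rK <= R0 by rewrite /R0; lra.
have [rho [r1 [r2 [[rho1 rhoc r12] [R0r1 esc1 into r2rho C0rho]]]]] :=
  scales e2 e12 ee1 c0 R01 C00 eps0.
have rho0 : 0 < rho by rewrite (lt_le_trans ltr01).
(* The coefficient with as_ rho^e = rho: the disc of radius [rho] about [b j] is then invariant
   under [hh aC j] for [j] in [S]. *)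
pose as_ := rho ^- e.-1.
have as0 : 0 < as_ by rewrite invr_gt0 exprn_gt0.
have as_rho : as_ * rho ^+ e = rho.
  by rewrite -(prednK (ltnW e2)) exprSr mulrA mulVf ?mul1r// gt_eqF// exprn_gt0.
pose a j := if S j then as_ else c / 2.
have a0 j : 0 < a j by rewrite /a; case: ifP.
exists a => [j|HK]; first by rewrite a0 /a; case: ifP.
pose aC j : C := (a j)%:C.
have aC0 j : aC j != 0 by rewrite -nm_gt0 nm_real ger0_norm// ltW.
have nm_aC j : nm (aC j) = a j by rewrite nm_real ger0_norm// ltW.
have size_hh j : (2 < size (hh aC j))%N.
  by rewrite size_unicritical ?(ltnW (hd j))// ltnS hd.
pose gen := family_gen h1 (hh aC).
have rg : range gen = [set h1] `|` range (hh aC) := range_family_gen _ _.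
have sgen t : (1 < size (gen t))%N by apply/ltnW/size_family_gen.
have bR j : nm (b j) < rK by exact: hrK (interior_subset (hb j)).
have gen_group1 t : ~~ P t -> gen t = gen0 t.
  by case: t => [j|] //= /negPf nS; rewrite /aC /a nS.
have far_group1 t z : ~~ P t -> r1 < nm z -> 4 * rho <= nm (gen t).[z].
  move=> nP zr; rewrite gen_group1//; apply: (le_trans esc1).
  have z0 : r0 <= nm z by lra.
  apply: le_trans (growth t z nP z0); rewrite ler_pM2l//.
  by rewrite lerXn2r ?nnegrE ?nm_ge0//; lra.
have escape t z : 4 * rho <= nm z -> 2 * nm z <= nm (gen t).[z].
  move=> zr; have R0rho : R0 <= rho by lra.
  have [Pt|nP] := boolP (P t); last first.
    rewrite gen_group1//; have z0 : r0 <= nm z by lra.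
    apply: le_trans (growth t z nP z0).
    apply: (@le_trans _ _ (C0 * nm z ^+ 2)); last first.
      by rewrite ler_pM2l// ler_weXn2l//; lra.
    rewrite expr2 mulrA ler_wpM2r ?nm_ge0//; apply: (le_trans C0rho).
    by rewrite ler_pM2l//; lra.
  case: t Pt => [j|] //= Sj.
  have hz := nm_unicritical (aC j) (b j) (d j) z.
  rewrite nm_aC /a Sj dS// in hz.
  have u3 : 3 * rho <= nm (z - b j).
    by have := nm_leD z (b j); have := bR j; lra.
  have u34 : 3 / 4 * nm z <= nm (z - b j).
    by have := nm_leD z (b j); have := bR j; lra.
  have h3 : 3 * nm (z - b j) <= as_ * nm (z - b j) ^+ e.
    have ee : e = e.-1.+1 by rewrite prednK// ltnW.
    rewrite [X in _ ^+ X]ee exprSr mulrA ler_wpM2r ?nm_ge0//.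
    rewrite /as_ mulrC ler_pdivlMr ?exprn_gt0//.
    apply: (@le_trans _ _ ((3 * rho) ^+ e.-1)); last first.
      by rewrite lerXn2r ?nnegrE ?nm_ge0//; lra.
    rewrite exprMn ler_pM2r ?exprn_gt0// -[leLHS]expr1 ler_weXn2l//; first by lra.
    by rewrite -ltnS (ltn_predK e2).
  rewrite -hz -(dS j Sj) in h3.
  have := nmD (unicritical (aC j) (b j) (d j)).[z] (- b j); rewrite nmN.
  by have := bR j; lra.
have into_K t z : P t -> nm z < r2 -> K (gen t).[z].
  case: t => [j|] //= Sj zr; apply: (heps j); rewrite /disc /=.
  rewrite nm_unicritical nm_aC /a Sj dS//; apply: le_lt_trans into.
  rewrite ler_pM2l// lerXn2r ?nnegrE ?nm_ge0//; first by have := nm_ge0 z; lra.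
  by have := nmD z (- b j); rewrite nmN; have := bR j; lra.
have Kword s z : K z -> K (word gen s).[z].
  case: s => [|t s]; first by rewrite /= hornerX.
  rewrite -HK; apply: Khat_forward; rewrite -rg; apply/generated_word.
  by exists t, s.
have L0 : 0 < 4 * rho by rewrite mulr_gt0.
(* Julia points on both sides of the annulus: [p1] lies in [K], inside modulus [r1]; [p2] bounds the
   filled Julia set of [hh aC j0], which contains the disc of radius [rho] about [b j0], so its
   modulus is at least rho - R0 >= r2. *)
have [p1 bp1] := exists_boundary_point size_h1 (interior_subset (hb j0)).
have K2 : disc (b j0) rho `<=` filled_Julia (hh aC j0).
  move=> z zb; apply/KhatP; exists (rho + rK) => g.
  have -> : [set unicritical (aC j0) (b j0) (d j0)] =
      range (fun _ : unit => unicritical (aC j0) (b j0) (d j0)).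
    by rewrite range_unit.
  move=> /generated_word [t [s ->]]; move: (t :: s) => {}s.
  suff : nm ((word (fun _ : unit => unicritical (aC j0) (b j0) (d j0)) s).[z] - b j0) <= rho.
    by move=> h; have := nm_leD (word (fun _ : unit => unicritical (aC j0) (b j0) (d j0)) s).[z] (b j0);
      have := bR j0; lra.
  elim: s => [|t' s IH] /=; first by rewrite hornerX; exact: ltW.
  rewrite horner_comp nm_unicritical nm_aC /a Sj0 dS// -[leRHS]as_rho ler_pM2l//.
  by rewrite lerXn2r ?nnegrE ?nm_ge0 ?(ltW rho0)// -(dS j0 Sj0).
have [p2 bp2] := exists_boundary_point (size_hh j0) (K2 _ (disc_center _ rho0)).
apply: (@disconnected_across_annulus _ _ r1 r2 p1 p2 r12).
- move=> x Jx; have [|r1x] := leP (nm x) r1; first by left.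
  have [|xr2] := leP r2 (nm x); first by right.
  exfalso; apply: Jx; rewrite -rg.
  apply: (@Fatou_annulus _ _ gen P K rK (4 * rho) r1 r2 x sgen L0 escape far_group1 into_K) => //.
    by move=> z /hrK /ltW.
  by rewrite r1x.
- move=> Fp; apply: (boundary_Julia size_h1 bp1); apply: Fatou_mono Fp.
  exact: G1_sub_G.
- by have := hrK _ bp1.1; lra.
- move=> Fp; apply: (boundary_Julia (size_hh j0) bp2); apply: Fatou_mono Fp.
  by apply: generated_mono => _ ->; right; exists j0.
- have : rho <= nm (p2 - b j0).
    rewrite leNgt; apply/negP => h; apply: bp2.2.
    have /open_discP /(_ p2 h) [r rpos hr] := @open_disc R (b j0) rho.
    by apply/interior_discP; exists r => //; exact: subset_trans K2.
  by have := nmD p2 (- b j0); rewrite nmN; have := bR j0; lra.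
Qed.

End PartTwo.

Section PartTwoChoice.
Variable R : realType.
Local Notation C := R[i].
Variables (h1 : {poly C}) (I : finType) (d : I -> nat) (b : I -> C).
Hypotheses (size_h1 : (2 < size h1)%N) (hd : forall j, (2 <= d j)%N)
  (hb : forall j, (filled_Julia h1)° (b j)).

(** The inequality e < e1 (e - 1) holds in both cases: with S = {j0}, e = d j0 >= 3 and e1 = 2; or,
    when all d j = 2, with S everything, e = 2 and e1 = 3, the degree of [h1]. *)
Lemma disconnected_cases (c : R) (i0 : I) : 0 < c ->
  (exists j, (3 <= d j)%N) \/ size h1 = 4%N ->
  exists2 a : I -> R, (forall j, 0 < a j < c) &
    let G := generated ([set h1] `|` range (fun j => unicritical (a j)%:C (b j) (d j))) in
    Khat G = filled_Julia h1 -> ~ connected (Julia G).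
Proof.
move=> c0 h.
have [[j0 dj0]|none] := pselect (exists j, (3 <= d j)%N).
  apply: (@disconnected_parameters _ h1 I d b size_h1 hd hb (pred1 j0) j0 (d j0) 2) => //.
  - exact: eqxx.
  - by move=> j /eqP ->.
  - by lia.
have d2 j : d j = 2%N.
  apply/eqP; rewrite eqn_leq hd andbT leqNgt; apply/negP => dj; apply: none.
  by exists j.
case: h => [h|h]; first by case: none.
by apply: (@disconnected_parameters _ h1 I d b size_h1 hd hb predT i0 2 3) => //; rewrite h.
Qed.

End PartTwoChoice.

(* The index j : 'I_m.-1 stands for the index j + 2 of d_j, a_j, b_j, h_j. *)
Theorem theorem2p43 (R : realType) (m : nat) (hm : (2 <= m)%N)
    (d1 : nat) (hd1 : (2 <= d1)%N)
    (d : 'I_m.-1 -> nat) (hd : forall j, (2 <= d j)%N)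
    (h1 : {poly R[i]}) (hh1 : polyY d1 h1) (hK : (filled_Julia h1)° !=set0)
    (hG1 : classG (generated [set h1]))
    (b : 'I_m.-1 -> R[i]) (hb : forall j, (filled_Julia h1)° (b j)) :
  let h (a : 'I_m.-1 -> R[i]) (j : 'I_m.-1) : {poly R[i]} :=
    a j *: ('X - (b j)%:P) ^+ d j + (b j)%:P in
  let G (a : 'I_m.-1 -> R[i]) : set {poly R[i]} :=
    generated ([set h1] `|` range (h a)) in
  (* 1 *)
  ((semi_hyperbolic (generated [set h1]) ->
    exists2 c : R, 0 < c &
      forall a : 'I_m.-1 -> R[i], (forall j, 0 < `|a j| < c%:C) ->
      [/\ classG (G a), Khat (G a) = filled_Julia h1 & semi_hyperbolic (G a)]) /\
   (hyperbolic (generated [set h1]) ->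
    exists2 c : R, 0 < c &
      forall a : 'I_m.-1 -> R[i], (forall j, 0 < `|a j| < c%:C) ->
      [/\ classG (G a), Khat (G a) = filled_Julia h1 & hyperbolic (G a)])) /\
  (* 2 *)
  ((exists j, (3 <= d j)%N) \/ (pdeg h1 = 3%N /\ forall i j, b i = b j) ->
   (semi_hyperbolic (generated [set h1]) ->
    exists2 a : 'I_m.-1 -> R, (forall j, 0 < a j) &
      let G' := G (fun j => (a j)%:C) in
      [/\ classG_dis G', Khat G' = filled_Julia h1 & semi_hyperbolic G']) /\
   (hyperbolic (generated [set h1]) ->
    exists2 a : 'I_m.-1 -> R, (forall j, 0 < a j) &
      let G' := G (fun j => (a j)%:C) in
      [/\ classG_dis G', Khat G' = filled_Julia h1 & hyperbolic G'])).
Proof.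
move=> h G.
have size_h1 : (2 < size h1)%N by rewrite hh1.
have perturb := @perturbation _ h1 _ d b size_h1 hd hG1 hb.
have choice2 c : 0 < c ->
    (exists j, (3 <= d j)%N) \/ (pdeg h1 = 3%N /\ forall i j, b i = b j) ->
    exists2 a : 'I_m.-1 -> R, (forall j, 0 < a j < c) &
      Khat (G (fun j => (a j)%:C)) = filled_Julia h1 ->
      ~ connected (Julia (G (fun j => (a j)%:C))).
  move=> c0 h3; have m0 : (0 < m.-1)%N by rewrite -ltnS prednK// ltnW.
  apply: (disconnected_cases size_h1 hd hb (Ordinal m0) c0).
  case: h3 => [h3|[+ _]]; first by left.
  by rewrite /pdeg => h3; right; rewrite -h3 prednK// ltnW// ltnW.
have modulus (a : 'I_m.-1 -> R[i]) (c : R) :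
    (forall j, 0 < `|a j| < c%:C) -> forall j, 0 < nm (a j) < c.
  by move=> ha j; have := ha j; rewrite normC_nm !ltcR.
have modulusR (a : 'I_m.-1 -> R) (c : R) :
    (forall j, 0 < a j < c) -> forall j, 0 < nm (a j)%:C < c.
  by move=> ha j; have /andP[a0 ac] := ha j; rewrite nm_real ger0_norm ?a0// ltW.
split.
  split=> [sh|hyp].
    have [del [N [del0 hdel]]] := semi_hyperbolic_uniform_degree size_h1 sh.
    have [c c0 hc] := perturb _ _ del0 hdel; exists c => // a /modulus /hc.
    by case.
  have [del [N [del0 hdel]]] := hyperbolic_uniform_degree size_h1 hyp.
  have [c c0 hc] := perturb _ _ del0 hdel; exists c => // a /modulus /hc.
  by case=> ? ? _ /(_ hyp).
move=> cases; split=> [sh|hyp].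
  have [del [N [del0 hdel]]] := semi_hyperbolic_uniform_degree size_h1 sh.
  have [c c0 hc] := perturb _ _ del0 hdel.
  (* The coefficients lie below the threshold [c] of the first statement, which supplies everything
     except disconnectedness, including the equality [Khat = K] on which [nc] depends. *)
  have [a ha nc] := choice2 c c0 cases; have [cG KG sG _] := hc _ (modulusR _ _ ha).
  by exists a => [j|]; [case/andP: (ha j)|split=> //; split=> //; exact: nc].
have [del [N [del0 hdel]]] := hyperbolic_uniform_degree size_h1 hyp.
have [c c0 hc] := perturb _ _ del0 hdel.
have [a ha nc] := choice2 c c0 cases; have [cG KG _ /(_ hyp) hypG] := hc _ (modulusR _ _ ha).
by exists a => [j|]; [case/andP: (ha j)|split=> //; split=> //; exact: nc].
Qed.
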